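(* Let $P$ be a finite nonempty poset and let $x$ be the maximal element of a chain of maximal length in $P$. (1) If the bundle $\mathrm{bu}(x)$ is trivial, then a polytope combinatorially equivalent to $\mathcal{K}P$ is obtained from (a polytope combinatorially equivalent to) $\mathcal{K}(P- x)$ by a finite sequence of truncations of faces. (2) If $\mathrm{bu}(x)$ is nontrivial, then a polytope combinatorially equivalent to $\mathcal{K}P$ is obtained from (a polytope combinatorially equivalent to) $\mathcal{K}\big(P-(\mathrm{bu}(x)- \{x\})\big)\times\Delta_{|\mathrm{bu}(x)|-1}$ by a finite sequence of truncations of faces. Here $P-x$ and $P-(\mathrm{bu}(x)-\{x\})$ denote induced subposets and $\Delta_k$ is the $k$-dimensional simplex.
   Context: For a finite poset $(P,\preceq)$: a lower set is $L\subseteq P$ with $y\preceq x\in L\Rightarrow y\in L$; $\partial x=\{y: y\prec x\}$; the bundle of $x$ is $\mathrm{bu}(x)=\{y:\partial y=\partial x\}$, trivial if $\mathrm{bu}(x)=\{x\}$; a subset is connected if it induces a connected subgraph of the Hasse diagram; a lower set $L$ is filled if for every $y\in P$ with $\partial y\subseteq L$ we have $L\cap\mathrm{bu}(y)\ne\emptyset$; a tube is a filled connected lower set; a tubing is a set of tubes, none equal to $P$, pairwise disjoint or nested, such that the union of the tubes of every nonempty subset is filled. The poset associahedron $\mathcal{K}P$ is a convex polytope whose poset of nonempty faces (ordered by inclusion) is isomorphic to the set of tubings of $P$ ordered by reverse containment, well-defined up to combinatorial equivalence (for the empty poset it is a point). Truncating a face $F$ of a convex polytope $Q$ means intersecting $Q$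 with a closed half-space whose boundary hyperplane strictly separates the vertices of $F$ from the remaining vertices of $Q$, the half-space containing the latter.
   Formalization: A tubing is also required not to have its tubes jointly cover P (automatic for connected P); without this, for a disconnected poset such as a two-element antichain the tubings are not the faces of any polytope, so KP would be undefined. *)

(* Defs.v *)
From HB Require Import structures.
From Stdlib Require Import Relation_Operators.
From mathcomp Require Import all_boot all_order all_algebra.

Set Implicit Arguments.
Unset Strict Implicit.
Unset Printing Implicit Defensive.

Import Order.TTheory GRing.Theory Num.Theory.

Section Tubings.

Context {d : Order.disp_t} {P : finPOrderType d}.
Implicit Types (x y : P) (A L C : {set P}) (T : {set {set P}}).

Definition lower_set L : bool :=
  [forall x in L, forall y, (y <= x)%O ==> (y \in L)].

Definition boundary x : {set P} := [set y | (y < x)%O].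

Definition bundle x : {set P} := [set y | boundary y == boundary x].

Definition covered_by y x : bool :=
  (y < x)%O && [forall z, ~~ ((y < z)%O && (z < x)%O)].

Definition hasse : rel P := [rel y x | covered_by y x || covered_by x y].

Definition hasse_connected A : bool :=
  [forall x in A, forall y in A,
     connect [rel u v | [&& u \in A, v \in A & hasse u v]] x y].

Definition filled L : bool :=
  [forall y, (boundary y \subset L) ==> (L :&: bundle y != set0)].

(* The empty set counts as connected, but it is filled only when [P] is
   empty, where it equals [P] and so belongs to no tubing. *)
Definition tube L : bool := [&& filled L, hasse_connected L & lower_set L].

(* The last clause says that the tubes of a nonempty tubing do not together
   cover [P]. When [P] is connected it follows from the others, see
   [cover_neq_setT]; without it the tubings of a disconnected poset would not
   be the faces of a polytope: for two incomparable points [a] and [b], the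
   set {{a}, {b}} has to be excluded to get a segment. *)
Definition tubing T : bool :=
  [&& [forall t in T, tube t && (t != [set: P])],
      [forall s in T, forall t in T,
         [|| s \subset t, t \subset s | [disjoint s & t]]],
      [forall S : {set {set P}},
         (S \subset T) && (S != set0) ==> filled (cover S)]
    & (T != set0) ==> (cover T != [set: P])].

Definition chain C : bool := [forall a in C, forall b in C, (a >=< b)%O].

Definition top_of_longest_chain x : Prop :=
  exists C : {set P},
    [/\ chain C,
        forall D : {set P}, chain D -> (#|D| <= #|C|)%N,
        x \in C
      & forall y, y \in C -> (y <= x)%O].

Lemma cover_neq_setT T :
  hasse_connected [set: P] -> T != set0 ->
  {in T, forall t : {set P}, tube t && (t != [set: P])} ->
  {in T &, forall s t : {set P}, [|| s \subset t, t \subset s | [disjoint s & t]]} ->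
  cover T != [set: P].
Proof.
move=> cP /set0Pn[t0 Tt0] tubT nestT; apply/eqP => covT.
have [t Tt tmax] := @arg_maxnP _ t0 [in T] (fun t => #|t|) Tt0.
have /andP[/and3P[ft _ lt] tP] := tubT t Tt.
have [q qNt] : exists q, q \notin t.
  apply/existsP; rewrite -negb_forall; apply: contra tP => /forallP tT.
  by apply/eqP/setP => z; rewrite inE tT.
have [p pt] : exists p, p \in t.
  case: (posnP #|boundary q|) => [/eqP|].
    rewrite cards_eq0 => /eqP q0.
    have := forallP ft q; rewrite q0 sub0set /= => /set0Pn[z].
    by rewrite inE => /andP[zt _]; exists z.
  rewrite card_gt0 => _; apply/set0Pn/negP => /eqP t_0.
  have [m _ mmin] := @arg_minnP _ q predT (fun m => #|boundary m|) isT.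
  have m0 : boundary m = set0.
    apply/setP => z; rewrite in_set0; apply/negP => zm.
    have := mmin z isT; apply/negP; rewrite -ltnNge.
    apply: proper_card; apply/properP; split.
      by apply/subsetP => w; move: zm; rewrite !inE => /[swap]; exact: lt_trans.
    by exists z; rewrite // inE ltxx.
  by have := forallP ft m; rewrite m0 t_0 sub0set set0I eqxx.
have lower s a b : s \in T -> b \in s -> (a <= b)%O -> a \in s.
  move=> /tubT/andP[/and3P[_ _ ls] _] bs ab.
  by have /forallP/(_ a)/implyP/(_ ab) := forall_inP ls b bs.
have /connectP[r] := forall_inP (forall_inP cP p (in_setT p)) q (in_setT q).
elim: r p pt => [|v r IH] u ut /=; first by move=> _ qu; rewrite qu ut in qNt.
case/andP; rewrite !inE /= => huv rp qr.
have [vt|vNt] := boolP (v \in t); first exact: IH vt rp qr.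
have : v \in cover T by rewrite covT inE.
case/bigcupP => s Ts vs.
case/or3P: (nestT s t Ts Tt) => [/subsetP st|ts|dst].
- by rewrite st in vNt.
- have := tmax s Ts; apply/negP; rewrite -ltnNge.
  by apply: proper_card; apply/properP; split => //; exists v.
- case/orP: huv => /andP[/ltW uv _].
    by move/pred0P: dst => /(_ u) /=; rewrite ut (lower s u v).
  by rewrite (lower t v u) in vNt.
Qed.

End Tubings.

Section InducedPoset.

Context {d : Order.disp_t} {P : finPOrderType d}.

Definition induced (A : {set P}) : Type := {y : P | y \in A}.

Variable A : {set P}.
HB.instance Definition _ := SubType.on (induced A).
HB.instance Definition _ := [Finite of induced A by <:].
HB.instance Definition _ := [SubChoice_isSubPOrder of induced A by <: with d].

End InducedPoset.

From mathcomp Require Import classical_sets functions reals.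

Local Open Scope classical_set_scope.
Local Open Scope ring_scope.

Section Polytopes.

Context {R : realType}.

Definition dotp {n} (u v : 'rV[R]_n) : R := \sum_i u 0 i * v 0 i.

Definition convex_hull {n N} (v : 'I_N -> 'rV[R]_n) : set 'rV[R]_n :=
  [set x | exists w : 'I_N -> R,
     [/\ forall i, 0 <= w i, \sum_i w i = 1 & x = \sum_i w i *: v i]].

Definition polytope {n} (Q : set 'rV[R]_n) : Prop :=
  exists N (v : 'I_N -> 'rV[R]_n), Q = convex_hull v.

(* Only nonempty faces; [Q] itself is the face cut out by [c = 0], [b = 0]. *)
Definition face {n} (Q F : set 'rV[R]_n) : Prop :=
  F !=set0 /\
  exists (c : 'rV[R]_n) (b : R),
    (forall x, Q x -> dotp c x <= b) /\ F = Q `&` [set x | dotp c x = b].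

Definition vertex {n} (Q : set 'rV[R]_n) (v : 'rV[R]_n) : Prop :=
  face Q [set v].

Definition truncation {n} (Q Q' : set 'rV[R]_n) : Prop :=
  exists (F : set 'rV[R]_n) (c : 'rV[R]_n) (b : R),
    [/\ face Q F,
        c != 0,
        forall v, vertex Q v -> F v -> b < dotp c v,
        forall v, vertex Q v -> ~ F v -> dotp c v < b
      & Q' = Q `&` [set x | dotp c x <= b]].

Definition iterated_truncation {n} : set 'rV[R]_n -> set 'rV[R]_n -> Prop :=
  clos_refl_trans _ truncation.

Definition prod_set {m n} (Q : set 'rV[R]_m) (Q' : set 'rV[R]_n) :
    set 'rV[R]_(m + n) :=
  [set z | Q (lsubmx z) /\ Q' (rsubmx z)].

(* The [k]-dimensional simplex in R^(k+1). *)
Definition simplex k : set 'rV[R]_k.+1 :=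
  [set x | (forall i, 0 <= x 0 i) /\ \sum_i x 0 i = 1].

Definition order_isomorphic {U V : Type}
    (A : set U) (leU : U -> U -> Prop) (B : set V) (leV : V -> V -> Prop) :=
  exists f : U -> V,
    set_bij A B f /\
    forall a a', A a -> A a' -> (leU a a' <-> leV (f a) (f a')).

Definition combinatorially_equivalent {m n}
    (Q : set 'rV[R]_m) (Q' : set 'rV[R]_n) : Prop :=
  order_isomorphic (face Q) (fun F G => F `<=` G)
                   (face Q') (fun F G => F `<=` G).

(* The poset associahedron is defined only up to combinatorial equivalence:
   this says that [Q] is one of its realizations. *)
Definition poset_associahedron {d : Order.disp_t} (P : finPOrderType d) {n}
    (Q : set 'rV[R]_n) : Prop :=
  polytope Q /\
  order_isomorphic (face Q) (fun F G => F `<=` G)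
    [set T : {set {set P}} | tubing T] (fun T T' => T' \subset T).

End Polytopes.

Arguments simplex {R} k.

(* Main.v *)
(** Realize a simple polytope by facet inequalities and describe it by its tight
    sets: the sets of inequalities that are equalities at some point. These are
    its faces, with inclusion reversed, and cutting off the face of a tight set
    [s] by a hyperplane close to it changes them by the stellar subdivision at
    [s]. So it suffices to pass between two complexes of tubings by stellar
    subdivisions, one for each tube of [P] that is not a facet at the start.

    Write [D] for the boundary of [x]. If the bundle of [x] is trivial, the tubes
    of [P] that do not come from a tube of [P - x] are the [L] containing [x] with
    [L - x] disconnected; [L] is placed at the simplex of the components of
    [L - x], in order of decreasing cardinality.

    If the bundle [b] is nontrivial, let [W] be the connected component of [x]
    in [P]. The facets of the simplex become the tubes [W - y] for [y] in [b],
    and a tube [M] of the smaller poset with [D] inside [M] becomes [M + b]. A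
    tube [L] with [D] inside [L] and not containing [b] is placed at the simplex
    made of [L + b] (unless it is [W]) and the [W - y] for [y] in [b - L], in
    order of increasing cardinality.

    In both cases the complex obtained after some of the cuts is given by
    explicit conditions on sets of tubes, from which each step is checked. *)

From Stdlib Require Import Relation_Operators.
Require Import Defs.
From mathcomp Require Import all_boot all_order all_algebra.
From mathcomp Require Import ring lra.
From mathcomp Require Import boolp classical_sets functions reals.
(* Imported again so that [set0], [subsetP], [inE] ... are those of finite sets. *)
From mathcomp Require Import fintype finset.

Set Implicit Arguments.
Unset Strict Implicit.
Unset Printing Implicit Defensive.

Import Order.TTheory GRing.Theory Num.Theory.

(** * Polyhedra and their tight sets *)

Local Open Scope ring_scope.

(** A truncation is a cut by an actual half-space, and the face poset does not tell where the
    hyperplanes lie; so every stage keeps an explicit system of inequalities. During the cuts these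
    are indexed by all subsets of [P]: an inequality that is never tight may be replaced at will,
    and each new facet takes over such an idle index. Downward closure of the family of tight sets
    encodes simplicity, which makes a cut a stellar subdivision.

    The realization of the smaller poset associahedron has to be constructed as well. It comes from
    the same truncations, by induction on the number of elements, which is why tops of longest
    chains are shown to exist.

    The longest chain enters through one consequence: every element of [bundle x] is maximal. So
    adding or removing bundle elements leaves lower sets lower, as long as [boundary x] is present.

    The order of the cuts excludes crossings: a tube crossing [L] would, together with members of
    the simplex of [L], complete the simplex of another tube, larger than [L] in the first case and
    smaller in the second, and that simplex has already been cut off. *)

Section DotProduct.
Context {R : realType} {n : nat}.
Implicit Types u v x y : 'rV[R]_n.

Lemma dotpDr u x y : dotp u (x + y) = dotp u x + dotp u y.
Proof. by rewrite -big_split; apply: eq_bigr => i _; rewrite mxE mulrDr. Qed.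

Lemma dotpZr u t x : dotp u (t *: x) = t * dotp u x.
Proof. by rewrite mulr_sumr; apply: eq_bigr => i _; rewrite mxE mulrCA. Qed.

Lemma dotpBr u x y : dotp u (x - y) = dotp u x - dotp u y.
Proof. by rewrite -scaleN1r dotpDr dotpZr mulN1r. Qed.

Lemma dotpNl u x : dotp (- u) x = - dotp u x.
Proof. by rewrite -sumrN; apply: eq_bigr => i _; rewrite mxE mulNr. Qed.

Lemma dotp0l x : dotp 0 x = 0.
Proof. by apply: big1 => i _; rewrite mxE mul0r. Qed.

Lemma dotp_suml I (r : seq I) (P : pred I) (a : I -> 'rV[R]_n) x :
  dotp (\sum_(i <- r | P i) a i) x = \sum_(i <- r | P i) dotp (a i) x.
Proof.
rewrite exchange_big; apply: eq_bigr => j _ /=.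
by rewrite summxE mulr_suml.
Qed.

Lemma dotp_sumr I (r : seq I) (P : pred I) u (x : I -> 'rV[R]_n) :
  dotp u (\sum_(i <- r | P i) x i) = \sum_(i <- r | P i) dotp u (x i).
Proof.
rewrite exchange_big; apply: eq_bigr => j _ /=.
by rewrite summxE mulr_sumr.
Qed.

End DotProduct.

Lemma pos_lower_bound {R : realType} (I : finType) (f : I -> R) :
  exists2 e, 0 < e & forall i, 0 < f i -> e < f i.
Proof.
(* The summand 1 makes [s] positive even without indices, and strictly larger than each
   reciprocal. *)
pose s := 1 + \sum_(i | 0 < f i) (f i)^-1.
have s_gt0 : 0 < s.
  by rewrite ltr_wpDr // sumr_ge0 // => i /ltW; rewrite invr_ge0.
exists s^-1; first by rewrite invr_gt0.
move=> i fi; rewrite -[f i]invrK ltf_pV2 ?posrE ?invr_gt0 //.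
rewrite /s (bigD1 i) //= addrCA ltrDl ltr_wpDr //.
by rewrite sumr_ge0 // => j /andP[/ltW]; rewrite invr_ge0.
Qed.

Section Polyhedra.
Context {R : realType} {n : nat}.
Implicit Types (Q F : set 'rV[R]_n) (Z : 'rV[R]_n -> Prop) (x y v c : 'rV[R]_n).

Definition affine Z : Prop :=
  forall (J : finType) (w : J -> R) (v : J -> 'rV[R]_n),
    \sum_j w j = 1 -> (forall j, Z (v j)) -> Z (\sum_j w j *: v j).

Lemma affine_line Z x y t : affine Z -> Z x -> Z y -> Z (x + t *: (y - x)).
Proof.
move=> Zaff Zx Zy.
have := Zaff bool (fun j => if j then t else 1 - t) (fun j => if j then y else x).
rewrite !big_bool /= subrKC => /(_ erefl).
rewrite scalerBl scale1r scalerBr addrCA; apply; by case.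
Qed.

Definition bounded Q : Prop := exists r, forall x j, Q x -> `|x 0 j| <= r.

Context (I : finType).
Implicit Types (a : I -> 'rV[R]_n) (b : I -> R) (s : {set I}).

Definition tight a b x : {set I} := [set i | dotp (a i) x == b i].

(* The equations of the affine hull go into [Z], so that the facets alone are
   indexed by [I]; an index occurring in no member of [D] is harmless. *)
Definition presents Q Z a b : Prop :=
  [/\ affine Z, bounded Q
    & forall x, Q x <-> Z x /\ forall i, dotp (a i) x <= b i].

Definition realizes Q (D : pred {set I}) : Prop :=
  exists Z a b, presents Q Z a b /\
    forall s, D s <-> exists2 x, Q x & tight a b x = s.

Definition tight_face Q a b s : set 'rV[R]_n :=
  [set x | Q x /\ s \subset tight a b x]%classic.

Definition determined Q Z a b x : Prop :=
  Q x /\ forall y, Z y -> tight a b x \subset tight a b y -> y = x.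

(** Vertices are named by their tight sets, so that sums over vertices range over the finite type
    [{set I}]. Where [s] belongs to no vertex the value is the default 0. *)
Definition vertex_at Q Z a b s : 'rV[R]_n :=
  xget 0 [set x | determined Q Z a b x /\ tight a b x = s]%classic.

Definition is_vertex_at Q Z a b s : Prop :=
  determined Q Z a b (vertex_at Q Z a b s) /\ tight a b (vertex_at Q Z a b s) = s.

Section Presentation.
Context {Q Z a b} (QP : presents Q Z a b).
Local Notation tight := (tight a b).
Local Notation tight_face := (tight_face Q a b).
Local Notation determined := (determined Q Z a b).
Local Notation vertex_at := (vertex_at Q Z a b).
Local Notation is_vertex_at := (is_vertex_at Q Z a b).

Lemma tight_le x i : Q x -> dotp (a i) x <= b i.
Proof. by case: QP => _ _ QE /QE[]. Qed.

Lemma tight_lt x i : Q x -> i \notin tight x -> dotp (a i) x < b i.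
Proof. by move=> Qx; rewrite inE lt_neqAle => ->; exact: tight_le. Qed.

Lemma presents_conv x y t :
  Q x -> Q y -> 0 <= t <= 1 -> Q (x + t *: (y - x)).
Proof.
case: QP => Zaff _ QE /QE[Zx Qx] /QE[Zy Qy] t01; apply/QE; split; first exact: affine_line.
move=> i; rewrite dotpDr dotpZr dotpBr.
have := Qx i; have := Qy i; nra.
Qed.

Lemma tight_conv x y t : Q x -> Q y -> 0 < t < 1 ->
  tight (x + t *: (y - x)) = tight x :&: tight y.
Proof.
move=> Qx Qy t01; apply/setP => i; rewrite !inE dotpDr dotpZr dotpBr.
have := tight_le i Qx; have := tight_le i Qy => yb xb.
apply/eqP/andP => [e|[/eqP-> /eqP->]]; last by lra.
by split; apply/eqP; nra.
Qed.

Lemma tight_face_face x : Q x -> face Q (tight_face (tight x)).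
Proof.
move=> Qx; split; first by exists x.
exists (\sum_(i in tight x) a i), (\sum_(i in tight x) b i); split.
  by move=> y Qy; rewrite dotp_suml; apply: ler_sum => i _; exact: tight_le.
apply/seteqP; split => y /= [Qy].
  move=> /subsetP sxy; split => //; rewrite dotp_suml.
  by apply: eq_bigr => i /sxy; rewrite inE => /eqP.
move=> yE; split => //; apply/subsetP => i ix.
have /eqP : \sum_(i in tight x) (b i - dotp (a i) y) = 0.
  by rewrite sumrB -yE dotp_suml subrr.
rewrite psumr_eq0; last by move=> j _; rewrite subr_ge0 tight_le.
by move=> /allP/(_ i (mem_index_enum _)) /implyP/(_ ix); rewrite subr_eq0 inE eq_sym.
Qed.

(** A point [x] of [F] with fewest tight inequalities is in the relative interior: passing to
    midpoints shows that its tight set lies in that of every point of [F]. Conversely, if it lies in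
    the tight set of [y], the segment from [y] to [x] can be prolonged beyond [x] inside [Q], which
    forces [y] into [F]. *)
Lemma face_tight_face F : face Q F -> exists2 x, Q x & F = tight_face (tight x).
Proof.
case=> -[x0 Fx0] [c [e [Qle FE]]].
have [] := @ex_minnP (fun k => `[< exists2 x, F x & #|tight x| = k >]).
  by exists #|tight x0|; apply/asboolP; exists x0.
move=> k /asboolP[x Fx <-] kmin.
have FQ y : F y -> Q y by rewrite FE => -[].
have Fc y : F y -> dotp c y = e by rewrite FE => -[].
have xmin y : F y -> tight x \subset tight y.
  move=> Fy; pose z : 'rV[R]_n := x + 2^-1 *: (y - x).
  have h2 : 0 < (2^-1 : R) < 1 by lra.
  have Fz : F z.
    rewrite FE; split; first by apply: presents_conv; [exact: FQ|exact: FQ|lra].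
    by rewrite /= dotpDr dotpZr dotpBr !Fc // subrr mulr0 addr0.
  have zE : tight z = tight x :&: tight y by apply: tight_conv => //; exact: FQ.
  suff -> : tight x = tight z by rewrite zE subsetIr.
  apply/eqP; rewrite eq_sym eqEcard zE subsetIl -zE kmin //.
  by apply/asboolP; exists z.
exists x; first exact: FQ.
apply/seteqP; split => y; first by move=> Fy; split; [exact: FQ|exact: xmin].
case=> Qy xy; rewrite FE; split => //=.
apply/eqP; rewrite eq_le Qle //=.
(* A step of size [e'] beyond [x] is too short to violate an inequality that is slack at [x]. *)
have [e' e'0 e'lt] := pos_lower_bound
  (fun i => (b i - dotp (a i) x) / (dotp (a i) x - dotp (a i) y)).
pose z : 'rV[R]_n := x + (- e') *: (y - x).
have Qz : Q z.
  have [Zaff _ QE] := QP; have [[Zx _] [Zy _]] := ((QE x).1 (FQ _ Fx), (QE y).1 Qy).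
  apply/QE; split; first exact: affine_line.
  move=> i; rewrite dotpDr dotpZr dotpBr.
  have [it|it] := boolP (i \in tight x).
    move: (it) (subsetP xy _ it); rewrite !inE => /eqP-> /eqP->.
    by rewrite subrr mulr0 addr0.
  have bx := tight_lt (FQ _ Fx) it.
  have [xyE|xyN] := leP (dotp (a i) x) (dotp (a i) y); first by nra.
  have := e'lt i; rewrite divr_gt0 ?subr_gt0 // => /(_ isT).
  by rewrite ltr_pdivlMr ?subr_gt0 //; nra.
have := Qle z Qz; rewrite dotpDr dotpZr dotpBr Fc //; nra.
Qed.

(** On the ray from [x] through [y] all inequalities tight at [x] stay tight. As [Q] is bounded the
    ray leaves it, and at the exit a further inequality is tight. *)
Lemma push x y : Q x -> Z y -> tight x \subset tight y -> y != x ->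
  exists t, [/\ 0 < t, Q (x + t *: (y - x))
    & tight x \proper tight (x + t *: (y - x))].
Proof.
move=> Qx Zy xy yx; have [Zaff [r rQ] QE] := QP; have [Zx _] := (QE x).1 Qx.
pose d i := dotp (a i) y - dotp (a i) x.
have zE i t : dotp (a i) (x + t *: (y - x)) = dotp (a i) x + t * d i.
  by rewrite dotpDr dotpZr dotpBr.
have dtight i : i \in tight x -> d i = 0.
  move=> ix; move: (ix) (subsetP xy i ix); rewrite !inE /d => /eqP-> /eqP->.
  by rewrite subrr.
have [i0 di0|dle] := pickP (fun i => 0 < d i); last first.
  have [j yxj] : exists j, y 0 j - x 0 j != 0.
    apply/existsP; apply: contraNT yx; rewrite negb_exists => /forallP h.
    by apply/eqP/rowP => j; apply/eqP; rewrite -subr_eq0; have := h j; rewrite negbK.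
  have Qray t : 0 <= t -> Q (x + t *: (y - x)).
    move=> t0; apply/QE; split; first exact: affine_line.
    move=> i; rewrite zE; have := dle i; have := tight_le i Qx.
    by move=> h1 /negbT; rewrite -leNgt; nra.
  have rx := rQ x j Qx.
  (* Far enough for coordinate [j] to exceed the bound [r]. *)
  pose t := (r + `|x 0 j| + 1) / `|y 0 j - x 0 j|.
  have t0 : 0 <= t by rewrite divr_ge0 //; have := normr_ge0 (x 0 j); lra.
  have := rQ _ j (Qray t t0); rewrite !mxE => h.
  have := ler_normB (x 0 j + t * (y 0 j - x 0 j)) (x 0 j).
  rewrite addrAC subrr add0r normrM (ger0_norm t0) /t divfK ?normr_eq0 //.
  by move=> h'; exfalso; lra.
have [i di imin] := @arg_minP _ _ _ i0 [pred i | 0 < d i]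
  (fun i => (b i - dotp (a i) x) / d i) di0.
rewrite /= in di imin.
have ix : i \notin tight x by apply/negP => /dtight di0'; rewrite di0' ltxx in di.
exists ((b i - dotp (a i) x) / d i); set t := _ / _.
have t0 : 0 < t by rewrite divr_gt0 // subr_gt0; exact: tight_lt.
have bz j : dotp (a j) (x + t *: (y - x)) <= b j.
  rewrite zE; have [dj|dj] := ltP 0 (d j); last by have := tight_le j Qx; nra.
  by have := imin j dj; rewrite -/t ler_pdivlMr //; lra.
split => //; first by apply/QE; split => //; exact: affine_line.
apply/properP; split.
  apply/subsetP => j jx; rewrite inE zE dtight // mulr0 addr0.
  by move: jx; rewrite inE.
by exists i => //; rewrite inE zE /t divfK ?subrKC // gt_eqF.
Qed.

Lemma vertexP v : vertex Q v <-> determined v.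
Proof.
split=> [Fv|[Qv vu]].
  have Qv : Q v by case: Fv => _ [c [e [_ E]]]; have : [set v]%classic v by []; rewrite E => -[].
  have [x Qx E] := face_tight_face Fv.
  have xv : x = v by have : tight_face (tight x) x by []; rewrite -E.
  split=> // y Zy vy; apply/eqP/negPn/negP => yv.
  have [t [t0 Qz /properP[vz _]]] := push Qv Zy vy yv.
  have : tight_face (tight x) (v + t *: (y - v)) by rewrite xv.
  rewrite -E => /eqP; rewrite -subr_eq0 addrAC subrr add0r scaler_eq0.
  by rewrite gt_eqF //= subr_eq0 (negbTE yv).
rewrite /vertex; suff -> : [set v]%classic = tight_face (tight v) by exact: tight_face_face.
apply/seteqP; split => [y -> //|y [Qy vy]].
by apply: vu => //; have [_ _ QE] := QP; have [] := (QE y).1 Qy.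
Qed.

Lemma tight_determined x y : determined x -> Q y -> tight y = tight x -> y = x.
Proof.
move=> [_ xu] Qy E; apply: xu; last by rewrite E.
by have [_ _ QE] := QP; have [] := (QE y).1 Qy.
Qed.

Lemma vertex_atP x : determined x -> is_vertex_at (tight x) /\ vertex_at (tight x) = x.
Proof.
move=> dx; have h : is_vertex_at (tight x).
  by apply: (@xgetPex _ 0 [set y | determined y /\ tight y = tight x]%classic); exists x.
split=> //; apply: (tight_determined dx); last by case: h.
by case: h => -[].
Qed.

(** A point not determined by its tight set lies between two exits from [Q], found by [push] in
    opposite directions. Both have more tight inequalities, and their convex combinations are
    merged. *)
Lemma vertex_hull x : Q x -> exists w : {set I} -> R,
  [/\ forall s, 0 <= w s, \sum_s w s = 1, x = \sum_s w s *: vertex_at s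
    & forall s, w s != 0 -> is_vertex_at s /\ tight x \subset s].
Proof.
move En : (#|I| - #|tight x|)%N => N; elim/ltn_ind: N x En => N IH x En Qx.
have [dx|ndx] := pselect (determined x).
  have [h1 h2] := vertex_atP dx.
  exists (fun s => (s == tight x)%:R); split.
  - by move=> s; rewrite ler0n.
  - by rewrite (bigD1 (tight x)) //= eqxx big1 ?addr0 // => s /negbTE->.
  - rewrite (bigD1 (tight x)) //= eqxx scale1r h2 big1 ?addr0 // => s /negbTE->.
    by rewrite scale0r.
  - by move=> s; case: (s =P tight x) => [->|_]; rewrite ?eqxx.
have [y [Zy xy yx]] : exists y, [/\ Z y, tight x \subset tight y & y != x].
  apply: contrapT => h; apply: ndx; split=> // y Zy xy.
  by apply/eqP/negPn/negP => yx; apply: h; exists y.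
have [Zaff _ QE] := QP; have [Zx _] := (QE x).1 Qx.
pose y' := x + (-1) *: (y - x).
have Zy' : Z y' by exact: affine_line.
have xy' : tight x \subset tight y'.
  apply/subsetP => i ix; move: (ix) (subsetP xy i ix).
  rewrite !inE dotpDr dotpZr dotpBr => /eqP-> /eqP->.
  by rewrite subrr mulr0 addr0.
have yx' : y' != x.
  by rewrite /y' scaleN1r -subr_eq0 addrAC subrr add0r oppr_eq0 subr_eq0.
have [t [t0 Qz xz]] := push Qx Zy xy yx.
have [t' [t'0 Qz' xz']] := push Qx Zy' xy' yx'.
have card_lt z : tight x \proper tight z -> (#|I| - #|tight z| < N)%N.
  move=> /proper_card xz0; rewrite -En ltn_sub2l //.
  by apply: leq_trans xz0 _; exact: max_card.
have [w [w0 w1 wE wv]] := IH _ (card_lt _ xz) _ erefl Qz.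
have [w' [w'0 w'1 w'E w'v]] := IH _ (card_lt _ xz') _ erefl Qz'.
have tt0 : t + t' != 0 by rewrite gt_eqF // addr_gt0.
pose k := t' / (t + t'); pose k' := t / (t + t').
have kk : k + k' = 1 by rewrite /k /k' -mulrDl addrC divff.
have k0 : 0 < k by rewrite divr_gt0 // addr_gt0.
have k'0 : 0 < k' by rewrite divr_gt0 // addr_gt0.
exists (fun s => k * w s + k' * w' s); split.
- by move=> s; rewrite addr_ge0 // mulr_ge0 // ltW.
- by rewrite big_split -!mulr_sumr /= w1 w'1 !mulr1.
- under eq_bigr do rewrite scalerDl -!scalerA.
  rewrite big_split -!scaler_sumr /= -wE -w'E /y'.
  apply/rowP => j; by rewrite !mxE /k /k'; field.
- move=> s; have [ws|ws _] := eqVneq (w s) 0.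
    rewrite ws mulr0 add0r mulf_eq0 negb_or => /andP[_ /w'v[vs zs]]; split => //.
    by apply: subset_trans zs; exact: proper_sub.
  have [vs zs] := wv s ws; split => //.
  by apply: subset_trans zs; exact: proper_sub.
Qed.

Lemma presents_polytope : polytope Q.
Proof.
have [Q0|Q0] := pselect (exists x, Q x); last first.
  exists 0%N, (fun=> 0); apply/seteqP; split => x; first by move=> Qx; case: Q0; exists x.
  by case=> w [_ + _]; rewrite big_ord0 => /esym/eqP; rewrite oner_eq0.
have [x0 Qx0] := Q0.
(* A set that is the tight set of no vertex carries weight zero, but the point listed for it must
   still lie in [Q]. *)
pose v s := if `[< is_vertex_at s >] then vertex_at s else x0.
have vQ s : Q (v s).
  by rewrite /v; case: asboolP => // -[[]].
exists #|{set I}|, (fun k => v (enum_val k)); apply/seteqP; split => x.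
  move=> /vertex_hull[w [w0 w1 wE wv]].
  exists (fun k => w (enum_val k)); split => //.
    by rewrite -w1 [RHS](big_enum_val (A := predT)).
  rewrite wE [LHS](big_enum_val (A := predT)); apply: eq_bigr => k _.
  have [->|/wv[vk _]] := eqVneq (w (enum_val k)) 0; first by rewrite !scale0r.
  by rewrite /v; case: asboolP.
case=> w [w0 w1 ->]; have [Zaff _ QE] := QP.
apply/QE; split; first by apply: Zaff => // k; have [] := (QE _).1 (vQ (enum_val k)).
move=> i; rewrite dotp_sumr -[leRHS]mul1r -w1 mulr_suml.
apply: ler_sum => k _; rewrite dotpZr; apply: ler_wpM2l => //.
by apply: tight_le; exact: vQ.
Qed.

Lemma vertex_above x c : Q x ->
  exists s, [/\ is_vertex_at s, tight x \subset s & dotp c x <= dotp c (vertex_at s)].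
Proof.
move=> Qx; have [w [w0 w1 wE wv]] := vertex_hull Qx.
apply: contrapT => h.
have lt_s s : w s != 0 -> dotp c (vertex_at s) < dotp c x.
  by move=> /wv[vs xs]; rewrite ltNge; apply/negP => le; apply: h; exists s.
have [s ws] : exists s, w s != 0.
  apply: contrapT => h'; move: w1; rewrite big1 => [/eqP|s _].
    by rewrite eq_sym oner_eq0.
  by apply/eqP/negPn/negP => ws; apply: h'; exists s.
have : \sum_s w s * (dotp c x - dotp c (vertex_at s)) = 0.
  under eq_bigr do rewrite mulrBr.
  rewrite sumrB -mulr_suml w1 mul1r {1}wE dotp_sumr.
  by under eq_bigr do rewrite dotpZr; rewrite subrr.
move/eqP; rewrite psumr_eq0; last first.
  move=> s' _; have [->|ws'] := eqVneq (w s') 0; first by rewrite mul0r.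
  by rewrite mulr_ge0 // subr_ge0 ltW // lt_s.
move=> /allP/(_ s (mem_index_enum _)); rewrite /= mulf_eq0 (negbTE ws) subr_eq0.
by rewrite gt_eqF // lt_s.
Qed.

(** An inequality that is never tight on [Q] is redundant: on a segment from a point of [Q] to a
    point outside, the first inequality to fail is tight where it is reached. This allows an idle
    index to be reused or dropped. *)
Lemma presents_active (J : {set I}) x y : Q y ->
  (forall z, Q z -> tight z \subset J) -> Z x ->
  (forall i, i \in J -> dotp (a i) x <= b i) -> Q x.
Proof.
move=> Qy QJ Zx xJ; have [Zaff _ QE] := QP; have [Zy yb] := (QE y).1 Qy.
apply/QE; split=> // i; rewrite leNgt; apply/negP => bi.
have [{bi}i /= bi imin] := @arg_minP _ _ _ i [pred i | b i < dotp (a i) x]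
  (fun i => (b i - dotp (a i) y) / (dotp (a i) x - dotp (a i) y)) bi.
pose r := (b i - dotp (a i) y) / (dotp (a i) x - dotp (a i) y).
have yi := yb i.
have d0 : 0 < dotp (a i) x - dotp (a i) y by lra.
have rE : r * (dotp (a i) x - dotp (a i) y) = b i - dotp (a i) y.
  by rewrite /r divfK // gt_eqF.
have r0 : 0 <= r by rewrite divr_ge0 ?subr_ge0 //; lra.
have r1 : r <= 1 by rewrite ler_pdivrMr //; lra.
have Qz : Q (y + r *: (x - y)).
  apply/QE; split; first exact: affine_line.
  move=> j; rewrite dotpDr dotpZr dotpBr; have yj := yb j.
  have [xj|xj] := leP (dotp (a j) x) (b j); first by nra.
  by have := imin j xj; rewrite -/r ler_pdivlMr; lra.
have /subsetP/(_ i) := QJ _ Qz.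
rewrite inE dotpDr dotpZr dotpBr rE subrKC eqxx => /(_ isT)/xJ.
by rewrite leNgt bi.
Qed.

End Presentation.

Lemma realizes_polytope Q (D : pred {set I}) : realizes Q D -> polytope Q.
Proof. by move=> [Z [a [b [QP _]]]]; exact: presents_polytope QP. Qed.

Lemma realizes_faces Q (D : pred {set I}) : realizes Q D ->
  order_isomorphic (face Q) (fun F G => (F `<=` G)%classic)
    [set s | D s]%classic (fun s s' => s' \subset s).
Proof.
move=> [Z [a [b [QP DE]]]].
pose f (F : set 'rV[R]_n) := [set i | `[< forall x, F x -> dotp (a i) x = b i >]]%SET.
have fE x : Q x -> f (tight_face Q a b (tight a b x)) = tight a b x.
  move=> Qx; apply/setP => i; rewrite inE; apply/asboolP/idP => [h|ix y [_]].
    by rewrite inE; apply/eqP/h; split.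
  by move=> /subsetP/(_ i ix); rewrite inE => /eqP.
exists f; split; first split.
- move=> F /= /(face_tight_face QP)[x Qx ->]; rewrite fE //.
  by apply/DE; exists x.
- move=> F G; rewrite !classical_sets.in_setE => /(face_tight_face QP)[x Qx ->].
  by move=> /(face_tight_face QP)[y Qy ->]; rewrite !fE // => ->.
- move=> s /= /DE[x Qx <-]; exists (tight_face Q a b (tight a b x)); last exact: fE.
  exact: tight_face_face QP _ Qx.
- move=> F G /(face_tight_face QP)[x Qx ->] /(face_tight_face QP)[y Qy ->].
  rewrite !fE //; split=> [h|yx z [Qz xz]].
    by have [|] := h x.
  by split => //; exact: subset_trans xz.
Qed.

Lemma eq_realizes Q (D D' : pred {set I}) : D =1 D' -> realizes Q D -> realizes Q D'.
Proof.
move=> E [Z [a [b [QP DE]]]]; exists Z, a, b; split => // s.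
by rewrite -E; exact: DE.
Qed.

(* The faces, coded by the facets containing them, after cutting off the face
   [s] by a new facet [m]: dually, the stellar subdivision at [s]. *)
Definition stellar (D : pred {set I}) s (m : I) : pred {set I} :=
  fun t => ~~ (s \subset t) && D (if m \in t then (t :\ m) :|: s else t).

(** The sum of the inequalities in [s] is an equality exactly on the face of [s], so its normal
    serves for the cut. The hyperplane meets the relative interior of the face of [u] exactly when
    that face reaches the removed one, that is, when [u :|: s] is a tight set. *)
Lemma truncation_realizes Q (D : pred {set I}) s (m : I) :
  realizes Q D -> (forall t t' : {set I}, D t -> t' \subset t -> D t') ->
  D s -> s != set0 -> (forall t : {set I}, D t -> m \notin t) ->
  exists Q', truncation Q Q' /\ realizes Q' (stellar D s m).
Proof.
move=> [Z [a [b [QP DE]]]] Dsub Ds s0 Dm.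
have [Zaff Qbd QE] := QP.
have D_tight x : Q x -> D (tight a b x) by move=> Qx; apply/DE; exists x.
have D0 : D set0 by apply: Dsub Ds _; exact: sub0set.
pose c := \sum_(i in s) a i; pose be := \sum_(i in s) b i.
have cle x : Q x -> dotp c x <= be.
  by move=> Qx; rewrite dotp_suml; apply: ler_sum => i _; exact: tight_le QP _ _ Qx.
have ceq x : Q x -> (dotp c x == be) = (s \subset tight a b x).
  move=> Qx; rewrite eq_sym -subr_eq0 dotp_suml -sumrB psumr_eq0; last first.
    by move=> i _; rewrite subr_ge0; exact: tight_le QP _ _ Qx.
  apply/allP/subsetP => h i.
    by move=> si; have := h i (mem_index_enum _); rewrite si /= inE subr_eq0 eq_sym.
  by move=> _; apply/implyP => /h; rewrite inE subr_eq0 eq_sym.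
have clt x : Q x -> ~~ (s \subset tight a b x) -> dotp c x < be.
  by move=> Qx; rewrite -ceq // lt_neqAle cle // andbT.
(* [e] is smaller than the gap at every vertex off the face, so the level [h] separates these
   vertices from the face. *)
have [e e0 elt] := pos_lower_bound (fun t => be - dotp c (vertex_at Q Z a b t)).
pose h := be - e.
have vlt t : is_vertex_at Q Z a b t -> ~~ (s \subset t) ->
    dotp c (vertex_at Q Z a b t) < h.
  move=> [[Qv _] vt] st; have := elt t; rewrite subr_gt0 clt // ?vt //.
  by move=> /(_ isT); rewrite /h; lra.
pose Q' := (Q `&` [set x | dotp c x <= h])%classic.
exists Q'; split.
  exists (tight_face Q a b s), c, h; split => //.
  - by have /DE[x Qx <-] := Ds; exact: tight_face_face QP _ Qx.
  - apply: contraNneq s0 => c0; have /DE[x Qx x0] := D0.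
    have /DE[y Qy sy] := Ds.
    have : dotp c x == be.
      by have := ceq y Qy; rewrite sy subxx => /eqP<-; rewrite c0 !dotp0l.
    by rewrite ceq // x0 subset0.
  - move=> v _ [Qv sv]; have /eqP-> : dotp c v == be by rewrite ceq.
    by rewrite /h; lra.
  - move=> v /(vertexP QP) dv nFv; have [h1 h2] := vertex_atP QP dv.
    rewrite -h2; apply: vlt => //; apply/negP => sv; apply: nFv; split => //.
    by case: dv.
(* The inequality [m] is never tight before the cut, so its index is free for the new facet. *)
pose a' i := if i == m then c else a i; pose b' i := if i == m then h else b i.
have tightE x : Q x -> tight a' b' x =
    if dotp c x == h then m |: tight a b x else tight a b x.
  move=> Qx; have := Dm _ (D_tight x Qx); rewrite inE => mx.
  apply/setP => i; case: ifP => cx; rewrite !inE /a' /b'.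
    by have [->|] := eqVneq i m.
  by have [->|] := eqVneq i m; rewrite ?cx ?(negbTE mx).
exists Z, a', b'; split.
  split => //.
    by have [r rQ] := Qbd; exists r => x j [Qx _]; exact: rQ.
  move=> x; split=> [[/QE[Zx Qx] /= cx]|[Zx Qx]].
    by split => // i; rewrite /a' /b'; case: ifP.
  have cx : dotp c x <= h by have := Qx m; rewrite /a' /b' eqxx.
  split => //; have /DE[y Qy _] := D0.
  apply: (presents_active QP Qy (J := [set~ m]%SET)) => //.
    by move=> z Qz; apply/subsetP => i iz; rewrite !inE; apply: contraTneq iz => ->; exact: Dm (D_tight z Qz).
  by move=> i; rewrite !inE => /negbTE im; have := Qx i; rewrite /a' /b' im.
move=> t; rewrite /stellar; split.
  (* The face of [u] has a vertex below level [h]; near that vertex, towards [x], there are points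
     with tight set exactly [u]. *)
  have low u x : Q x -> tight a b x = u -> ~~ (s \subset u) ->
      exists y, [/\ Q y, tight a b y = u & dotp c y < h].
    move=> Qx xu su; have [v [vv xv]] := vertex_above QP (- c) Qx.
    rewrite !dotpNl lerN2 => vx; have [[Qv _] vE] := vv.
    have vh : dotp c (vertex_at Q Z a b v) < h.
      have cx : dotp c x < be by apply: clt => //; rewrite xu.
      apply: vlt => //; rewrite -vE -ceq //.
      by rewrite lt_eqF // (le_lt_trans vx cx).
    move: vx vh; set y := vertex_at _ _ _ _ _ => vx vh.
    pose g := h - dotp c y; pose d := dotp c x - dotp c y.
    have g0 : 0 < g by rewrite subr_gt0.
    have d0 : 0 <= d by rewrite subr_ge0.
    (* With [r = g / (g + d + 1)] the rise [r * d] stays below [g]; the summand 1 keeps [r] below 1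
       also when [d] is zero. *)
    have gd1 : 0 < g + d + 1 by lra.
    have rE : g / (g + d + 1) * (g + d + 1) = g by rewrite divfK // gt_eqF.
    have r01 : 0 < g / (g + d + 1) < 1 by rewrite divr_gt0 //= ltr_pdivrMr //; lra.
    move: r01 rE; set r := g / _ => r01 rE.
    exists (y + r *: (x - y)); split.
    - by apply: (presents_conv QP) => //; lra.
    - rewrite (tight_conv QP) // vE -xu; exact/setIidPr.
    - by rewrite dotpDr dotpZr dotpBr -/d; rewrite -(subrK (dotp c y) h) -/g; nra.
  case: ifP => mt /andP[st Dt].
    have [x Qx xE] : exists2 x, Q x & tight a b x = t :\ m.
      by apply/DE/(Dsub _ _ Dt); exact: subsetUl.
    have stm : ~~ (s \subset t :\ m).
      by apply: contra st => /subset_trans; apply; exact: subsetDl.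
    have [y [Qy yE yh]] := low _ _ Qx xE stm.
    have /DE[w Qw wE] := Dt.
    have cw : dotp c w = be by apply/eqP; rewrite ceq // wE subsetUr.
    pose r := (h - dotp c y) / (be - dotp c y).
    have bey : 0 < be - dotp c y by move: yh; rewrite /h; lra.
    have r01 : 0 < r < 1.
      by apply/andP; split; [rewrite divr_gt0 // subr_gt0|rewrite ltr_pdivrMr // mul1r /h; lra].
    have rE : r * (be - dotp c y) = h - dotp c y by rewrite /r divfK // gt_eqF.
    have Qz : Q (y + r *: (w - y)) by apply: (presents_conv QP) => //; lra.
    have cz : dotp c (y + r *: (w - y)) = h.
      by rewrite dotpDr dotpZr dotpBr cw rE subrKC.
    exists (y + r *: (w - y)); first by split => //=; rewrite cz.
    rewrite tightE // cz eqxx (tight_conv QP) // yE wE.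
    by rewrite (setIidPl (subsetUl _ _)) setD1K.
  have /DE[x Qx xE] := Dt.
  have [y [Qy yE yh]] := low _ _ Qx xE st.
  exists y; first by split => //=; exact: ltW.
  by rewrite tightE // lt_eqF.
case=> x [Qx /= cx]; rewrite tightE // => <-.
have sx : ~~ (s \subset tight a b x).
  by rewrite -ceq //; rewrite lt_eqF //; move: cx; rewrite /h; lra.
have mx := Dm _ (D_tight x Qx).
have [ch|ch] := eqVneq; last by rewrite (negbTE mx) sx D_tight.
rewrite setU11 setU1K //.
have ms : m \notin s by exact: Dm.
have -> : s \subset m |: tight a b x = (s \subset tight a b x).
  apply/idP/idP => [/subsetP sm|/subset_trans]; last by apply; exact: subsetUr.
  apply/subsetP => i si; have := sm i si; rewrite in_setU1.
  by case: eqP => // im; rewrite im in si; rewrite si in ms.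
(* A vertex of the face of [x] at level at least [h] lies on the face of [s]. Its tight set contains
   both sets, and downward closure gives their union. *)
rewrite sx /=; have [v [vv xv hv]] := vertex_above QP c Qx.
have [sv|/(vlt _ vv)] := boolP (s \subset v); last by rewrite -ch ltNge hv.
have [[Qv _] vE] := vv.
by apply: (Dsub v); [rewrite -vE; exact: D_tight|rewrite subUset xv sv].
Qed.

End Polyhedra.

Definition relabel_set {I I' : finType} (g : I' -> option I) (s : {set I}) :
    {set I'} := [set i | if g i is Some j then j \in s else false]%SET.

(** An index sent to [None] receives the inequality [0 <= 1], never tight and so available for a
    later facet. Inequalities not reached by [g] are never tight either, hence redundant. *)
Lemma relabel_realizes {R : realType} {n} {I I' : finType} (g : I' -> option I)
    (Q : set 'rV[R]_n) (D : pred {set I}) (D' : pred {set I'}) :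
  realizes Q D -> (exists s, D s) ->
  (forall s i, D s -> i \in s -> exists i', g i' = Some i) ->
  (forall t, D' t <-> exists2 s, D s & t = relabel_set g s) -> realizes Q D'.
Proof.
move=> [Z [a [b [QP DE]]]] [s0 /DE[y Qy _]] gD D'E; have [Zaff Qbd QE] := QP.
pose a' i' := if g i' is Some i then a i else 0.
pose b' i' := if g i' is Some i then b i else 1.
have tightE x : tight a' b' x = relabel_set g (tight a b x).
  apply/setP => i'; rewrite !inE /a' /b'; case: (g i') => [i|]; first by rewrite inE.
  by rewrite dotp0l eq_sym oner_eq0.
exists Z, a', b'; split; last first.
  move=> t; split=> [/D'E[s /DE[x Qx <-] ->]|[x Qx <-]]; first by exists x.
  by rewrite tightE; apply/D'E; exists (tight a b x) => //; apply/DE; exists x.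
split => // x; split=> [/QE[Zx xb]|[Zx xb]].
  by split => // i'; rewrite /a' /b'; case: (g i') => [i|]; rewrite ?dotp0l ?ler01.
apply: (presents_active QP Qy (J := [set i | [exists i', g i' == Some i]]%SET)) => //.
  move=> z Qz; apply/subsetP => i iz; rewrite inE; apply/existsP.
  have [|i' gi] := gD (tight a b z) i _ iz; first by apply/DE; exists z.
  by exists i'; rewrite gi.
move=> i; rewrite inE => /existsP[i' /eqP gi].
by have := xb i'; rewrite /a' /b' gi.
Qed.

(** The equation of the simplex goes into [Z]. Any set of coordinates may vanish on the simplex
    except all of them at once. *)
Lemma product_realizes {R : realType} {n k} {I : finType}
    (K : set 'rV[R]_n) (D : pred {set I}) : realizes K D ->
  realizes (prod_set K (simplex k)) [pred t : {set I + 'I_k.+1} |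
    D (inl @^-1: t) && [exists j, inr j \notin t]].
Proof.
move=> [Z [a [b [[Zaff [r Kr] KE] DE]]]].
pose a' (i : I + 'I_k.+1) : 'rV[R]_(n + k.+1) :=
  match i with inl i => row_mx (a i) 0 | inr j => row_mx 0 (- delta_mx 0 j) end.
pose b' (i : I + 'I_k.+1) := if i is inl i then b i else 0.
have a'l i (z : 'rV[R]_(n + k.+1)) : dotp (a' (inl i)) z = dotp (a i) (lsubmx z).
  rewrite /dotp big_split_ord /= addrC big1 ?add0r => [|j _].
    by apply: eq_bigr => j _; rewrite row_mxEl mxE.
  by rewrite row_mxEr mxE mul0r.
have a'r j (z : 'rV[R]_(n + k.+1)) : dotp (a' (inr j)) z = - rsubmx z 0 j.
  rewrite /dotp big_split_ord /= big1 ?add0r => [|i _]; last first.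
    by rewrite row_mxEl mxE mul0r.
  rewrite (bigD1 j) //= big1 ?addr0 => [|i ij].
    by rewrite row_mxEr !mxE !eqxx mulN1r.
  by rewrite row_mxEr !mxE (negbTE ij) andbF oppr0 mul0r.
pose Z' (z : 'rV[R]_(n + k.+1)) := Z (lsubmx z) /\ \sum_j rsubmx z 0 j = 1.
have tl z : inl @^-1: tight a' b' z = tight a b (lsubmx z).
  by apply/setP => i; rewrite !inE a'l.
have tr z j : (inr j \in tight a' b' z) = (rsubmx z 0 j == 0).
  by rewrite inE a'r /= oppr_eq0.
exists Z', a', b'; split; first split.
- move=> J w v w1 Zv; split.
    rewrite linear_sum; under eq_bigr do rewrite linearZ.
    by apply: Zaff => // j; have [] := Zv j.
  have -> : \sum_j rsubmx (\sum_i w i *: v i) 0 j = \sum_i w i * \sum_j rsubmx (v i) 0 j.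
    under eq_bigr do rewrite linear_sum summxE.
    rewrite exchange_big; apply: eq_bigr => i _; rewrite mulr_sumr.
    by apply: eq_bigr => j _; rewrite linearZ mxE.
  by rewrite -w1; apply: eq_bigr => i _; have [_ ->] := Zv i; rewrite mulr1.
- exists (Num.max r 1) => z j [/Kr Kz [z0 z1]]; rewrite -[z]hsubmxK.
  case: (split_ordP j) => i ->; rewrite ?row_mxEl ?row_mxEr le_max.
    by rewrite Kz.
  rewrite ger0_norm // -z1 (bigD1 i) //= lerDl sumr_ge0 ?orbT //.
- move=> z; split=> [[/KE[Zz zb] [z0 z1]]|[[Zz z1] zb]].
    split; first by [].
    by case=> [i|j]; rewrite ?a'l ?a'r //= oppr_le0.
  split; first by apply/KE; split => // i; have := zb (inl i); rewrite a'l.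
  by split => // j; have := zb (inr j); rewrite a'r /= oppr_le0.
move=> t; split=> [/andP[/DE[x Kx xt] /existsP[j0 j0t]]|[z [/= Kz [z0 z1]] <-]].
  (* The witness spreads the weight evenly over the coordinates that must not vanish. *)
  pose N := #|[set j : 'I_k.+1 | inr j \notin t]|.
  have N0 : (N%:R : R) != 0.
    by rewrite pnatr_eq0 -lt0n; apply/card_gt0P; exists j0; rewrite inE.
  pose y : 'rV[R]_k.+1 := \row_j (if inr j \in t then 0 else N%:R^-1).
  exists (row_mx x y).
    split; rewrite /= ?row_mxKl ?row_mxKr //; split.
      by move=> j; rewrite mxE; case: ifP; rewrite // invr_ge0 ler0n.
    under eq_bigr do rewrite mxE -if_neg.
    rewrite -big_mkcond /= sumr_const -[RHS](mulVf N0) mulr_natr /N.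
    by congr (_ *+ _); apply: eq_card => j; rewrite inE.
  apply/setP => -[i|j].
    have := tl (row_mx x y); rewrite row_mxKl xt => /setP/(_ i).
    by rewrite in_set [in X in _ = X]in_set.
  rewrite tr row_mxKr mxE; case: ifP => _; first exact: eqxx.
  by rewrite invr_eq0 (negbTE N0).
apply/andP; split; first by rewrite tl; apply/DE; exists (lsubmx z).
apply/existsP; apply: contrapT => /forallNP h; move: z1.
rewrite big1 => [/esym/eqP|j _]; first by rewrite oner_eq0.
by apply/eqP; rewrite -tr; apply/negPn/negP => /h.
Qed.

(* [rk m] is the date at which the face [sg m] is cut off. *)
Lemma iterated_truncation_realizes {R : realType} {n} {I : finType}
    (N : {set I}) (rk : I -> nat) (sg : I -> {set I}) (D : {set I} -> pred {set I}) :
  (forall S s t : {set I}, D S s -> t \subset s -> D S t) ->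
  (forall (S : {set I}) m, S \subset N -> m \in N :\: S ->
    (forall m', m' \in N -> (rk m' < rk m)%N -> m' \in S) ->
    (forall m', m' \in S -> (rk m' <= rk m)%N) ->
    [/\ D S (sg m), sg m != set0, forall s, D S s -> m \notin s
      & D (m |: S) =1 stellar (D S) (sg m) m]) ->
  forall Q : set 'rV[R]_n, realizes Q (D set0) ->
  exists Q', iterated_truncation Q Q' /\ realizes Q' (D N).
Proof.
move=> Dsub step Q Q0.
suff H (S : {set I}) (Q1 : set 'rV[R]_n) : S \subset N -> realizes Q1 (D S) ->
    (forall m m', m \in S -> m' \in N -> (rk m' < rk m)%N -> m' \in S) ->
    exists Q', iterated_truncation Q1 Q' /\ realizes Q' (D N).
  by apply: H Q0 _; rewrite ?sub0set // => m m'; rewrite inE.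
move Ek : #|N :\: S| => k; elim: k S Q1 Ek => [|k IH] S Q1 Ek SN Q1S Scl.
  exists Q1; split; first exact: rt_refl.
  by move/eqP: Ek; rewrite cards_eq0 setD_eq0 => NS; rewrite (_ : N = S) //; apply/eqP; rewrite eqEsubset NS.
have [m0 m0N] : exists m0, m0 \in N :\: S by apply/card_gt0P; rewrite Ek.
have [m mN mmin] := @arg_minnP _ m0 [in N :\: S] rk m0N.
have below m' : m' \in N -> (rk m' < rk m)%N -> m' \in S.
  move=> m'N; rewrite ltnNge; apply: contraNT => m'S.
  by apply: mmin; rewrite /= inE m'N m'S.
have [Ds s0 Dm E] : [/\ D S (sg m), sg m != set0, forall s, D S s -> m \notin s
      & D (m |: S) =1 stellar (D S) (sg m) m].
  apply: step => // m' m'S; rewrite leqNgt; apply/negP => lt.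
  move: mN; rewrite /= inE => /andP[/negP mS mN].
  by apply: mS; apply: Scl m'S mN lt.
have [Q2 [tr Q2S]] := truncation_realizes Q1S (@Dsub S) Ds s0 Dm.
move: (mN); rewrite /= inE => /andP[mS mN'].
have [||||Q' [it Q'N]] := IH (m |: S) Q2.
- by apply/eqP; rewrite -eqSS -Ek (cardsD1 m (N :\: S)) inE mS mN' /= add1n eqSS setDDl setUC.
- by rewrite subUset sub1set mN'.
- by apply: eq_realizes Q2S => t; rewrite E.
- move=> p q; rewrite !in_setU1 => /orP[/eqP->|pS] qN lt; last by rewrite (Scl p) ?orbT.
  by rewrite below ?orbT.
by exists Q'; split => //; apply: rt_trans it; exact: rt_step.
Qed.

Local Close Scope ring_scope.

(** * Lower sets, connected components and tubings *)

Section LowerSets.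
Context {d : Order.disp_t} {P : finPOrderType d}.
Implicit Types (x y z u v w : P) (A L U V C : {set P}) (S T : {set {set P}}).

Lemma lower_setP L :
  reflect (forall x y, x \in L -> (y <= x)%O -> y \in L) (lower_set L).
Proof.
apply: (iffP forall_inP) => [h x y xL yx|h x xL].
  by have /forallP/(_ y)/implyP/(_ yx) := h x xL.
by apply/forallP => y; apply/implyP; exact: h.
Qed.

Lemma lower_cover S : {in S, forall t : {set P}, lower_set t} -> lower_set (cover S).
Proof.
move=> lS; apply/lower_setP => x y /bigcupP[t tS xt] yx.
by apply/bigcupP; exists t => //; exact: (lower_setP _ (lS t tS)) yx.
Qed.

Lemma lower_boundary L x : lower_set L -> x \in L -> boundary x \subset L.
Proof.
move=> /lower_setP lL xL; apply/subsetP => y; rewrite inE => /ltW.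
exact: lL xL.
Qed.

(** For a lower set this is connectedness in the Hasse diagram, see [hasse_connectedP]. Stated
    through separations by lower sets, it allows gluing arguments without paths. *)
Definition conn L : Prop := forall U V, lower_set U -> lower_set V ->
  [disjoint U & V] -> L \subset U :|: V -> (L \subset U) || (L \subset V).

Definition nod U V : bool := [|| U \subset V, V \subset U | [disjoint U & V]].

Lemma nodC U V : nod U V = nod V U.
Proof. by rewrite /nod orbCA disjoint_sym. Qed.

Lemma nod_refl U : nod U U.
Proof. by rewrite /nod subxx. Qed.

Lemma disjointI U V z : [disjoint U & V] -> z \in U -> z \notin V.
Proof. by move=> UV zU; rewrite (disjointFr UV). Qed.

Definition hasse_in L : rel P := [rel u v | [&& u \in L, v \in L & hasse u v]].

Lemma hasse_in_sym L : symmetric (hasse_in L).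
Proof. by move=> u v; rewrite /hasse_in /hasse /= orbC andbCA. Qed.

Lemma hasse_in_connect_sym L : connect_sym (hasse_in L).
Proof. exact/sym_connect_sym/hasse_in_sym. Qed.

(** Descend from [v] to an element covered by [v], taken with the most elements below it among those
    from [u] up to [v]. *)
Lemma lower_connect L u v : lower_set L -> v \in L -> (u <= v)%O ->
  connect (hasse_in L) u v.
Proof.
move=> lL; have [k] := ubnP #|boundary v|; elim: k v => // k IH v vk vL.
rewrite le_eqVlt => /predU1P[->//|uv].
have uP : u \in [set z | (u <= z)%O && (z < v)%O] by rewrite inE lexx.
have [w] := @arg_maxnP _ u [in [set z | (u <= z)%O && (z < v)%O]]
  (fun z => #|boundary z|) uP.
rewrite inE => /andP[uw wv] wmax.
have bsub z1 z2 : (z1 < z2)%O -> #|boundary z1| < #|boundary z2|.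
  move=> z12; apply: proper_card; apply/properP; split.
    by apply/subsetP => z; rewrite !inE => /lt_trans; apply.
  by exists z1; rewrite inE ?ltxx.
have wL : w \in L by apply: (lower_setP _ lL) vL (ltW wv).
apply: connect_trans (IH w _ wL uw) _.
  by apply: leq_trans (bsub _ _ wv) _.
apply: connect1; rewrite /hasse_in /hasse /covered_by /= wL vL wv /=.
apply/orP; left; apply/forallP => z; apply/negP => /andP[wz zv].
have := wmax z; rewrite /= inE (ltW (le_lt_trans uw wz)) zv => /(_ isT).
by apply/negP; rewrite -ltnNge; exact: bsub.
Qed.

Definition component L u : {set P} := [set v in L | connect (hasse_in L) u v].

Lemma component_sub L u : component L u \subset L.
Proof. by apply/subsetP => v; rewrite inE => /andP[]. Qed.

Lemma mem_component L u : u \in L -> u \in component L u.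
Proof. by move=> uL; rewrite inE uL connect0. Qed.

Lemma component_lower L u : lower_set L -> lower_set (component L u).
Proof.
move=> lL; apply/lower_setP => v w; rewrite !inE => /andP[vL uv] wv.
rewrite (lower_setP _ lL _ _ vL wv) /=; apply: connect_trans uv _.
by rewrite hasse_in_connect_sym lower_connect.
Qed.

Lemma componentD_lower L u : lower_set L -> lower_set (L :\: component L u).
Proof.
move=> lL; apply/lower_setP => v w; rewrite !inE => /andP[uv vL] wv.
have wL := lower_setP _ lL _ _ vL wv; rewrite wL vL /= andbT in uv *.
by apply: contra uv => /connect_trans; apply; exact: lower_connect.
Qed.

Lemma component_conn L u : u \in L -> conn (component L u).
Proof.
move=> uL U V lU lV dUV sUV.
wlog uU : U V lU lV dUV sUV / u \in U.
  move=> H; have := subsetP sUV u (mem_component uL); rewrite inE => /orP[uU|uV].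
    exact: H uU.
  by rewrite orbC; apply: H uV => //; rewrite 1?disjoint_sym // setUC.
apply/orP; left; apply/subsetP => v; rewrite inE => /andP[_ /connectP[p]].
suff H w : w \in U -> connect (hasse_in L) u w -> path (hasse_in L) w p -> last w p \in U.
  by move=> up ->; apply: H up; rewrite ?connect0.
elim: p w => [|z p IH] w wU uw //= /andP[wz zp].
have [wL zL] : w \in L /\ z \in L by case/and3P: wz.
have uz : connect (hasse_in L) u z by apply: connect_trans uw (connect1 wz).
apply: (IH z _ uz zp); have : z \in U :|: V by apply: (subsetP sUV); rewrite inE zL.
rewrite inE => /orP[//|zV].
case/and3P: wz => _ _ /orP[] /andP[/ltW wz _].
  by have := lower_setP _ lV _ _ zV wz; rewrite (disjointFr dUV wU).
by apply: (lower_setP _ lU) wU wz.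
Qed.

Lemma hasse_connectedP L : lower_set L -> reflect (conn L) (hasse_connected L).
Proof.
move=> lL; apply: (iffP idP) => [hL|cL].
  have [->|/set0Pn[u uL]] := eqVneq L set0.
    by move=> U V _ _ _ _; rewrite sub0set.
  rewrite (_ : L = component L u); first exact: component_conn.
  apply/eqP; rewrite eqEsubset component_sub andbT; apply/subsetP => v vL.
  by rewrite inE vL; exact: (forall_inP (forall_inP hL u uL) v vL).
apply/forall_inP => u uL; apply/forall_inP => v vL.
have /orP[/subsetP/(_ v vL)|/subsetP/(_ u uL)] :
    (L \subset component L u) || (L \subset L :\: component L u).
- apply: cL; [exact: component_lower|exact: componentD_lower| |].
    by rewrite disjoint_sym disjoints_subset subsetDr.
  by apply/subsetP => w wL; rewrite in_setU in_setD wL andbT orbN.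
- by rewrite inE => /andP[].
- by rewrite in_setD mem_component.
Qed.

Definition components L : {set {set P}} := [set component L u | u in L].

Lemma componentsP L C : lower_set L -> C \in components L ->
  [/\ C \subset L, lower_set C, lower_set (L :\: C), conn C & C != set0].
Proof.
move=> lL /imsetP[u uL ->]; split; first exact: component_sub.
- exact: component_lower.
- exact: componentD_lower.
- exact: component_conn.
- by apply/set0Pn; exists u; exact: mem_component.
Qed.

Lemma cover_components L : cover (components L) = L.
Proof.
apply/setP => v; apply/bigcupP/idP => [[C /imsetP[u _ ->]]|vL].
  exact/subsetP/component_sub.
by exists (component L v); [exact: imset_f|exact: mem_component].
Qed.

Lemma conn_component L C t : lower_set L -> C \in components L -> conn t ->
  t \subset L -> t \subset C \/ [disjoint t & C].
Proof.
move=> lL CL ct tL; have [CsL lC lLC _ _] := componentsP lL CL.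
have := ct _ _ lC lLC; rewrite -setI_eq0 setIDA [C :&: L](setIidPl CsL) setDv eqxx.
have -> : C :|: L :\: C = L.
  by apply/setP => v; rewrite !inE; have := subsetP CsL v; case: (v \in C) => // ->.
move=> /(_ isT tL)/orP[|tD]; [by left|right].
by move: tD; rewrite subsetD => /andP[].
Qed.

Lemma components_disjoint L C C' : lower_set L ->
  C \in components L -> C' \in components L -> C != C' -> [disjoint C & C'].
Proof.
move=> lL CL C'L CC'; have [CsL lC _ cC _] := componentsP lL CL.
have [C'sL lC' _ cC' _] := componentsP lL C'L.
have [CC|//] := conn_component lL C'L cC CsL.
have [C'C|] := conn_component lL CL cC' C'sL; last by rewrite disjoint_sym.
by rewrite eqEsubset CC C'C in CC'.
Qed.

(** Each member of [S] is connected, so it lies in one component; that component cannot be larger,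
    because the member and the union of the others would separate it. *)
Lemma components_unique S :
  {in S, forall t : {set P}, [/\ conn t, lower_set t & t != set0]} ->
  {in S &, forall s t : {set P}, s != t -> [disjoint s & t]} ->
  components (cover S) = S.
Proof.
move=> Sc Sd.
have lS : lower_set (cover S) by apply: lower_cover => t /Sc[].
have SE t u : t \in S -> u \in t -> component (cover S) u = t.
  move=> tS ut; have [ct lt _] := Sc t tS.
  have uS : u \in cover S by apply/bigcupP; exists t.
  have CS : component (cover S) u \in components (cover S) by exact: imset_f.
  have tsub : t \subset cover S by exact: bigcup_sup.
  have uC := mem_component uS.
  apply/eqP; rewrite eqEsubset; apply/andP; split; last first.
    have [//|/disjointI/(_ ut)] := conn_component lS CS ct tsub.
    by rewrite uC.
  have lS' : lower_set (cover (S :\ t)).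
    by apply: lower_cover => s; rewrite inE => /andP[_ /Sc[]].
  have := component_conn uS lt lS'; case/(_ _ _)/orP => //.
  - rewrite -setI_eq0; apply/eqP/setP => v; rewrite !inE.
    apply/negbTE/negP => /andP[vt /bigcupP[s]]; rewrite !inE => /andP[st sS] vs.
    by have := disjointI (Sd _ _ sS tS st) vs; rewrite vt.
  - apply/subsetP => v /(subsetP (component_sub _ _))/bigcupP[s sS vs].
    rewrite inE; have [<-|st] := eqVneq s t; first by rewrite vs.
    by apply/orP; right; apply/bigcupP; exists s; rewrite // !inE st.
  - move=> /subsetP/(_ u uC)/bigcupP[s]; rewrite !inE => /andP[st sS] us.
    by have := disjointI (Sd _ _ sS tS st) us; rewrite ut.
apply/setP => t; apply/imsetP/idP => [[u /bigcupP[s sS us] ->]|tS].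
  by rewrite (SE s).
have [_ _ /set0Pn[u ut]] := Sc t tS.
exists u; last by rewrite (SE t).
by apply/bigcupP; exists t.
Qed.

(* The axioms of a tubing of the subposet [A], for a lower set [A] of [P]. *)
Record tubing_in A T : Prop := TubingIn {
  tubing_conn : forall t, t \in T -> conn t;
  tubing_lower : forall t, t \in T -> lower_set t;
  tubing_nod : forall s t, s \in T -> t \in T -> nod s t;
  tubing_filled : forall S, S \subset T -> S != set0 ->
    forall y, y \in A -> boundary y \subset cover S ->
      exists2 z, z \in cover S & boundary z = boundary y;
  tubing_cover : T != set0 -> ~~ (A \subset cover T) }.

Lemma filledP L : reflect
  (forall y, boundary y \subset L -> exists2 z, z \in L & boundary z = boundary y)
  (filled L).
Proof.
apply: (iffP forallP) => h y.
  move=> yL; have /implyP/(_ yL)/set0Pn[z] := h y.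
  by rewrite !inE => /andP[zL /eqP]; exists z.
apply/implyP => /h[z zL zy]; apply/set0Pn; exists z.
by rewrite !inE zL zy eqxx.
Qed.

Lemma tubingP T : reflect (tubing_in setT T) (tubing T).
Proof.
have cov1 (t : {set P}) : cover [set t] = t by rewrite /cover big_set1.
apply: (iffP and4P) => [[tubT /forall_inP nT /forallP fT cT]|[cT lT nT fT covT]].
  have tT t : t \in T -> [/\ filled t, conn t, lower_set t & t != setT].
    move=> /(forall_inP tubT)/andP[/and3P[ft ht lt] tN]; split => //.
    exact/hasse_connectedP.
  split; [by move=> t /tT[]|by move=> t /tT[]| | |].
  - by move=> s t /nT/forall_inP h /h.
  - by move=> S ST S0 y _; have := fT S; rewrite ST S0 /= => /filledP; exact.
  - by move=> /(implyP cT); rewrite subTset.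
split.
- apply/forall_inP => t tT; rewrite /tube lT //=.
  rewrite [hasse_connected _](introT (hasse_connectedP _) (cT _ tT)) ?lT //=.
  apply/andP; split.
    rewrite andbT; apply/filledP => y yt.
    have := fT [set t]; rewrite sub1set cov1; apply => //.
    by apply/set0Pn; exists t; rewrite set11.
  have : T != set0 by apply/set0Pn; exists t.
  move/covT; apply: contra => /eqP<-; exact: bigcup_sup.
- by apply/forall_inP => s sT; apply/forall_inP => t tT; exact: nT.
- apply/forallP => S; apply/implyP => /andP[ST S0]; apply/filledP => y.
  exact: fT.
- by apply/implyP => /covT; rewrite subTset.
Qed.

End LowerSets.

(** * Tubings of a lower subposet, read as sets of subsets of [P] *)

Section InducedTubings.
Context {d : Order.disp_t} {P : finPOrderType d} (A : {set P}).
Hypothesis lA : lower_set A.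
Implicit Types (L : {set P}) (t : {set induced A}).

Definition extend t : {set P} := val @: t.

Definition restrict L : {set induced A} := [set y | val y \in L].

Lemma imset_val_sub t : extend t \subset A.
Proof. by apply/subsetP => _ /imsetP[y _ ->]; exact: valP. Qed.

Lemma mem_imset_val t (y : induced A) : (val y \in extend t) = (y \in t).
Proof. exact: mem_imset val_inj. Qed.

Lemma restrict_imset t : restrict (extend t) = t.
Proof. by apply/setP => y; rewrite inE mem_imset_val. Qed.

Lemma imset_restrict L : extend (restrict L) = L :&: A.
Proof.
apply/setP => z; rewrite inE; apply/imsetP/andP => [[y]|[zL zA]].
  by rewrite inE => yL ->; rewrite yL; split => //; exact: valP.
by exists (Sub z zA); rewrite ?inE ?SubK.
Qed.

(** Since [A] is a lower set, boundaries are the same in [A] and in [P]. This is why being filled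
    can be compared in the two posets. *)
Lemma imset_val_boundary (y : induced A) : extend (boundary y) = boundary (val y).
Proof.
apply/setP => z; apply/imsetP/idP => [[w]|].
  by rewrite !inE => wy ->; exact: wy.
rewrite inE => zy; have zA := lower_setP _ lA _ _ (valP y) (ltW zy).
by exists (Sub z zA); rewrite ?SubK // inE.
Qed.

Lemma lower_restrict L : lower_set L -> lower_set (restrict L).
Proof.
move=> /lower_setP lL; apply/lower_setP => y z; rewrite !inE => yL zy.
exact: lL yL zy.
Qed.

Lemma lower_imset_val t : lower_set t -> lower_set (extend t).
Proof.
move=> /lower_setP lt; apply/lower_setP => _ z /imsetP[y yt ->] zy.
have zA := lower_setP _ lA _ _ (valP y) zy.
have -> : z = val (Sub z zA : induced A) by rewrite SubK.
by rewrite mem_imset_val; apply: lt yt _; exact: zy.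
Qed.

Lemma subset_imset_val t t' : (extend t \subset extend t') = (t \subset t').
Proof.
apply/idP/idP => [/subsetP tt'|]; last exact: imsetS.
by apply/subsetP => y; rewrite -mem_imset_val => /tt'; rewrite mem_imset_val.
Qed.

Lemma disjoint_imset_val t t' : [disjoint extend t & extend t'] = [disjoint t & t'].
Proof.
apply/idP/idP => tt'; apply/pred0P => z /=; apply/negP => /andP[].
  by rewrite -(mem_imset_val t) => /(disjointI tt'); rewrite mem_imset_val => /negP.
by move=> /imsetP[y yt ->]; rewrite mem_imset_val; apply/negP; exact: disjointI yt.
Qed.

Lemma conn_imset_val t : conn (extend t) <-> conn t.
Proof.
split=> ct U V lU lV UV tUV.
  have := ct _ _ (lower_imset_val lU) (lower_imset_val lV).
  by rewrite disjoint_imset_val /extend -imsetU -/(extend _) !subset_imset_val; exact.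
have := ct _ _ (lower_restrict lU) (lower_restrict lV).
have sub L : (t \subset restrict L) = (extend t \subset L).
  rewrite -subset_imset_val imset_restrict subsetI imset_val_sub andbT //.
rewrite !sub; apply.
  by rewrite -disjoint_imset_val !imset_restrict (disjointWl (subsetIl _ _)) // (disjointWr (subsetIl _ _)).
rewrite -subset_imset_val /extend imsetU -!/(extend _) !imset_restrict -setIUl subsetI tUV.
exact: imset_val_sub.
Qed.

Lemma cover_imset_val (S : {set {set induced A}}) :
  cover (extend @: S) = extend (cover S).
Proof.
apply/setP => z; apply/bigcupP/imsetP => [[_ /imsetP[t tS ->] /imsetP[y yt ->]]|].
  by exists y => //; apply/bigcupP; exists t.
by case=> y /bigcupP[t tS yt] ->; exists (extend t); exact: imset_f.
Qed.

Lemma tubing_induced (T : {set {set induced A}}) :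
  tubing T <-> tubing_in A (extend @: T).
Proof.
split=> [/tubingP[cT lT nT fT covT]|[cT lT nT fT covT]]; last apply/tubingP.
  split.
  - by move=> _ /imsetP[t tT ->]; apply/conn_imset_val; exact: cT.
  - by move=> _ /imsetP[t tT ->]; apply: lower_imset_val; exact: lT.
  - move=> _ _ /imsetP[s sT ->] /imsetP[t tT ->].
    by rewrite /nod !subset_imset_val disjoint_imset_val; exact: nT.
  - move=> S ST S0 y yA; pose S' := [set t in T | extend t \in S].
    have SE : S = (extend @: S').
      apply/setP => s; apply/idP/imsetP => [sS|[t]]; last by rewrite inE => /andP[_ ?] ->.
      have /imsetP[t tT E] := subsetP ST s sS.
      by exists t; rewrite // inE tT -E.
    rewrite SE cover_imset_val.
    have -> : y = val (Sub y yA : induced A) by rewrite SubK.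
    rewrite -imset_val_boundary subset_imset_val => /(fT S').
    case=> //; first by apply/subsetP => t; rewrite inE => /andP[].
      by apply: contraNneq S0 => S'0; rewrite SE S'0 imset0.
    move=> z zS zE; exists (val z); rewrite ?mem_imset_val //.
    by rewrite -!imset_val_boundary zE.
  - move=> T0; rewrite cover_imset_val; apply/negP => AT.
    have /covT/negP : T != set0 by apply: contraNneq T0 => ->; rewrite imset0.
    by apply; apply/subsetP => y _; rewrite -mem_imset_val (subsetP AT) //; exact: valP.
split.
- by move=> t tT; apply/conn_imset_val/cT/imset_f.
- move=> t tT; rewrite -[t]restrict_imset; apply/lower_restrict/lT; exact: imset_f.
- move=> s t sT tT; have := nT _ _ (imset_f _ sT) (imset_f _ tT).
  by rewrite /nod !subset_imset_val disjoint_imset_val.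
- move=> S ST S0 y _ yS; have := fT (extend @: S).
  have S0' : (extend @: S) != set0.
    by have /set0Pn[s sS] := S0; apply/set0Pn; exists (extend s); exact: imset_f.
  case/(_ (imsetS _ ST) S0' (val y) (valP y)).
    by rewrite cover_imset_val -imset_val_boundary subset_imset_val.
  move=> z; rewrite cover_imset_val => /imsetP[w wS ->]; rewrite -!imset_val_boundary.
  by move=> E; exists w => //; exact: imset_inj val_inj _ _ E.
- move=> T0; have : (extend @: T) != set0.
    by have /set0Pn[s sS] := T0; apply/set0Pn; exists (extend s); exact: imset_f.
  move=> /covT; rewrite cover_imset_val; apply: contra => /subsetP TT.
  by apply/subsetP => z zA; apply/imsetP; exists (Sub z zA); rewrite ?SubK // TT ?inE.
Qed.

End InducedTubings.

(** * The case of a trivial bundle *)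

Section TrivialBundle.
Context {d : Order.disp_t} {P : finPOrderType d} (x : P).
Hypothesis xmax : forall y : P, ~~ (x < y)%O.
Hypothesis xbundle : bundle x = [set x].
Implicit Types (y z u v w : P) (L t C : {set P}) (S T : {set {set P}}).

Local Notation D := (boundary x).

(* A tube of [P - x] is coded by the smallest filled set of [P] containing it,
   [M] being replaced by [x |: M] when [D \subset M]. *)
Record split_stage S T : Prop := SplitStage {
  split_stage_lower : forall t, t \in T -> lower_set t;
  split_stage_x : forall t, t \in T -> (x \in t) = (D \subset t);
  split_stage_conn : forall t, t \in T -> conn (t :\ x) \/ t \in S;
  split_stage_nod : forall s t, s \in T -> t \in T -> nod s t;
  split_stage_filled : forall S', S' \subset T -> S' != set0 ->
    forall y, y != x -> boundary y \subset cover S' ->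
      exists2 z, z \in cover S' & boundary z = boundary y;
  split_stage_cover : T != set0 -> ~~ ([set~ x] \subset cover T);
  split_stage_new : forall L, L \in S -> ~~ (components (L :\ x) \subset T) }.

Record split_tube L : Prop := SplitTube {
  split_tube_lower : lower_set L;
  split_tube_conn : conn L;
  split_tube_filled : forall y, boundary y \subset L ->
    exists2 z, z \in L & boundary z = boundary y;
  split_tube_x : x \in L;
  split_tube_disc : ~ conn (L :\ x);
  split_tube_neqT : L != setT }.

Definition split_tubes : {set {set P}} := [set L | `[< split_tube L >]].

Lemma split_tubesP L : reflect (split_tube L) (L \in split_tubes).
Proof. by rewrite inE; exact: asboolP. Qed.

Lemma x_notin_boundary y : x \notin boundary y.
Proof. by rewrite inE. Qed.

Lemma boundary_eq_x y : (boundary y == D) = (y == x).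
Proof. by have /setP/(_ y) := xbundle; rewrite !inE. Qed.

Lemma lowerD1 L : lower_set L -> lower_set (L :\ x).
Proof.
move=> /lower_setP lL; apply/lower_setP => y z; rewrite !inE => /andP[yx yL] zy.
rewrite (lL _ _ yL zy) andbT; apply: contraNneq (xmax y) => zx.
by rewrite lt_neqAle eq_sym yx -zx.
Qed.

Lemma setD1_eq L : x \notin L -> L :\ x = L.
Proof. by move=> xL; apply/eqP; rewrite eqEsubset subsetDl subsetD1 subxx xL. Qed.

Lemma boundaryD1 L y : (boundary y \subset L :\ x) = (boundary y \subset L).
Proof. by rewrite subsetD1 x_notin_boundary andbT. Qed.

Lemma lower_boundary_x L : lower_set L -> x \in L -> D \subset L :\ x.
Proof. by move=> lL xL; rewrite boundaryD1; exact: lower_boundary. Qed.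

(** The source of all contradictions with earlier cuts. The pieces are joined by [x] because each
    meets [D], and without [x] they fall apart because none contains [D] although together they
    cover it. *)
Lemma split_tube_of_family S : S != set0 ->
  {in S, forall t : {set P}, [/\ conn t, lower_set t, x \notin t,
     ~~ [disjoint D & t] & ~~ (D \subset t)]} ->
  {in S &, forall s t : {set P}, s != t -> [disjoint s & t]} ->
  D \subset cover S ->
  (forall y, y != x -> boundary y \subset cover S ->
      exists2 z, z \in cover S & boundary z = boundary y) ->
  ~~ ([set~ x] \subset cover S) ->
  [/\ x |: cover S \in split_tubes, (x |: cover S) :\ x = cover S
    & components ((x |: cover S) :\ x) = S].
Proof.
move=> S0 St Sd DS fS cS.
have xS : x \notin cover S by apply/bigcupP => -[t /St[_ _ /negP]].
have lS : lower_set (cover S) by apply: lower_cover => t /St[].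
have t0 t : t \in S -> t != set0.
  by move=> /St[_ _ _ + _]; apply: contraNneq => ->; rewrite -setI_eq0 setI0.
have E : (x |: cover S) :\ x = cover S by rewrite setU1K.
split=> //; last by rewrite E components_unique // => t tS; have [] := St t tS; split=> //; exact: t0.
apply/split_tubesP; split.
- apply/lower_setP => y z; rewrite !in_setU1 => /predU1P[-> zx|yS zy].
    have [//|zNx] := eqVneq z x; apply: (subsetP DS).
    by rewrite inE lt_neqAle zNx.
  by rewrite (lower_setP _ lS _ _ yS zy) orbT.
- move=> U V lU lV dUV sUV.
  wlog xU : U V lU lV dUV sUV / x \in U.
    move=> H; have := subsetP sUV x (setU11 _ _); rewrite inE => /orP[xU|xV].
      exact: H xU.
    by rewrite orbC; apply: H xV => //; rewrite 1?disjoint_sym // [V :|: U]setUC.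
  apply/orP; left; rewrite subUset sub1set xU; apply/bigcupsP => t tS.
  have [ct lt xt Dt _] := St t tS.
  have tUV : t \subset U :|: V.
    apply: subset_trans sUV; apply: subset_trans (subsetUr _ _).
    exact: bigcup_sup.
  have /orP[//|tV] := ct U V lU lV dUV tUV.
  case/negP: Dt; apply: disjointWl (lower_boundary lU xU) _.
  exact: disjointWr tV dUV.
- move=> y; have [->|yx] := eqVneq y x; first by exists x; rewrite ?setU11.
  rewrite -boundaryD1 E => /(fS y yx)[z zS zy].
  by exists z; rewrite // in_setU1 zS orbT.
- exact: setU11.
- rewrite E => cS'; have [t tS] := set0Pn _ S0; have [_ lt _ _ Dt] := St t tS.
  have lV : lower_set (cover (S :\ t)).
    by apply: lower_cover => s; rewrite inE => /andP[_ /St[]].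
  have dtV : [disjoint t & cover (S :\ t)].
    apply/pred0P => v /=; apply/negP => /andP[vt /bigcupP[s]].
    rewrite !inE => /andP[st sS] vs.
    by have := disjointI (Sd _ _ sS tS st) vs; rewrite vt.
  have SV : cover S \subset t :|: cover (S :\ t).
    apply/bigcupsP => s sS; have [->|st] := eqVneq s t; first exact: subsetUl.
    by apply: subset_trans (subsetUr _ _); apply: bigcup_sup; rewrite !inE st.
  have /orP[St'|SV'] := cS' _ _ lt lV dtV SV.
    by case/negP: Dt; exact: subset_trans St'.
  have /set0Pn[v vt] := t0 t tS.
  have vS : v \in cover S by apply/bigcupP; exists t.
  by have := disjointI dtV vt; rewrite (subsetP SV').
- apply: contraNneq cS => cT; apply/subsetP => y; rewrite !inE => yx.
  by have : y \in [set: P] by []; rewrite -cT in_setU1 (negbTE yx).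
Qed.

(** A component missing [D] would already split [L]. One containing [D] would meet all the others,
    so it would be all of [L :\ x], which is disconnected. *)
Lemma split_tube_components L C : split_tube L -> C \in components (L :\ x) ->
  [/\ [/\ conn C, lower_set C, C != set0 & C \subset L], x \notin C,
     ~~ [disjoint D & C] & ~~ (D \subset C)].
Proof.
move=> [lL cL fL xL nL _] CL; have lLx := lowerD1 lL.
have [CLx lC lLC cC C0] := componentsP lLx CL.
have [CL' xC] : C \subset L /\ x \notin C by apply/andP; rewrite -subsetD1.
have meet C' : C' \in components (L :\ x) -> ~~ [disjoint D & C'].
  move=> C'L; have [C'Lx lC' lLC' cC' C'0] := componentsP lLx C'L.
  apply/negP => DC'.
  have lLC'' : lower_set (L :\: C').
    apply/lower_setP => y z; rewrite !in_setD => /andP[yC yL] zy.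
    rewrite (lower_setP _ lL _ _ yL zy) andbT; apply/negP => zC.
    have [yx|yx] := eqVneq y x; last first.
      have /(_ z) := lower_setP _ lLC' y; rewrite !in_setD in_set1 yC yx yL zC /=.
      by move=> /(_ isT zy).
    have [zx|zx] := eqVneq z x.
      by have := subsetP C'Lx z zC; rewrite zx !inE eqxx.
    by have := disjointI DC' (_ : z \in D); rewrite zC inE lt_neqAle zx -yx => /(_ zy).
  have dC : [disjoint C' & L :\: C'] by rewrite disjoint_sym disjoints_subset subsetDr.
  have LC : L \subset C' :|: L :\: C'.
    by apply/subsetP => v vL; rewrite in_setU in_setD vL andbT orbN.
  have /orP[/subsetP/(_ x xL) xC'|LC'] := cL _ _ lC' lLC'' dC LC.
    by have := subsetP C'Lx x xC'; rewrite !inE eqxx.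
  have /set0Pn[v vC] := C'0; have := subsetP LC' v.
  have := subsetP C'Lx v vC; rewrite !inE => /andP[_ ->] /(_ isT).
  by rewrite vC.
split=> //; first exact: meet.
apply/negP => DC; apply: nL; rewrite (_ : L :\ x = C) //.
apply/eqP; rewrite eqEsubset CLx andbT -{1}(cover_components (L :\ x)).
apply/bigcupsP => C' C'L; have [-> //|CC'] := eqVneq C' C.
have := components_disjoint lLx C'L CL CC' => dCC'.
by case/negP: (meet C' C'L); apply: disjointWl DC _; rewrite disjoint_sym.
Qed.

Lemma split_tube_components_neq0 L : split_tube L -> components (L :\ x) != set0.
Proof.
move=> LN; apply/negP => /eqP s0; apply: (split_tube_disc LN).
by rewrite -(cover_components (L :\ x)) s0 /cover big_set0 => U V *; rewrite sub0set.
Qed.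

Lemma split_stage_sub S T T' : split_stage S T -> T' \subset T -> split_stage S T'.
Proof.
move=> [lT xT cT nT fT covT newT] /subsetP T'T; split.
- by move=> t /T'T; exact: lT.
- by move=> t /T'T; exact: xT.
- by move=> t /T'T; exact: cT.
- by move=> s t /T'T sT /T'T; exact: nT.
- by move=> S' S'T; apply: fT; apply: subset_trans S'T _; exact/subsetP.
- move=> T'0; have T0 : T != set0.
    by have /set0Pn[t /T'T tT] := T'0; apply/set0Pn; exists t.
  apply: contra (covT T0) => /subset_trans; apply.
  by apply/bigcupsP => t /T'T tT; exact: bigcup_sup.
- by move=> L /newT; apply: contra => /subset_trans; apply; exact/subsetP.
Qed.

(** * A single cut in the trivial case *)

Section Step.
Context (S : {set {set P}}) (L : {set P}).
Hypothesis SN : S \subset split_tubes.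
Hypothesis LN : L \in split_tubes :\: S.
Hypothesis Sbig : forall L', L' \in split_tubes -> #|L| < #|L'| -> L' \in S.
Hypothesis bigS : forall L', L' \in S -> #|L| <= #|L'|.

Let LS : L \notin S. Proof. by move: LN; rewrite inE => /andP[]. Qed.
Let Lnew : split_tube L. Proof. by apply/split_tubesP; move: LN; rewrite inE => /andP[]. Qed.
Let lL : lower_set L := split_tube_lower Lnew.
Let xL : x \in L := split_tube_x Lnew.
Let lLx : lower_set (L :\ x) := lowerD1 lL.
Let DL : D \subset L := lower_boundary lL xL.
Let sg := components (L :\ x).
Let sgP C (CL : C \in sg) := split_tube_components Lnew CL.
(** Larger tubes are cut first, so no tube cut so far lies inside [L]. *)
Let sub_eq L' : L' \in S -> L' \subset L -> False.
Proof.
move=> L'S L'L; have : L' == L by rewrite eqEcard L'L bigS.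
by move=> /eqP E; move: L'S; rewrite E (negbTE LS).
Qed.

Lemma cover_sg : cover sg = L :\ x.
Proof. exact: cover_components. Qed.

Lemma sg_neq0 : sg != set0.
Proof. exact: split_tube_components_neq0. Qed.

Lemma comp_of v : v \in L -> v != x -> exists2 C, C \in sg & v \in C.
Proof.
move=> vL vx; have : v \in cover sg by rewrite cover_sg !inE vx.
by case/bigcupP => C; exists C.
Qed.

Lemma split_stage_step_to T : L \in T -> split_stage (L |: S) T ->
  split_stage S ((T :\ L) :|: sg).
Proof.
move=> LT [lT xT cT nT fT covT newT].
set T' := (T :\ L) :|: sg.
have T'P t : t \in T' -> (t \in T /\ t != L) \/ t \in sg.
  by rewrite !inE => /orP[/andP[-> ->]|->]; [left|right].
have connT t : t \in T -> t != L -> conn (t :\ x) \/ t \in S.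
  by move=> tT tL; have := cT t tT; rewrite in_setU1 (negbTE tL).
have nod_sg t C : t \in T -> t != L -> C \in sg -> nod t C.
  move=> tT tNL CL; have [[cC lC C0 CsL] xC DC DnC] := sgP CL.
  case/or3P: (nT t L tT LT) => [tL|Lt|dtL]; last 2 first.
  - by rewrite /nod (subset_trans CsL Lt) orbT.
  - by rewrite /nod (disjointWr CsL dtL) !orbT.
  (* A tube inside [L] has not been cut, so it is connected without [x] and lies in [C] or misses
     [C]. If it contained [x] it would contain [D], and both are impossible since [C] meets [D]
     without containing it. *)
  have [ct|/sub_eq/(_ tL)//] := connT t tT tNL.
  have [|tC|dtC] := conn_component lLx CL ct; first exact: setSD.
    have [xt|xt] := boolP (x \in t).
      have := lower_boundary_x (lT t tT) xt => Dt.
      by case/negP: DnC; exact: subset_trans tC.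
    by rewrite /nod; move: tC; rewrite (setD1_eq xt) => ->.
  have [xt|xt] := boolP (x \in t).
    have := lower_boundary_x (lT t tT) xt => Dt.
    by case/negP: DC; exact: disjointWl Dt dtC.
  by rewrite /nod; move: dtC; rewrite (setD1_eq xt) => ->; rewrite !orbT.
split.
- by move=> t /T'P[[/lT]|/sgP[[]]].
- move=> t /T'P[[/xT]//|/sgP[_ /negbTE-> _ /negbTE->//]].
- move=> t /T'P[[/connT h /h//]|/sgP[[ct _ _ _] xt _ _]].
  by left; rewrite (setD1_eq xt).
- move=> s t /T'P[[sT sL]|sC] /T'P[[tT tL]|tC].
  + exact: nT.
  + exact: nod_sg.
  + by rewrite nodC; exact: nod_sg.
  + have [->|st] := eqVneq s t; first exact: nod_refl.
    by rewrite /nod (components_disjoint lLx sC tC st) !orbT.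
- move=> S' S'T S'0 y yx yS'.
  have S'P t : t \in S' -> (t \in T /\ t != L) \/ t \in sg.
    by move=> tS'; apply: T'P; exact: subsetP S'T t tS'.
  pose S1 := S' :&: T :\ L.
  have S1T : S1 \subset T by rewrite (subset_trans (subsetDl _ _)) // subsetIr.
  have S1S' : S1 \subset S' by rewrite (subset_trans (subsetDl _ _)) // subsetIl.
  have inS' t z : t \in S' -> z \in t -> z \in cover S'.
    by move=> tS' zt; apply/bigcupP; exists t.
  (* For an empty boundary a minimal element of any member of [S'] will do. *)
  have [y0|y0] := eqVneq (boundary y) set0.
    have /set0Pn[t tS'] := S'0; have [[tT tL]|tC] := S'P t tS'.
      have [|||z zt <-] := fT [set t] _ _ y yx; rewrite ?sub1set ?y0 ?sub0set //.
        by apply/set0Pn; exists t; rewrite set11.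
      exists z => //; apply: inS' tS' _; move: zt.
      by rewrite /cover big_set1.
    have [[_ lt /set0Pn[v vt] _] _ _ _] := sgP tC.
    have [m mt mmin] := @arg_minnP _ v [in t] (fun m => #|boundary m|) vt.
    exists m; first exact: inS' mt.
    rewrite y0; apply/eqP/set0Pn => -[w wm].
    have wt : w \in t by apply: (subsetP (lower_boundary lt mt)).
    have := mmin w wt; apply/negP; rewrite -ltnNge; apply: proper_card.
    apply/properP; split; last by exists w; rewrite // inE ltxx.
    by move: wm; rewrite inE => wm; apply/subsetP => z; rewrite !inE => /lt_trans; apply.
  (* [L] stands in for those of its components that belong to [S']; the element obtained may lie in
     a component that does not. *)
  have [|||z zV zy] := fT (L |: S1) _ _ y yx.
  - by rewrite subUset sub1set LT.
  - by apply/set0Pn; exists L; rewrite setU11.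
  - apply: subset_trans yS' _; apply/bigcupsP => t tS'.
    have [[tT tL]|/sgP[[_ _ _ tL] _ _ _]] := S'P t tS'.
      by apply: bigcup_sup; rewrite !inE tL tS' tT orbT.
    by apply: (subset_trans tL); apply: bigcup_sup; rewrite setU11.
  have zx : z != x by rewrite -boundary_eq_x zy boundary_eq_x.
  move: zV => /bigcupP[t]; rewrite in_setU1 => /predU1P[->|tS1] zL; last first.
    by exists z => //; apply: inS' zL; exact: subsetP tS1.
  have [C CL zC] := comp_of zL zx; have [[cC lC C0 CsL] xC DC DnC] := sgP CL.
  have zbC := lower_boundary lC zC.
  have [CS'|CS'] := boolP (C \in S'); first by exists z => //; exact: inS' zC.
  have [zS1|zS1] := boolP (z \in cover S1).
    by move: zS1 => /bigcupP[t' /(subsetP S1S')/inS' h /h zS']; exists z.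
  (* Now [boundary y = boundary z] lies in [C]. A tube of [S'] meeting it cannot contain [z], so it
     lies inside [C]; these tubes belong to [T] and can be filled without [L]. *)
  pose S3 := [set t in S1 | t \subset C].
  have zS3 : boundary y \subset cover S3.
    apply/subsetP => w wy; have wC : w \in C by apply: (subsetP zbC); rewrite zy.
    have /bigcupP[t' t'S' wt'] := subsetP yS' w wy.
    have [[t'T t'L]|t'C] := S'P t' t'S'; last first.
      have [E|/(components_disjoint lLx t'C CL)/disjointI/(_ wt')] := eqVneq t' C.
        by rewrite -E t'S' in CS'.
      by rewrite wC.
    have t'S1 : t' \in S1 by rewrite !inE t'L t'S'.
    apply/bigcupP; exists t' => //; rewrite inE t'S1.
    case/or3P: (nod_sg t' C t'T t'L CL) => [//|/subsetP/(_ z zC) zt'|/disjointI/(_ wt')].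
      by case/bigcupP: zS1; exists t'.
    by rewrite wC.
  have [||v vS3 vy] := fT S3 _ _ y yx zS3.
  - by apply/subsetP => t'; rewrite inE => /andP[/(subsetP S1T)].
  - have /set0Pn[w wy] := y0; have /bigcupP[t' t'S3 _] := subsetP zS3 w wy.
    by apply/set0Pn; exists t'.
  exists v => //; move: vS3 => /bigcupP[t']; rewrite inE => /andP[t'S1 _].
  by apply: inS'; exact: subsetP t'S1.
- move=> _; have T0 : T != set0 by apply/set0Pn; exists L.
  apply: contra (covT T0) => /subset_trans; apply.
  apply/bigcupsP => t /T'P[[tT _]|/sgP[[_ _ _ tL] _ _ _]]; first exact: bigcup_sup.
  by apply: subset_trans tL _; exact: bigcup_sup.
(* If all components of [L' :\ x] were present, each would lie inside [L]: it meets [D] without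
   containing it, so it can neither miss [L] nor contain it. Then [L'] itself would lie inside
   [L]. *)
- move=> L' L'S; apply/negP => /subsetP L'T.
  have /split_tubesP L'N := subsetP SN L' L'S.
  apply: (sub_eq L'S); rewrite -(setD1K (split_tube_x L'N)) subUset sub1set xL /=.
  rewrite -(cover_components (L' :\ x)); apply/bigcupsP => C CL'.
  have [_ xC /negP DC /negP DnC] := split_tube_components L'N CL'.
  have [[CT _]|/sgP[[]]//] := T'P C (L'T C CL').
  case/or3P: (nT C L CT LT) => // [LC|dCL].
    by case: DnC; exact: subset_trans LC.
  by case: DC; apply: disjointWl DL _; rewrite disjoint_sym.
Qed.

(** The point is that [L] crosses no other tube of [T], although only its components are known to
    cross none. *)
Lemma split_stage_step_of T : L \in T -> ~~ (sg \subset T) ->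
  split_stage S ((T :\ L) :|: sg) -> split_stage (L |: S) T.
Proof.
move=> LT sgT [lT xT cT nT fT covT newT].
set T' := (T :\ L) :|: sg in lT xT cT nT fT covT newT.
have TT' t : t \in T -> t != L -> t \in T' by move=> tT tL; rewrite !inE tT tL.
have sgT' C : C \in sg -> C \in T' by move=> CL; rewrite inE CL orbT.
have TP t : t \in T -> t = L \/ (t != L /\ t \in T').
  by move=> tT; have [->|tL] := eqVneq t L; [left|right; split; rewrite ?TT'].
have T'0 : T' != set0.
  by have /set0Pn[C CL] := sg_neq0; apply/set0Pn; exists C; exact: sgT'.
have nodL t : t \in T -> t != L -> nod t L.
  move=> tT tL; have tT' := TT' t tT tL.
  have [/exists_inP[C CL tC]|noC] := boolP [exists C in sg, t \subset C].
    by have [[_ _ _ CsL] _ _ _] := sgP CL; rewrite /nod (subset_trans tC CsL).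
  have alt C : C \in sg -> (C \subset t) || [disjoint t & C].
    move=> CL; case/or3P: (nT t C tT' (sgT' C CL)) => [tC|->//|->]; rewrite ?orbT //.
    by case/exists_inP: noC; exists C.
  have [/forall_inP allsub|] := boolP [forall C in sg, C \subset t].
    have Lxt : L :\ x \subset t by rewrite -cover_sg; apply/bigcupsP.
    have xt : x \in t.
      by rewrite xT //; apply: subset_trans Lxt; exact: lower_boundary_x.
    by rewrite /nod -{2}(setD1K xL) subUset sub1set xt Lxt orbT.
  case/forall_inPn => C0 C0L C0t.
  have dC0 : [disjoint t & C0] by have := alt C0 C0L; rewrite (negbTE C0t).
  have xt : x \notin t.
    rewrite xT //; apply/negP => Dt; have [_ _ /negP DC _] := sgP C0L.
    by apply: DC; exact: disjointWl Dt dC0.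
  have [/forall_inP alldis|] := boolP [forall C in sg, [disjoint t & C]].
    rewrite /nod (_ : [disjoint t & L]) ?orbT //.
    apply/pred0P => v /=; apply/negP => /andP[vt vL].
    have vx : v != x by apply: contraNneq xt => <-.
    by have [C CL vC] := comp_of vL vx; have := disjointI (alldis C CL) vt; rewrite vC.
  case/forall_inPn => C1 C1L C1t'.
  have C1t : C1 \subset t by have := alt C1 C1L; rewrite (negbTE C1t') orbF.
  have tS : t \notin S by apply: contra xt => /(subsetP SN)/split_tubesP/split_tube_x.
  have ct : conn t by have := cT t tT'; rewrite (setD1_eq xt) (negbTE tS) => -[].
  have [[_ _ C10 C1sL] _ DC1 _] := sgP C1L.
  (* The remaining case is that [t] contains some components of [L :\ x] and misses others. Then [t]
     and the components it misses are the components of a split tube strictly larger than [L], which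
     has been cut already. *)
  exfalso; pose S2 := t |: [set C in sg | [disjoint t & C]].
  have S2E : cover S2 = (L :\ x) :|: t.
    apply/setP => v; apply/bigcupP/idP => [[s]|].
      rewrite !inE => /predU1P[-> ->|/andP[sC _] vs]; rewrite ?orbT //.
      have [[_ _ _ sL] xs _ _] := sgP sC; rewrite (subsetP sL) // andbT.
      by apply/orP; left; apply: contraNneq xs => <-.
    rewrite !inE => /orP[/andP[vx vL]|vt]; last by exists t; rewrite ?setU11.
    have [C CL vC] := comp_of vL vx; have /orP[Ct|dtC] := alt C CL.
      by exists t; [rewrite setU11|exact: (subsetP Ct)].
    by exists C => //; rewrite !inE CL dtC orbT.
  have S2T' : S2 \subset T'.
    apply/subsetP => s; rewrite in_setU1 inE => /predU1P[->//|/andP[sC _]].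
    exact: sgT'.
  have S20 : S2 != set0 by apply/set0Pn; exists t; rewrite setU11.
  have [||||||LN2 LE cE] := @split_tube_of_family S2.
  - exact: S20.
  - move=> s; rewrite in_setU1 inE => /predU1P[->|/andP[/sgP[[? ? _ _] ? ? ?]]]; last by [].
    split=> //; first exact: lT.
      by apply: contra DC1 => dDt; exact: disjointWr C1t dDt.
    by rewrite -xT.
  - move=> s s'; rewrite !in_setU1 !inE.
    move=> /predU1P[->|/andP[sC ds]] /predU1P[->|/andP[sC' ds']]; rewrite ?eqxx //.
      by rewrite disjoint_sym.
    exact: components_disjoint lLx sC sC'.
  - rewrite S2E; apply: subset_trans (subsetUl _ _); exact: lower_boundary_x.
  - exact: fT.
  - apply: contra (covT T'0) => /subset_trans; apply.
    by apply/bigcupsP => s /(subsetP S2T') sT'; exact: bigcup_sup.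
  have Lsub : L \proper x |: cover S2.
    apply/properP; split.
      apply/subsetP => v vL; rewrite S2E !inE; case: (v == x) => //=.
      by rewrite vL.
    have /subsetPn[v vt vL] : ~~ (t \subset L).
      apply/negP => tL'; have tLx : t \subset L :\ x by rewrite subsetD1 tL'.
      have [tC1|dtC1] := conn_component lLx C1L ct tLx.
        by case/exists_inP: noC; exists C1.
      have /set0Pn[v vC1] := C10; have := subsetP C1t v vC1 => vt.
      by have := disjointI dtC1 vt; rewrite vC1.
    by exists v; rewrite // S2E !inE vt !orbT.
  have := newT _ (Sbig LN2 (proper_card Lsub)).
  by rewrite cE S2T'.
split.
- by move=> t /TP[->|[_ /lT]].
- by move=> t /TP[->|[_ /xT//]]; rewrite xL DL.
- move=> t /TP[->|[_ /cT[]]]; first by right; rewrite setU11.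
    by left.
  by rewrite in_setU1 => ->; rewrite orbT; right.
- move=> s t sT tT; have [->|[sL sT']] := TP s sT; have [->|[tL tT']] := TP t tT.
  + exact: nod_refl.
  + by rewrite nodC; exact: nodL.
  + exact: nodL.
  + exact: nT.
- move=> S' S'T S'0 y yx yS'.
  have [LS'|LS'] := boolP (L \in S'); last first.
    apply: fT => //; apply/subsetP => t tS'; apply: TT'; first exact: subsetP tS'.
    by apply: contraNneq LS' => <-.
  have sub : cover ((S' :\ L) :|: sg) \subset cover S'.
    apply/bigcupsP => t; rewrite !inE => /orP[/andP[_ tS']|/sgP[[_ _ _ tL] _ _ _]].
      exact: bigcup_sup.
    by apply: subset_trans tL _; exact: bigcup_sup.
  have [|||z zS zy] := fT ((S' :\ L) :|: sg) _ _ y yx.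
  - by apply: setSU; exact: setSD.
  - by have /set0Pn[C CL] := sg_neq0; apply/set0Pn; exists C; rewrite inE CL orbT.
  - apply/subsetP => v vy; have /bigcupP[t tS' vt] := subsetP yS' v vy.
    have vx : v != x by apply: contraTneq vy => ->; exact: x_notin_boundary.
    have [tL|tL] := eqVneq t L; last by apply/bigcupP; exists t; rewrite // !inE tL tS'.
    rewrite tL in vt; have [C CL vC] := comp_of vt vx.
    by apply/bigcupP; exists C; rewrite // inE CL orbT.
  by exists z => //; exact: (subsetP sub).
- move=> _; apply: contra (covT T'0) => /subsetP xcov; apply/subsetP => v vx.
  have /bigcupP[t tT vt] := xcov v vx.
  have [tL|[tL tT']] := TP t tT; last by apply/bigcupP; exists t.
  rewrite tL in vt; have [|C CL vC] := comp_of vt; first by move: vx; rewrite !inE.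
  by apply/bigcupP; exists C => //; exact: sgT'.
- move=> L'; rewrite in_setU1 => /predU1P[->//|L'S].
  apply: contra (newT L' L'S) => /subsetP L'T; apply/subsetP => C CL'.
  apply: TT'; first exact: L'T.
  apply: contraTneq CL' => ->; apply/negP => CL'.
  have /split_tubesP L'N := subsetP SN L' L'S.
  by have [_ + _ _] := split_tube_components L'N CL'; rewrite xL.
Qed.

(** Through [split_stage_step_to] this shows that the simplex about to be subdivided belongs to the
    complex. *)
Lemma split_stage_single : split_stage (L |: S) [set L].
Proof.
split.
- by move=> t /set1P->.
- by move=> t /set1P->; rewrite xL DL.
- by move=> t /set1P->; right; rewrite setU11.
- by move=> s t /set1P-> /set1P->; exact: nod_refl.
- move=> S'; rewrite subset1 => /orP[/eqP->|/eqP->]; last by rewrite eqxx.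
  by move=> _ y _; rewrite /cover big_set1; exact: split_tube_filled.
- move=> _; rewrite /cover big_set1; apply: contra (split_tube_neqT Lnew) => xLs.
  apply/eqP/setP => y; rewrite in_setT; have [->//|yx] := eqVneq y x.
  by apply: (subsetP xLs); rewrite !inE.
- move=> L'; rewrite in_setU1 => L'N.
  have {}L'N : split_tube L'.
    by case/predU1P: L'N => [->//|/(subsetP SN)/split_tubesP].
  apply/negP => /subsetP sub; have /set0Pn[C CL] := split_tube_components_neq0 L'N.
  have [_ + _ _] := split_tube_components L'N CL.
  by have /set1P-> := sub C CL; rewrite xL.
Qed.

Lemma split_stage_fresh T : split_stage S T -> L \notin T.
Proof.
move=> ST; apply/negP => /(split_stage_conn ST)[/(split_tube_disc Lnew)//|].
exact/negP.
Qed.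

Lemma split_stage_step_out T : L \notin T ->
  split_stage (L |: S) T <-> ~~ (sg \subset T) /\ split_stage S T.
Proof.
move=> LT; split=> [[lT xT cT nT fT covT newT]|[sgT [lT xT cT nT fT covT newT]]].
  split; first by apply: newT; rewrite setU11.
  split=> // [t tT|L' L'S]; last by apply: newT; rewrite in_setU1 L'S orbT.
  have := cT t tT; rewrite in_setU1 => -[|/predU1P[tL|]]; [by left| |by right].
  by rewrite -tL tT in LT.
split=> // [t tT|L']; last by rewrite in_setU1 => /predU1P[->|/newT].
by case: (cT t tT) => [|tS]; [left|right; rewrite in_setU1 tS orbT].
Qed.

End Step.

(** With [D] empty, every minimal element is in the bundle, hence equal to [x]. As [x] is maximal,
    nothing lies above it. *)
Lemma boundary_eq0 : D = set0 -> [set~ x] = set0.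
Proof.
move=> D0; apply/setP => y; rewrite !inE; apply/negbTE/negPn.
have [m] := @arg_minnP _ y [pred m | (m <= y)%O] (fun m => #|boundary m|) (lexx y).
rewrite inE => my mmin; have m0 : boundary m == D.
  rewrite D0; apply/set0Pn => -[w]; rewrite inE => wm.
  have := mmin w; rewrite inE (ltW (lt_le_trans wm my)) => /(_ isT).
  apply/negP; rewrite -ltnNge; apply: proper_card; apply/properP; split.
    by apply/subsetP => z; rewrite !inE => /lt_trans; apply.
  by exists w; rewrite inE ?ltxx.
rewrite boundary_eq_x in m0; move: my; rewrite (eqP m0) le_eqVlt eq_sym.
by rewrite (negbTE (xmax y)) orbF.
Qed.

Lemma split_stage_last T : split_stage split_tubes T <-> tubing T.
Proof.
split=> [[lT xT cT nT fT covT newT]|/tubingP[cT lT nT fT covT]].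
  have D0 : T != set0 -> D != set0.
    by move=> /covT; apply: contra => /eqP/boundary_eq0->; rewrite sub0set.
  apply/tubingP; split => //.
  - move=> t tT; have [ctx|/split_tubesP/split_tube_conn//] := cT t tT.
    have [xt|xt] := boolP (x \in t); last by rewrite -(setD1_eq xt).
    (* [x] is attached to the connected set [t :\ x] through an element of [D]. *)
    have /D0/set0Pn[z zD] : T != set0 by apply/set0Pn; exists t.
    move=> U V lU lV dUV sUV.
    wlog xU : U V lU lV dUV sUV / x \in U.
      move=> H; have := subsetP sUV x xt; rewrite inE => /orP[xU|xV].
        exact: H xU.
      by rewrite orbC; apply: H xV => //; rewrite 1?disjoint_sym // [V :|: U]setUC.
    have /orP[tU|tV] := ctx U V lU lV dUV (subset_trans (subsetDl _ _) sUV).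
      by rewrite -(setD1K xt) subUset sub1set xU tU.
    have zU := subsetP (lower_boundary lU xU) z zD.
    have := subsetP (subset_trans (lower_boundary_x (lT t tT) xt) tV) z zD.
    by rewrite (disjointFr dUV zU).
  - move=> S' S'T S'0 y _; have [->|yx] := eqVneq y x; last exact: fT.
    move=> DS'; exists x => //; apply: contraT => xS'.
    have /D0/set0Pn[z0 z0D] : T != set0.
      by have /set0Pn[t /(subsetP S'T) tT] := S'0; apply/set0Pn; exists t.
    have xt t : t \in S' -> x \notin t.
      by move=> tS'; apply: contra xS' => xt; apply/bigcupP; exists t.
    (* If [x] were missing, the maximal tubes of [S'] that meet [D] would be the components of a
       split tube, all present in [T]. *)
    pose S2 := [set t in S' | ~~ [disjoint D & t] &&
      [forall s in S', (t \subset s) ==> (s \subset t)]].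
    have S2S' : S2 \subset S' by apply/subsetP => t; rewrite inE => /andP[].
    have S2T := subset_trans S2S' S'T.
    have DS2 : D \subset cover S2.
      apply/subsetP => z zD; have /bigcupP[t0 t0S' zt0] := subsetP DS' z zD.
      have t0P : (t0 \in S') && (z \in t0) by rewrite t0S'.
      have [t /= /andP[tS' zt] tmax] := @arg_maxnP _ t0
        [pred t | (t \in S') && (z \in t)] (fun t => #|t|) t0P.
      apply/bigcupP; exists t => //; rewrite inE tS' /=; apply/andP; split.
        by apply/negP => /disjointI/(_ zD); rewrite zt.
      apply/forall_inP => s sS'; apply/implyP => ts.
      have := tmax s; rewrite /= sS' (subsetP ts z zt) => /(_ isT) st.
      by rewrite (_ : t = s) //; apply/eqP; rewrite eqEcard ts.
    have S20 : S2 != set0.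
      by have /bigcupP[t tS2 _] := subsetP DS2 z0 z0D; apply/set0Pn; exists t.
    have [|||||LN2 LE cE] := @split_tube_of_family S2 S20.
    + move=> t tS2; have tS' := subsetP S2S' t tS2; have tT := subsetP S2T t tS2.
      split; [|exact: lT|exact: xt| |].
      * have [|/split_tubesP/split_tube_x xt'] := cT t tT; first by rewrite (setD1_eq (xt t tS')).
        by have := xt t tS'; rewrite xt'.
      * by move: tS2; rewrite inE => /and3P[].
      * by rewrite -xT // xt.
    + move=> s t; rewrite !inE => /and3P[sS' _ /forall_inP smax] /and3P[tS' _ /forall_inP tmax].
      have := nT s t (subsetP S'T s sS') (subsetP S'T t tS').
      case/or3P => // [st|ts]; first by rewrite eqEsubset st (implyP (smax t tS')).
      by rewrite eqEsubset ts (implyP (tmax s sS')).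
    + exact: DS2.
    + exact: fT.
    + have T0 : T != set0 by have /set0Pn[t /(subsetP S2T) tT] := S20; apply/set0Pn; exists t.
      apply: contra (covT T0) => /subset_trans; apply.
      by apply/bigcupsP => t /(subsetP S2T) tT; exact: bigcup_sup.
    by have := newT _ LN2; rewrite cE S2T.
  - by move=> /covT; apply: contra; apply: subset_trans; exact: subsetT.
have xcov S' : S' \subset T -> S' != set0 -> D \subset cover S' -> x \in cover S'.
  move=> S'T S'0 /(fT S' S'T S'0 x (in_setT x))[z zS' /eqP].
  by rewrite boundary_eq_x => /eqP<-.
have cov1 (t : {set P}) : cover [set t] = t by rewrite /cover big_set1.
have xT t : t \in T -> (x \in t) = (D \subset t).
  move=> tT; apply/idP/idP; first by move=> xt; exact: lower_boundary (lT t tT) xt.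
  by have := xcov [set t]; rewrite sub1set cov1; apply => //; apply/set0Pn; exists t; rewrite set11.
have covTx : T != set0 -> ~~ ([set~ x] \subset cover T).
  move=> T0; apply: contra (covT T0) => xsub; apply/subsetP => y _.
  have [->|yx] := eqVneq y x; last by apply: (subsetP xsub); rewrite !inE.
  by apply: xcov => //; apply/subsetP => z zD; apply: (subsetP xsub); rewrite !inE;
    apply: contraTneq zD => ->; exact: x_notin_boundary.
split => //.
- move=> t tT; have [ct|nct] := pselect (conn (t :\ x)); [by left|right].
  apply/split_tubesP; split => //; [exact: lT|exact: cT| | |].
  + move=> y yt; have := fT [set t]; rewrite sub1set cov1; apply => //.
    by apply/set0Pn; exists t; rewrite set11.
  + by apply: contra_notT nct => xt; rewrite (setD1_eq xt); exact: cT.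
  + have T0 : T != set0 by apply/set0Pn; exists t.
    by apply: contraNneq (covT T0) => <-; exact: bigcup_sup.
- by move=> S' S'T S'0 y _; exact: fT.
- move=> L /split_tubesP LN; apply/negP => LT.
  have := xcov _ LT (split_tube_components_neq0 LN).
  rewrite cover_components => /(_ (lower_boundary_x (split_tube_lower LN) (split_tube_x LN))).
  by rewrite !inE eqxx.
Qed.

(** * The tubings of [P - x] as the initial complex *)

Lemma lower_setC1 : lower_set [set~ x].
Proof.
apply/lower_setP => y z; rewrite !inE => yx zy; apply: contraNneq (xmax y) => zx.
by rewrite lt_neqAle eq_sym yx -zx.
Qed.

Local Notation A := [set~ x].
Local Notation extend := (@extend _ P A).
Local Notation restrict := (@restrict _ P A).

(** [None] marks the subsets that code no lower set of [P - x]; their indices stay idle until a cut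
    uses them. *)
Definition split_uncode L : option {set induced A} :=
  if lower_set L && ((x \in L) == (D \subset L)) then Some (restrict L) else None.

Lemma extend_restrictD1 L : extend (restrict L) = L :\ x.
Proof. by rewrite imset_restrict setDE. Qed.

Lemma x_notin_extend (t : {set induced A}) : x \notin extend t.
Proof. by apply/negP => /(subsetP (imset_val_sub t)); rewrite !inE eqxx. Qed.

Lemma mem_relabel_split (s : {set {set induced A}}) L :
  L \in relabel_set split_uncode s =
  [&& lower_set L, (x \in L) == (D \subset L) & restrict L \in s].
Proof. by rewrite inE /split_uncode andbA; case: ifP. Qed.

(** A code is recovered from its trace on [P - x], since whether it contains [x] is decided by
    [D]. *)
Lemma split_stage_first T :
  split_stage set0 T <-> exists2 s, tubing s & T = relabel_set split_uncode s.
Proof.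
have lA := lower_setC1.
split=> [[lT xT cT nT fT covT _]|[s /(tubing_induced lA)[cT lT nT fT covT] ->]].
  exists (restrict @: T).
    apply/(tubing_induced lA).
    have sP t : t \in extend @: (restrict @: T) -> exists2 L, L \in T & t = L :\ x.
      by move=> /imsetP[_ /imsetP[L LT ->] ->]; exists L; rewrite ?extend_restrictD1.
    split.
    - by move=> _ /sP[L LT ->]; have [//|] := cT L LT; rewrite inE.
    - by move=> _ /sP[L LT ->]; exact: lowerD1 (lT L LT).
    - move=> _ _ /sP[K KT ->] /sP[L LT ->]; rewrite /nod.
      case/or3P: (nT K L KT LT) => [KL|LK|dKL].
      + by rewrite setSD.
      + by rewrite (setSD _ LK) orbT.
      + by rewrite (disjointWl (subsetDl _ _)) ?orbT // (disjointWr (subsetDl _ _)).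
    - move=> S' S'T S'0 y; rewrite !inE => yx yS'.
      pose S2 := [set L in T | L :\ x \in S'].
      have [|||z /bigcupP[L]] := fT S2 _ _ y yx.
      + by apply/subsetP => L; rewrite inE => /andP[].
      + have /set0Pn[t tS'] := S'0; have [L LT tE] := sP t (subsetP S'T t tS').
        by apply/set0Pn; exists L; rewrite inE LT -tE.
      + apply: subset_trans yS' _; apply/bigcupsP => t tS'.
        have [L LT tE] := sP t (subsetP S'T t tS'); rewrite tE.
        by apply: subset_trans (subsetDl _ _) _; apply: bigcup_sup; rewrite inE LT -tE.
      rewrite inE => /andP[LT LS'] zL zy; exists z => //.
      apply/bigcupP; exists (L :\ x) => //; rewrite !inE zL andbT.
      by rewrite -boundary_eq_x zy boundary_eq_x.
    - move=> /set0Pn[t /sP[L LT _]].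
      have T0 : T != set0 by apply/set0Pn; exists L.
      apply: contra (covT T0) => /subset_trans; apply.
      apply/bigcupsP => _ /sP[K KT ->]; apply: subset_trans (subsetDl _ _) _.
      exact: bigcup_sup.
  apply/setP => L; rewrite mem_relabel_split; apply/idP/and3P => [LT|[lL /eqP xL]].
    by rewrite lT // xT // eqxx imset_f.
  move=> /imsetP[K KT LK]; suff -> : L = K by [].
  have E : L :\ x = K :\ x by rewrite -!extend_restrictD1 LK.
  apply/setP => y; have [->|yx] := eqVneq y x.
    by rewrite xL xT // -boundaryD1 -(boundaryD1 K) E.
  by have /setP/(_ y) := E; rewrite !inE yx.
set T0 := relabel_set _ _.
have sP L : L \in T0 -> L :\ x \in extend @: s.
  by rewrite mem_relabel_split => /and3P[_ _ Ls]; rewrite -extend_restrictD1 imset_f.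
have lT0 L : L \in T0 -> lower_set L by rewrite mem_relabel_split => /and3P[].
have xT0 L : L \in T0 -> (x \in L) = (D \subset L).
  by rewrite mem_relabel_split => /and3P[_ /eqP].
have covT0 : T0 != set0 -> ~~ (A \subset cover T0).
  move=> /set0Pn[L /sP Ls]; have s0 : extend @: s != set0 by apply/set0Pn; exists (L :\ x).
  apply: contra (covT s0) => AT; apply/subsetP => v vA.
  have /bigcupP[K KT vK] := subsetP AT v vA.
  by apply/bigcupP; exists (K :\ x); [exact: sP|move: vA; rewrite !inE vK andbT].
split => //.
- by move=> L /sP/cT; left.
- move=> K L KT LT; have D0 : D != set0.
    have /covT0 : T0 != set0 by apply/set0Pn; exists K.
    by apply: contra => /eqP/boundary_eq0->; rewrite sub0set.
  have subD1 K' L' : K' \in T0 -> L' \in T0 -> K' :\ x \subset L' :\ x -> K' \subset L'.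
    move=> K'T L'T KL; have KL' := subset_trans KL (subsetDl _ _).
    have [xK|xK] := boolP (x \in K'); last by rewrite -(setD1_eq xK).
    rewrite -(setD1K xK) subUset sub1set KL' andbT xT0 //.
    by apply: subset_trans KL'; apply: lower_boundary_x => //; exact: lT0.
  case/or3P: (nT _ _ (sP K KT) (sP L LT)) => [h|h|dKL].
  - by rewrite /nod (subD1 K L KT LT h).
  - by rewrite /nod (subD1 L K LT KT h) orbT.
  rewrite /nod (_ : [disjoint K & L]) ?orbT //.
  apply/pred0P => v /=; apply/negP => /andP[vK vL].
  have [vx|vx] := eqVneq v x.
    rewrite vx in vK vL; have /set0Pn[z zD] := D0.
    have zK := subsetP (lower_boundary_x (lT0 K KT) vK) z zD.
    have zL := subsetP (lower_boundary_x (lT0 L LT) vL) z zD.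
    by have := disjointI dKL zK; rewrite zL.
  by have := disjointI dKL (_ : v \in K :\ x); rewrite !inE vx vK vL => /(_ isT).
- move=> S' S'T S'0 y yx yS'.
  pose S2 := [set L :\ x | L : {set P} in S'].
  have [||||z /bigcupP[_ /imsetP[L LS' ->] zL] zy] := fT S2 _ _ y _ _.
  + by apply/subsetP => _ /imsetP[L LS' ->]; apply: sP; exact: subsetP LS'.
  + by have /set0Pn[t tS'] := S'0; apply/set0Pn; exists (t :\ x); exact: imset_f.
  + by rewrite !inE.
  + apply/subsetP => v vy; have /bigcupP[L LS' vL] := subsetP yS' v vy.
    apply/bigcupP; exists (L :\ x); first exact: imset_f.
    by rewrite !inE vL andbT; apply: contraTneq vy => ->; exact: x_notin_boundary.
  by exists z => //; apply/bigcupP; exists L => //; move: zL; rewrite inE => /andP[].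
- by move=> L; rewrite inE.
Qed.

Lemma split_uncode_onto (t : {set induced A}) : lower_set t -> exists L, split_uncode L = Some t.
Proof.
move=> lt; have lM := lower_imset_val lower_setC1 lt.
exists (if D \subset extend t then x |: extend t else extend t).
have rE : restrict (x |: extend t) = t.
  apply/setP => y; rewrite in_set in_setU1 mem_imset_val.
  by have := valP y; rewrite !inE => /negbTE->.
case: ifP => DM; rewrite /split_uncode; last first.
  by rewrite lM (negbTE (x_notin_extend t)) DM eqxx restrict_imset.
rewrite setU11 (subset_trans DM (subsetUr _ _)) eqxx rE andbT ifT //.
apply/lower_setP => y z; rewrite !in_setU1 => /predU1P[->|yM] zy.
  have [//|zx] := eqVneq z x; apply: (subsetP DM).
  by rewrite inE lt_neqAle zx.
by rewrite (lower_setP _ lM _ _ yM zy) orbT.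
Qed.

End TrivialBundle.

Lemma tubing0 {d} {P : finPOrderType d} : tubing (set0 : {set {set P}}).
Proof.
apply/tubingP; split; [by move=> t; rewrite inE|by move=> t; rewrite inE
  |by move=> s t; rewrite inE| |by rewrite eqxx].
by move=> S; rewrite subset0 => /eqP->; rewrite eqxx.
Qed.

Lemma truncations_trivial_bundle {R : realType} {d} {P : finPOrderType d} (x : P) n
    (Q : set 'rV[R]_n) :
  (forall y : P, ~~ (x < y)%O) -> bundle x = [set x] ->
  realizes Q (@tubing _ (induced [set~ x])) ->
  exists Q', iterated_truncation Q Q' /\ realizes Q' (@tubing _ P).
Proof.
move=> xmax xb QR.
have [|||Q' [it Q'R]] := @iterated_truncation_realizes R n _ (split_tubes x)
  (fun L => #|P| - #|L|)%N (fun L => components (L :\ x))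
  (fun S T => `[< split_stage x S T >]) _ _ Q.
- move=> S s t /asboolP sS ts; apply/asboolP; exact: split_stage_sub sS ts.
- move=> S L SN LN below above.
  have Sbig L' : L' \in split_tubes x -> #|L| < #|L'| -> L' \in S.
    move=> L'N LL'; apply: below => //; apply: ltn_sub2l => //.
    by apply: leq_trans LL' _; exact: max_card.
  have bigS L' : L' \in S -> #|L| <= #|L'|.
    move=> /above; rewrite leq_sub2lE //; exact: max_card.
  have LN' : split_tube x L by apply/split_tubesP; move: LN; rewrite inE => /andP[].
  have fresh T : split_stage x S T -> L \notin T by move=> /split_stage_fresh; apply.
  split.
  + apply/asboolP.
    have := split_stage_step_to xmax xb SN LN bigS (set11 L) (split_stage_single xmax SN LN).
    by rewrite setDv set0U.
  + exact: split_tube_components_neq0.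
  + by move=> T /asboolP; exact: fresh.
  + move=> T; rewrite /stellar; case: ifPn => LT; last first.
      apply/asboolP/andP => [/(split_stage_step_out x S LT)[? ?]|[? /asboolP ?]].
        by split=> //; exact/asboolP.
      exact/(split_stage_step_out x S LT).
    apply/asboolP/andP => [TS|[sgT /asboolP TS]].
      split; first by apply: split_stage_new TS _ _; rewrite setU11.
      apply/asboolP; exact: split_stage_step_to.
    exact: (split_stage_step_of xmax SN LN Sbig).
- apply: (relabel_realizes (g := @split_uncode _ P x) QR).
  + by exists set0; exact: tubing0.
  + move=> s i /tubingP sT is_; apply: (split_uncode_onto xmax).
    exact: tubing_lower sT _ is_.
  + by move=> T; split=> [/asboolP/(split_stage_first xmax xb)//|h]; apply/asboolP/(split_stage_first xmax xb).
exists Q'; split => //; apply: eq_realizes Q'R => T.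
by apply/asboolP/idP => /(split_stage_last xmax xb).
Qed.

(** * The case of a nontrivial bundle *)

Definition fills {d} {P : finPOrderType d} (L : {set P}) : Prop :=
  forall y, boundary y \subset L -> exists2 z, z \in L & boundary z = boundary y.

(** * Numbering of the bundle by the coordinates of the simplex *)

Section BundleIndex.
Context {d : Order.disp_t} {P : finPOrderType d} (x : P).
Local Notation b := (bundle x).

(** The ordinal has the shape of the coordinates of [simplex k] for [k = #|b|.-1]; its bound is
    [#|b|], as [x] is in the bundle. *)
Definition bundle_pt (j : 'I_(#|b|.-1).+1) : P := nth x (enum b) j.

Definition bundle_idx (y : P) : 'I_(#|b|.-1).+1 := inord (index y (enum b)).

Let size_enum_b : size (enum b) = (#|b|.-1).+1.
Proof. by rewrite prednK -?cardE //; apply/card_gt0P; exists x; rewrite inE. Qed.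

Lemma bundle_ptP j : bundle_pt j \in b.
Proof. by rewrite -mem_enum mem_nth // size_enum_b. Qed.

Lemma bundle_idxK y : y \in b -> bundle_pt (bundle_idx y) = y.
Proof.
move=> yb; rewrite /bundle_pt inordK ?nth_index ?mem_enum //.
by rewrite -size_enum_b index_mem mem_enum.
Qed.

Lemma bundle_ptK j : bundle_idx (bundle_pt j) = j.
Proof.
by rewrite /bundle_idx /bundle_pt index_uniq ?inord_val ?enum_uniq // size_enum_b.
Qed.

End BundleIndex.

Section NontrivialBundle.
Context {d : Order.disp_t} {P : finPOrderType d} (x : P).
Local Notation b := (bundle x).
Local Notation D := (boundary x).
Hypothesis bmax : forall y z : P, y \in b -> ~~ (y < z)%O.
Hypothesis bN1 : b != [set x].
Hypothesis D0 : D != set0.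
Implicit Types (y z u v w : P) (B K L M t C U V : {set P}) (F S T : {set {set P}}).

Lemma bundleE y : (y \in b) = (boundary y == D).
Proof. by rewrite inE. Qed.

Lemma x_in_b : x \in b.
Proof. by rewrite inE. Qed.

Lemma le_bundle y z : y \in b -> (y <= z)%O -> y = z.
Proof.
move=> yb; rewrite le_eqVlt => /predU1P[//|yz].
by have := bmax z yb; rewrite yz.
Qed.

Lemma boundary_disjoint_b y z : z \in boundary y -> z \notin b.
Proof. by rewrite inE => zy; apply: contraL zy; exact: bmax. Qed.

Lemma boundary_sub_b L y : (boundary y \subset L :|: b) = (boundary y \subset L).
Proof.
apply/idP/idP => [/subsetP h|/subset_trans]; last by apply; exact: subsetUl.
apply/subsetP => z zy; have := h z zy.
by rewrite in_setU (negbTE (boundary_disjoint_b zy)) orbF.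
Qed.

Lemma lower_D L y : lower_set L -> y \in L -> y \in b -> D \subset L.
Proof. by move=> lL yL; rewrite bundleE => /eqP<-; exact: lower_boundary. Qed.

Lemma lower_Ub L : lower_set L -> D \subset L -> lower_set (L :|: b).
Proof.
move=> lL DL; apply/lower_setP => y z; rewrite !in_setU => /orP[yL|yb] zy.
  by rewrite (lower_setP _ lL _ _ yL zy).
have [->|zNy] := eqVneq z y; first by rewrite yb orbT.
rewrite (subsetP DL) //; move: yb; rewrite bundleE => /eqP<-.
by rewrite inE lt_neqAle zNy.
Qed.

Lemma lower_Db L B : lower_set L -> B \subset b -> lower_set (L :\: B).
Proof.
move=> lL /subsetP Bb; apply/lower_setP => y z; rewrite !in_setD => /andP[yB yL] zy.
rewrite (lower_setP _ lL _ _ yL zy) andbT; apply: contra yB => zB.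
by rewrite -(le_bundle (Bb z zB) zy).
Qed.

Lemma lower_D1 L y : lower_set L -> y \in b -> lower_set (L :\ y).
Proof. by move=> lL yb; apply: lower_Db; rewrite ?sub1set. Qed.

(** Two tubes above [D] are therefore nested. This needs [D] nonempty; the other case is an
    antichain, treated separately. *)
Lemma meetD U V : D \subset U -> D \subset V -> ~~ [disjoint U & V].
Proof.
move=> /subsetP DU /subsetP DV; have /set0Pn[z zD] := D0.
by apply/negP => /disjointI/(_ (DU z zD)); rewrite DV.
Qed.

Lemma conn_Ub L : lower_set L -> D \subset L -> conn L -> conn (L :|: b).
Proof.
move=> lL DL cL U V lU lV dUV; rewrite subUset => /andP[LUV /subsetP bUV].
wlog LU : U V lU lV dUV LUV bUV / L \subset U.
  move=> H; have /orP[LU|LV] := cL U V lU lV dUV LUV; first exact: H LU.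
  rewrite orbC; apply: H LV => //; rewrite 1?disjoint_sym // 1?[V :|: U]setUC //.
apply/orP; left; rewrite subUset LU; apply/subsetP => y yb.
have := bUV y yb; rewrite in_setU => /orP[//|yV].
have := meetD (subset_trans DL LU) (lower_D lV yV yb).
by rewrite dUV.
Qed.

(** Of two disjoint lower sets at most one contains bundle elements, because such an element brings
    [D] with it. So a single bundle element connects as well as the whole bundle. *)
Lemma conn_of_Ub L y : lower_set L -> y \in L -> y \in b -> conn (L :|: b) -> conn L.
Proof.
move=> lL yL yb cL U V lU lV dUV LUV.
wlog yU : U V lU lV dUV LUV / y \in U.
  move=> H; have := subsetP LUV y yL; rewrite in_setU => /orP[yU|yV]; first exact: H yU.
  rewrite orbC; apply: H yV => //; rewrite 1?disjoint_sym // 1?[V :|: U]setUC //.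
have DU := lower_D lU yU yb.
have notV z : z \in b -> z \notin V.
  by move=> zb; apply/negP => zV; have := meetD DU (lower_D lV zV zb); rewrite dUV.
apply/orP; left; apply/subsetP => v vL.
have [vb|vb] := boolP (v \in b).
  by have := subsetP LUV v vL; rewrite in_setU (negbTE (notV v vb)) orbF.
have /orP[/subsetP/(_ v)|/subsetP/(_ y)] :
    (L :|: b \subset U :|: b) || (L :|: b \subset V).
- apply: cL => //; first exact: lower_Ub.
    rewrite disjoint_sym; apply/pred0P => z /=; apply/negP => /andP[zV].
    by rewrite in_setU (disjointFl dUV zV) => /notV; rewrite zV.
  apply/subsetP => z; rewrite !in_setU => /orP[/(subsetP LUV)|->]; last by rewrite orbT.
  by rewrite in_setU => /orP[->|->]; rewrite ?orbT.
- by rewrite !in_setU vL (negbTE vb) !orbF => /(_ isT).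
- by rewrite in_setU yL (negbTE (notV y yb)) => /(_ isT).
Qed.

Lemma fills_Ub L : fills L -> fills (L :|: b).
Proof.
move=> fL y; rewrite boundary_sub_b => /fL[z zL zy].
by exists z; rewrite // in_setU zL.
Qed.

Lemma fills_of_Ub L y : y \in L -> y \in b -> fills (L :|: b) -> fills L.
Proof.
move=> yL yb fL w wL; have [|z] := fL w; first by rewrite boundary_sub_b.
rewrite in_setU => /orP[zL zw|]; first by exists z.
by rewrite bundleE => /eqP zD zw; exists y => //; move: yb; rewrite bundleE -zw zD => /eqP.
Qed.

(** * The component [W] and the facets [W :\ y] *)

Definition W := component [set: P] x.

Lemma lower_setT : lower_set [set: P].
Proof. by apply/lower_setP => y z _ _; rewrite in_setT. Qed.

Lemma lowerW : lower_set W.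
Proof. exact: component_lower lower_setT. Qed.

Lemma lowerCW : lower_set (~: W).
Proof. by rewrite -setTD; exact: componentD_lower lower_setT. Qed.

Lemma connW : conn W.
Proof. exact: component_conn. Qed.

Lemma xW : x \in W.
Proof. exact: mem_component. Qed.

Lemma DW : D \subset W.
Proof. exact: lower_boundary lowerW xW. Qed.

Lemma bW : b \subset W.
Proof.
apply/subsetP => y yb; have /set0Pn[z zD] := D0.
have zy : z \in boundary y by move: yb; rewrite bundleE => /eqP->.
apply: contraT => yW; have := lower_boundary lowerCW (_ : y \in ~: W).
rewrite in_setC yW => /(_ isT)/subsetP/(_ z zy).
by rewrite in_setC (subsetP DW z zD).
Qed.

Lemma nodW L : conn L -> nod W L.
Proof.
move=> cL; have := cL _ _ lowerW lowerCW; rewrite setUCr subsetT.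
rewrite -setI_eq0 setICr eqxx => /(_ isT isT)/orP[LW|].
  by rewrite /nod LW orbT.
by rewrite -disjoints_subset disjoint_sym /nod => ->; rewrite !orbT.
Qed.

Lemma conn_subW L : conn L -> D \subset L -> L \subset W.
Proof.
move=> cL DL; case/or3P: (nodW cL) => [WL|//|]; last by rewrite (negbTE (meetD DW DL)).
have := cL _ _ lowerW lowerCW; rewrite setUCr subsetT.
rewrite -setI_eq0 setICr eqxx => /(_ isT isT)/orP[//|].
by rewrite -disjoints_subset (negbTE (meetD DL DW)).
Qed.

(** [W] and its complement are both lower, so the boundary of an element outside [W] avoids [W] and
    must lie in [X]. *)
Lemma fills_setU_W X : (X != set0 -> fills X) -> fills (X :|: W).
Proof.
move=> fX y yXW; have [y0|y0] := eqVneq (boundary y) set0.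
  have [m] := @arg_minnP _ x [in W] (fun m => #|boundary m|) xW.
  rewrite /= => mW mmin; exists m; first by rewrite in_setU mW orbT.
  rewrite y0; apply/eqP/set0Pn => -[w wm].
  have wW := subsetP (lower_boundary lowerW mW) w wm.
  have := mmin w wW; apply/negP; rewrite -ltnNge; apply: proper_card.
  apply/properP; split; last by exists w; rewrite // inE ltxx.
  by move: wm; rewrite inE => wm; apply/subsetP => z; rewrite !inE => /lt_trans; apply.
have [yW|yW] := boolP (y \in W); first by exists y; rewrite // in_setU yW orbT.
have yX : boundary y \subset X.
  apply/subsetP => z zy; have := subsetP yXW z zy; rewrite in_setU => /orP[//|zW].
  have := lower_boundary lowerCW (_ : y \in ~: W).
  by rewrite in_setC yW => /(_ isT)/subsetP/(_ z zy); rewrite in_setC zW.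
have /fX/(_ y yX)[z zX zy] : X != set0.
  have /set0Pn[z zy] := y0; apply/set0Pn; exists z; exact: subsetP yX z zy.
by exists z; rewrite // in_setU zX.
Qed.

Lemma fillsW : fills W.
Proof. by rewrite -[W]set0U; apply: fills_setU_W; rewrite eqxx. Qed.

Lemma fills_family F : (F :\ W != set0 -> fills (cover (F :\ W))) ->
  F != set0 -> fills (cover F).
Proof.
move=> fF F0; have [WF|WF] := boolP (W \in F); last first.
  have E : F :\ W = F by apply/setDidPl; rewrite disjoint_sym disjoints1.
  by rewrite E in fF; exact: fF.
have -> : cover F = cover (F :\ W) :|: W.
  by rewrite /cover (big_setD1 W) //= setUC.
apply: fills_setU_W => c0; apply: fF; apply: contraNneq c0 => ->.
by rewrite /cover big_set0.
Qed.

(* The largest member of [F] containing [x] is a union of connected components. *)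
Lemma cover_setT_W F : (forall t, t \in F -> lower_set t) -> (forall t, t \in F -> conn t) ->
  (forall s t, s \in F -> t \in F -> nod s t) -> cover F = setT -> W \in F.
Proof.
move=> lF cF nF covF; have /bigcupP[t0 t0F xt0] : x \in cover F by rewrite covF.
have t0P : (t0 \in F) && (x \in t0) by rewrite t0F.
have [t /= /andP[tF xt] tmax] := @arg_maxnP _ t0 [pred t | (t \in F) && (x \in t)]
  (fun t => #|t|) t0P.
suff <- : t = W by [].
apply/eqP; rewrite eqEsubset conn_subW ?(lower_boundary (lF t tF) xt) //=; last exact: cF.
have lCt : lower_set (~: t).
  apply/lower_setP => y z; rewrite !in_setC => yt zy; apply/negP => zt.
  have /bigcupP[s sF ys] : y \in cover F by rewrite covF.
  have zs := lower_setP _ (lF s sF) _ _ ys zy.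
  case/or3P: (nF s t sF tF) => [/subsetP/(_ y ys)|ts|/disjointI/(_ zs)].
  - by rewrite (negbTE yt).
  - have st : #|s| <= #|t| by apply: tmax; rewrite sF (subsetP ts).
    have /eqP ts' : t == s by rewrite eqEcard ts.
    by rewrite ts' ys in yt.
  - by rewrite zt.
have := connW (lF t tF) lCt; rewrite setUCr subsetT -setI_eq0 setICr eqxx.
move=> /(_ isT isT)/orP[//|/subsetP/(_ x xW)].
by rewrite in_setC xt.
Qed.

Lemma facet_eq y z : y \in b -> W :\ y = W :\ z -> y = z.
Proof.
move=> yb /setP/(_ y); rewrite !in_setD1 eqxx (subsetP bW y yb) !andbT.
by move=> /esym/negbFE/eqP.
Qed.

Lemma D_facet y : y \in b -> D \subset W :\ y.
Proof. by move=> yb; rewrite subsetD1 DW; apply/negP => /boundary_disjoint_b; rewrite yb. Qed.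

Lemma facet_Ub y : y \in b -> W :\ y :|: b = W.
Proof.
move=> yb; apply/setP => v; rewrite in_setU in_setD1.
have [->|_] := eqVneq v y; first by rewrite yb (subsetP bW).
by have := subsetP bW v; case: (v \in b) => [->|] //; rewrite ?orbF.
Qed.

Lemma bundle_other y : y \in b -> exists2 z, z \in b & z != y.
Proof.
move=> yb; apply/exists_inP; apply: contraNT bN1 => /exists_inPn h.
apply/eqP/setP => z; rewrite in_set1; apply/idP/eqP => [zb|->]; last exact: x_in_b.
by have /negbNE/eqP-> := h z zb; have /negbNE/eqP-> := h x x_in_b.
Qed.

Lemma conn_facet y : y \in b -> conn (W :\ y).
Proof.
move=> yb; have [z zb zy] := bundle_other yb.
apply: (@conn_of_Ub _ z) => //; first exact: lower_D1 lowerW yb.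
  by rewrite in_setD1 zy (subsetP bW).
by rewrite facet_Ub //; exact: connW.
Qed.

(** Forgets which bundle elements a tube contains: what remains is a tube of the smaller poset with
    the whole bundle for [x]. Facets [W :\ y] all become [W]. *)
Definition sat L := if D \subset L then L :|: b else L.

Lemma sub_sat L : L \subset sat L.
Proof. by rewrite /sat; case: ifP => // _; exact: subsetUl. Qed.

Lemma sat_large L : b \subset L -> sat L = L.
Proof. by move=> bL; rewrite /sat (setUidPl bL); case: ifP. Qed.

Lemma sat_facet y : y \in b -> sat (W :\ y) = W.
Proof. by move=> yb; rewrite /sat D_facet // facet_Ub. Qed.

Lemma small_notin L y : lower_set L -> ~~ (D \subset L) -> y \in b -> y \notin L.
Proof. by move=> lL DL yb; apply: contra DL => yL; exact: lower_D yL yb. Qed.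

Lemma sat_mono K L : K \subset L -> sat K \subset sat L.
Proof.
move=> KL; rewrite /sat; case: ifP => DK; first by rewrite (subset_trans DK KL) setSU.
by case: ifP => // _; rewrite subsetU ?KL.
Qed.

Record partial_tube L : Prop := PartialTube {
  partial_tube_lower : lower_set L;
  partial_tube_conn : conn L;
  partial_tube_fills : fills L;
  partial_tube_D : D \subset L;
  partial_tube_b : ~~ (b \subset L);
  partial_tube_facet : forall y, y \in b -> L != W :\ y }.

Definition partial_tubes : {set {set P}} := [set L | `[< partial_tube L >]].

Lemma partial_tubesP L : reflect (partial_tube L) (L \in partial_tubes).
Proof. by rewrite inE; exact: asboolP. Qed.

Definition partial_face L : {set {set P}} :=
  [set K in [set L :|: b] | K != W] :|: [set W :\ y | y in b :\: L].

Lemma partial_faceP L K : reflect ((K = L :|: b /\ K != W) \/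
  exists y, [/\ y \in b, y \notin L & K = W :\ y]) (K \in partial_face L).
Proof.
rewrite !inE; apply: (iffP orP) => -[].
- by move=> /andP[/eqP-> ?]; left.
- by move=> /imsetP[y]; rewrite in_setD => /andP[yL yb] ->; right; exists y.
- by move=> [-> ->]; left; rewrite eqxx.
- by move=> [y [yb yL ->]]; right; apply/imsetP; exists y; rewrite // in_setD yL.
Qed.

Lemma partial_tube_bundle L : partial_tube L -> exists2 y, y \in L & y \in b.
Proof.
move=> LN; have [z zL /eqP zD] := partial_tube_fills LN (partial_tube_D LN).
by exists z; rewrite // bundleE.
Qed.

Lemma partial_tube_sub_W L : partial_tube L -> L \subset W.
Proof. by move=> LN; apply: conn_subW; [exact: partial_tube_conn|exact: partial_tube_D]. Qed.

Lemma partial_tube_notin L : partial_tube L -> exists2 y, y \in b & y \notin L.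
Proof. by move=> /partial_tube_b/subsetPn[y]; exists y. Qed.

Lemma partial_tube_intro L y : y \in L -> y \in b -> lower_set L -> conn (L :|: b) ->
  fills (L :|: b) -> ~~ (b \subset L) -> (forall y, y \in b -> L != W :\ y) ->
  L \in partial_tubes.
Proof.
move=> yL yb lL cL fL bL LW; apply/partial_tubesP; split => //.
- exact: conn_of_Ub yL yb cL.
- exact: fills_of_Ub yL yb fL.
- exact: lower_D yL yb.
Qed.

Lemma partial_face_not_partial L K : K \in partial_face L -> K \notin partial_tubes.
Proof.
move=> /partial_faceP KL; apply/negP => /partial_tubesP[_ _ _ _ bK KW].
case: KL => [[KE _]|[y [yb _ KE]]]; first by rewrite KE subsetUr in bK.
by have := KW y yb; rewrite KE eqxx.
Qed.

Lemma partial_face_neq0 L : partial_tube L -> partial_face L != set0.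
Proof.
move=> /partial_tube_notin[y yb yL]; apply/set0Pn; exists (W :\ y); apply/partial_faceP; right.
by exists y.
Qed.

Lemma W_notin_partial_face L : W \notin partial_face L.
Proof.
apply/negP => /partial_faceP[[_]|[y [yb _ /setP/(_ y)]]]; first by rewrite eqxx.
by rewrite !in_setD1 eqxx (subsetP bW).
Qed.

Lemma partial_face_sub_W L K : partial_tube L -> K \in partial_face L -> L \subset K /\ K \subset W.
Proof.
move=> LN /partial_faceP[[-> _]|[y [yb yL ->]]].
  by rewrite subsetUl subUset partial_tube_sub_W // bW.
by rewrite subsetDl subsetD1 partial_tube_sub_W.
Qed.

Lemma partial_face_D L K : partial_tube L -> K \in partial_face L -> D \subset K.
Proof. by move=> LN /(partial_face_sub_W LN)[LK _]; exact: subset_trans (partial_tube_D LN) LK. Qed.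

(* [old L] : a tube of [P - (b - x)], with [x] replaced by the whole of [b]. *)
Definition old L : Prop := [/\ lower_set L, conn L & D \subset L -> b \subset L].

(** [W] is always included, so that facets can enter or leave [T] without changing the family; it
    crosses no connected set and spoils no filling. *)
Definition family T : {set {set P}} := W |: [set sat t | t : {set P} in T].

(** Nestedness and filling are asked of saturations, where partial tubes and facets leave no trace
    of the bundle elements they omit. [partial_stage_pt] says that the facets in [T] are not all
    those of the simplex, and persists when partial tubes appear. [partial_stage_cover] concerns [W]
    alone, because by [cover_setT_W] a tubing-like family covering [P] contains [W]. *)
Record partial_stage S T : Prop := PartialStage {
  partial_stage_kind : forall t, t \in T ->
    [\/ old t, exists2 y, y \in b & t = W :\ y | t \in S];
  partial_stage_nod : forall s t, s \in family T -> t \in family T -> nod s t;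
  partial_stage_fills : forall F, F \subset family T -> F != set0 -> fills (cover F);
  partial_stage_pt : exists2 y, y \in b & forall t, t \in T -> D \subset t -> y \in t;
  partial_stage_chain : forall s t, s \in S -> s \in T -> t \in T -> D \subset t ->
    s \subset t \/ (t \in S /\ t \subset s);
  partial_stage_sg : forall L, L \in S -> ~~ (partial_face L \subset T);
  partial_stage_cover : W \in T -> cover T != setT }.

Lemma partial_stage_sub S T T' : partial_stage S T -> T' \subset T -> partial_stage S T'.
Proof.
move=> [kT nT fT [y yb pT] chT sgT covT] T'T; have /subsetP sub := T'T.
have famS : family T' \subset family T by apply: setUS; exact: imsetS.
split.
- by move=> t /sub; exact: kT.
- by move=> s t /(subsetP famS) sT /(subsetP famS); exact: nT.
- by move=> F /subset_trans/(_ famS); exact: fT.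
- by exists y => // t /sub; exact: pT.
- by move=> s t sS /sub sT /sub; exact: chT.
- by move=> L /sgT; apply: contra => /subset_trans; apply.
- move=> /sub/covT; apply: contra => /eqP cT'; rewrite -subTset -cT'.
  by apply/bigcupsP => t /sub tT; exact: bigcup_sup.
Qed.

(** * A single cut in the nontrivial case *)

Section Step.
Context (S : {set {set P}}) (L : {set P}).
Hypothesis SN : S \subset partial_tubes.
Hypothesis LN : L \in partial_tubes :\: S.
Hypothesis Ssmall : forall L', L' \in partial_tubes -> #|L'| < #|L| -> L' \in S.
Hypothesis smallS : forall L', L' \in S -> #|L'| <= #|L|.

Let LS : L \notin S. Proof. by move: LN; rewrite inE => /andP[]. Qed.
Let Lnew : partial_tube L. Proof. by apply/partial_tubesP; move: LN; rewrite inE => /andP[]. Qed.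
Let LUb : sat L = L :|: b. Proof. by rewrite /sat (partial_tube_D Lnew). Qed.
Let LW : L \subset W. Proof. exact: partial_tube_sub_W. Qed.
Let SLN : L |: S \subset partial_tubes.
Proof. by rewrite subUset sub1set SN andbT; apply/partial_tubesP. Qed.

(** [L] and [L :|: b] have the same saturation and the facets saturate to [W]. So the cut does not
    affect the conditions on nestedness and filling. *)
Lemma family_step T : L \in T -> family ((T :\ L) :|: partial_face L) = family T.
Proof.
move=> LT; apply/setP => K; rewrite !in_setU1; have [//|KW /=] := eqVneq K W.
apply/imsetP/imsetP => -[t tT KE]; last first.
  have [tL|tL] := eqVneq t L; last by exists t; rewrite // !inE tL tT.
  rewrite tL LUb in KE; exists K; last by rewrite sat_large // KE subsetUr.
  by rewrite in_setU; apply/orP; right; apply/partial_faceP; left; split.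
move: tT; rewrite in_setU => /orP[|/partial_faceP[[tE _]|[y [yb _ tE]]]].
- by rewrite !inE => /andP[_ tT]; exists t.
- by exists L; rewrite // KE tE LUb sat_large // subsetUr.
- by move: KW; rewrite KE tE sat_facet // eqxx.
Qed.

Lemma partial_stage_step_to T : L \in T -> partial_stage (L |: S) T ->
  partial_stage S ((T :\ L) :|: partial_face L).
Proof.
move=> LT [kT nT fT [y0 y0b pT] chT sgT covT].
set T' := (T :\ L) :|: partial_face L.
have T'P t : t \in T' -> (t \in T /\ t != L) \/ t \in partial_face L.
  by rewrite !in_setU !in_setD in_set1 => /orP[/andP[-> ->]|->]; [left|right].
have notN K L' : K \in partial_face L' -> K \in L |: S -> False.
  by move=> /partial_face_not_partial/negP KN /(subsetP SLN).
split; rewrite ?family_step //.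
- move=> t /T'P[[tT tL]|/partial_faceP[[-> _]|[y [yb yL ->]]]].
  + case: (kT t tT) => [?|?|]; [by constructor 1|by constructor 2|].
    by rewrite in_setU1 (negbTE tL); constructor 3.
  + constructor 1; split; [exact: lower_Ub (partial_tube_lower Lnew) (partial_tube_D Lnew)| |by rewrite subsetUr].
    exact: conn_Ub (partial_tube_lower Lnew) (partial_tube_D Lnew) (partial_tube_conn Lnew).
  + by constructor 2; exists y.
- exists y0 => // t /T'P[[tT _]|]; first exact: pT.
  have y0L := pT L LT (partial_tube_D Lnew).
  move=> tL _; have [Lt _] := partial_face_sub_W Lnew tL; exact: subsetP Lt y0 y0L.
- move=> s t sS /T'P[[sT sL]|/partial_face_not_partial/negP sN]; last by case: sN; exact: subsetP SN s sS.
  have sLS : s \in L |: S by rewrite in_setU1 sS orbT.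
  move=> /T'P[[tT tL] Dt|tL _].
    have [|[]] := chT s t sLS sT tT Dt; first by left.
    by rewrite in_setU1 (negbTE tL); right.
  left; have [Lt _] := partial_face_sub_W Lnew tL; apply: subset_trans Lt.
  have [//|[_ Ls]] := chT s L sLS sT LT (partial_tube_D Lnew).
  have /eqP E : L == s by rewrite eqEcard Ls smallS.
  by rewrite E eqxx in sL.
- move=> L' L'S; apply/negP => /subsetP L'T.
  have /partial_tubesP L'N := subsetP SN L' L'S.
  have above K : K \in partial_face L' -> L \subset K.
    move=> KL'; have [[KT KL]|KL] := T'P K (L'T K KL'); last by have [] := partial_face_sub_W Lnew KL.
    by have [//|[/(notN _ _ KL')]//] := chT L K (setU11 _ _) LT KT (partial_face_D L'N KL').
  (* [L'] is the intersection of the members of its simplex, and all of them contain [L]. *)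
  have LL' : L \subset L'.
    apply/subsetP => v vL; have [vb|vb] := boolP (v \in b).
      apply: contraT => vL'; have LWv : L \subset W :\ v.
        by apply: above; apply/partial_faceP; right; exists v.
      by have := subsetP LWv v vL; rewrite !inE eqxx.
    have : v \in L' :|: b; last by rewrite in_setU (negbTE vb) orbF.
    have [->|L'W] := eqVneq (L' :|: b) W; first exact: subsetP vL.
    by apply: (subsetP (above (L' :|: b) _)) => //; apply/partial_faceP; left.
  have /eqP E : L == L' by rewrite eqEcard LL' smallS.
  by have := LS; rewrite E L'S.
- rewrite in_setU (negbTE (W_notin_partial_face L)) orbF in_setD => /andP[_ WT].
  apply: contra (covT WT) => /eqP cT'; rewrite -subTset -cT'.
  apply/bigcupsP => t /T'P[[tT _]|tL]; first exact: bigcup_sup.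
  by have [_ tW] := partial_face_sub_W Lnew tL; apply: subset_trans tW _; exact: (bigcup_sup W).
Qed.

Lemma partial_stage_step_of T : L \in T -> ~~ (partial_face L \subset T) ->
  partial_stage S ((T :\ L) :|: partial_face L) -> partial_stage (L |: S) T.
Proof.
move=> LT sgLT [kT nT fT [y0 y0b pT] chT sgT covT].
set T' := (T :\ L) :|: partial_face L in kT nT fT pT chT sgT covT.
rewrite !(family_step LT) in nT fT.
have TT' t : t \in T -> t != L -> t \in T' by move=> tT tL; rewrite !inE tT tL.
have sgT' K : K \in partial_face L -> K \in T' by move=> KL; rewrite in_setU KL orbT.
have TP t : t \in T -> t = L \/ (t != L /\ t \in T').
  by move=> tT; have [->|tL] := eqVneq t L; [left|right; split; rewrite ?TT'].
have LD := partial_tube_D Lnew; have lL := partial_tube_lower Lnew.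
(* Otherwise the facet [W :\ y0], a member of the simplex of [L], would be a tube above [D] without
   [y0]. *)
have y0L : y0 \in L.
  apply: contraT => y0L; have y0s : W :\ y0 \in partial_face L by apply/partial_faceP; right; exists y0.
  by have := pT _ (sgT' _ y0s) (D_facet y0b); rewrite !inE eqxx.
have below s : s \in S -> s \in T -> s \subset L.
  move=> sS sT; have sNL : s != L by apply: contraNneq LS => <-.
  have sK K : K \in partial_face L -> s \subset K.
    move=> KL; have [//|[KS _]] := chT s K sS (TT' s sT sNL) (sgT' K KL) (partial_face_D Lnew KL).
    by case/negP: (partial_face_not_partial KL); exact: subsetP SN K KS.
  have /partial_tubesP sN := subsetP SN s sS.
  apply/subsetP => v vs; have [vb|vb] := boolP (v \in b).
    apply: contraT => vL; have sWv : s \subset W :\ v by apply: sK; apply/partial_faceP; right; exists v.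
    by have := subsetP sWv v vs; rewrite !inE eqxx.
  have : v \in L :|: b; last by rewrite in_setU (negbTE vb) orbF.
  have [->|LbW] := eqVneq (L :|: b) W; first exact: subsetP (partial_tube_sub_W sN) v vs.
  by apply: (subsetP (sK (L :|: b) _)) => //; apply/partial_faceP; left.
have noS L' : L' \in partial_tubes -> #|L'| < #|L| -> ~~ (partial_face L' \subset T').
  by move=> L'N L'L; apply: sgT; exact: Ssmall.
have chL t : t \in T -> D \subset t -> L \subset t \/ (t \in L |: S /\ t \subset L).
  move=> tT Dt; have [->|[tL tT']] := TP t tT; first by left.
  case: (kT t tT') => [[lt ct /(_ Dt) bt]|[y yb tE]|tS]; last first.
  - by right; rewrite in_setU1 tS orbT; split => //; exact: below.
  (* If [y] were in [L], the smaller partial tube [L :\ y] would have its whole simplex in [T']: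
     that of [L] together with [W :\ y]. *)
  - left; rewrite tE subsetD1 LW /=; apply/negP => yL.
    have y0y : y0 != y.
      by have := pT t tT' Dt; rewrite tE !inE => /andP[].
    have E : L :\ y :|: b = L :|: b.
      apply/setP => v; rewrite !in_setU in_setD1.
      by have [->|//] := eqVneq v y; rewrite yb !orbT.
    have /noS/(_ _)/negP : L :\ y \in partial_tubes.
      apply: (@partial_tube_intro _ y0) => //.
      + by rewrite !inE y0y.
      + exact: lower_D1 lL yb.
      + by rewrite E; exact: conn_Ub lL LD (partial_tube_conn Lnew).
      + by rewrite E; exact: fills_Ub (partial_tube_fills Lnew).
      + by apply: contra (partial_tube_b Lnew) => /subset_trans; apply; exact: subsetDl.
      + move=> y1 y1b; apply/eqP => E1; have := y1b; have := yb.
        have yy1 : y = y1.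
          have /setP/(_ y) := E1; rewrite !in_setD1 eqxx (subsetP bW y yb) !andbT.
          by move=> /esym/negbFE/eqP.
        case/negP: (partial_tube_b Lnew); apply: subset_trans bW _.
        by rewrite -(setD1K yL) E1 -yy1 (setD1K (subsetP bW y yb)).
    case; first exact/proper_card/properD1.
    apply/subsetP => K /partial_faceP[[-> KW]|[y1 [y1b y1L ->]]].
      by rewrite E; apply: sgT'; apply/partial_faceP; left; rewrite -E.
    have [y1y|y1y] := eqVneq y1 y; first by rewrite y1y -tE.
    apply: sgT'; apply/partial_faceP; right; exists y1; split => //.
    by move: y1L; rewrite !inE y1y.
  - have tF : t \in family T by rewrite in_setU1; apply/orP; right; apply/imsetP; exists t; rewrite ?sat_large.
    have LF : L :|: b \in family T by rewrite in_setU1 -LUb imset_f ?orbT.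
    case/or3P: (nT _ _ LF tF) => [Lt|tL'|].
    + by left; apply: subset_trans Lt; exact: subsetUl.
    (* Otherwise [L :&: t] is a smaller partial tube with saturation [t]. It omits the same bundle
       elements as [L], so its simplex lies in [T']. *)
    + have [Lt|Lt] := boolP (L \subset t); first by left.
      exfalso; have E : L :&: t :|: b = t.
        by rewrite setUIl (setUidPl bt); apply/setIidPr.
      have Lsm : L :&: t \proper L.
        by apply/properP; split; [exact: subsetIl|have /subsetPn[v vL vt] := Lt; exists v; rewrite // !inE vL].
      have /noS/(_ (proper_card Lsm))/negP : L :&: t \in partial_tubes.
        apply: (@partial_tube_intro _ y0) => //.
        * by rewrite in_setI y0L (subsetP bt).
        * apply/lower_setP => u v; rewrite !in_setI => /andP[uL ut] vu.
          by rewrite (lower_setP _ lL _ _ uL vu) (lower_setP _ lt _ _ ut vu).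
        * by rewrite E.
        * rewrite E; have := fT [set t]; rewrite sub1set tF /cover big_set1; apply => //.
          by apply/set0Pn; exists t; rewrite set11.
        * by apply: contra (partial_tube_b Lnew) => /subset_trans; apply; exact: subsetIl.
        * move=> y yb; apply/eqP => E1; have [yL|yL] := boolP (y \in L).
            case/negP: (partial_tube_b Lnew); apply: subset_trans bW _.
            by rewrite -(setD1K (subsetP bW y yb)) -E1 subUset sub1set yL subsetIl.
          have /eqP := partial_tube_facet Lnew yb; apply; apply/eqP; rewrite eqEsubset.
          by rewrite subsetD1 LW yL -E1 subsetIl.
      apply; apply/subsetP => K /partial_faceP[[-> KW]|[y1 [y1b y1L ->]]]; first by rewrite E.
      apply: sgT'; apply/partial_faceP; right; exists y1; split => //.
      by apply: contra y1L => y1L; rewrite in_setI y1L (subsetP bt).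
    + by rewrite (negbTE (meetD (subset_trans LD (subsetUl _ _)) Dt)).
split=> //.
- move=> t /TP[->|[_ /kT[? | ? | tS]]]; [|by constructor 1|by constructor 2|].
    by constructor 3; rewrite setU11.
  by constructor 3; rewrite in_setU1 tS orbT.
- by exists y0 => // t /TP[->//|[_ tT']]; exact: pT.
- move=> s t; rewrite in_setU1 => /predU1P[->|sS] sT tT Dt; first exact: chL.
  have sL : s != L by apply: contraNneq LS => <-.
  have [->|[tL tT']] := TP t tT; first by left; exact: below.
  have [|[tS ts]] := chT s t sS (TT' s sT sL) tT' Dt; first by left.
  by right; rewrite in_setU1 tS orbT.
- move=> L'; rewrite in_setU1 => /predU1P[->//|L'S].
  apply: contra (sgT L' L'S) => /subsetP L'T; apply/subsetP => K KL'.
  apply: TT'; first exact: L'T.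
  by apply: contraTneq KL' => ->; apply/negP => /partial_face_not_partial/negP; apply; apply/partial_tubesP.
- move=> WT; have WT' : W \in T'.
    by apply: TT' => //; apply: contraNneq (partial_tube_b Lnew) => <-; exact: bW.
  apply: contra (covT WT') => /eqP cT; rewrite -subTset -cT.
  apply/bigcupsP => t /TP[->|[_ tT']]; last exact: bigcup_sup.
  by apply: subset_trans LW _; exact: (bigcup_sup W).
Qed.

Lemma partial_stage_fresh T : partial_stage S T -> L \notin T.
Proof.
move=> ST; apply/negP => /(partial_stage_kind ST)[[_ _ /(_ (partial_tube_D Lnew))]|[y yb LE]|].
- by rewrite (negbTE (partial_tube_b Lnew)).
- by have := partial_tube_facet Lnew yb; rewrite LE eqxx.
- by rewrite (negbTE LS).
Qed.

(** As in the trivial case, this provides the membership of the simplex to be subdivided. *)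
Lemma partial_stage_single : partial_stage (L |: S) [set L].
Proof.
have famP K : K \in family [set L] -> K = W \/ K = L :|: b.
  by rewrite in_setU1 imset_set1 in_set1 LUb => /orP[/eqP->|/eqP->]; [left|right].
have LbW : L :|: b \subset W by rewrite subUset LW bW.
have [y0 y0L y0b] := partial_tube_bundle Lnew.
split.
- by move=> t /set1P->; constructor 3; rewrite setU11.
- by move=> s t /famP[]-> /famP[]->; rewrite /nod ?subxx ?LbW ?orbT.
- move=> F FF; apply: fills_family => F0.
  suff -> : F :\ W = [set L :|: b].
    by rewrite /cover big_set1; exact: fills_Ub (partial_tube_fills Lnew).
  have sub : F :\ W \subset [set L :|: b].
    apply/subsetP => K; rewrite in_setD1 => /andP[KW /(subsetP FF)/famP[KE|->]].
      by rewrite KE eqxx in KW.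
    by rewrite set11.
  by move: sub; rewrite subset1 (negbTE F0) orbF => /eqP.
- by exists y0 => // t /set1P->.
- by move=> s t _ /set1P-> /set1P-> _; left.
- move=> L' /(subsetP SLN)/partial_tubesP/partial_face_neq0/set0Pn[K KL'].
  apply/negP => /subsetP/(_ K KL')/set1P KL; have /negP := partial_face_not_partial KL'.
  by apply; rewrite KL; apply/partial_tubesP.
- by move=> /set1P WL; have := partial_tube_b Lnew; rewrite -WL bW.
Qed.

Lemma partial_stage_step_out T : L \notin T ->
  partial_stage (L |: S) T <-> ~~ (partial_face L \subset T) /\ partial_stage S T.
Proof.
move=> LT; have inS t : t \in T -> (t \in L |: S) = (t \in S).
  by move=> tT; rewrite in_setU1 (_ : t == L = false) //; apply: contraNF LT => /eqP<-.
split=> [[kT nT fT pT chT sgT covT]|[sgLT [kT nT fT pT chT sgT covT]]].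
  split; first by apply: sgT; rewrite setU11.
  split=> //.
  - by move=> t tT; have := kT t tT; rewrite inS.
  - move=> s t sS sT tT Dt; have := chT s t _ sT tT Dt; rewrite !inS //; exact.
  - by move=> L' L'S; apply: sgT; rewrite in_setU1 L'S orbT.
split=> //.
- by move=> t tT; rewrite inS //; exact: kT.
- by move=> s t + sT tT; rewrite !inS // => sS; exact: chT.
- by move=> L'; rewrite in_setU1 => /predU1P[->|/sgT].
Qed.

End Step.

Lemma partial_stage_lower_conn S T t : S \subset partial_tubes -> partial_stage S T -> t \in T ->
  lower_set t /\ conn t.
Proof.
move=> SN ST tT; case: (partial_stage_kind ST tT) => [[]//|[y yb ->]|/(subsetP SN)/partial_tubesP[]//].
by split; [exact: lower_D1 lowerW yb|exact: conn_facet].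
Qed.

Lemma partial_stage_last T : partial_stage partial_tubes T <-> tubing T.
Proof.
split=> [ST|/tubingP[cT lT nT fT covT]].
  have [kT nT fT [y0 y0b pT] chT sgT covT] := ST.
  have lT t : t \in T -> lower_set t by move=> /(partial_stage_lower_conn (subxx _) ST)[].
  have cT t : t \in T -> conn t by move=> /(partial_stage_lower_conn (subxx _) ST)[].
  have famT t : t \in T -> sat t \in family T.
    by move=> tT; rewrite in_setU1 imset_f ?orbT.
  have nodT s t : s \in T -> t \in T -> nod s t.
    move=> sT tT; have satn := nT _ _ (famT s sT) (famT t tT).
    have [Ds|Ds] := boolP (D \subset s); have [Dt|Dt] := boolP (D \subset t).
    - have newL s' t' : s' \in partial_tubes -> s' \in T -> t' \in T -> D \subset t' -> nod s' t'.
        move=> s'N s'T t'T Dt'; have [st|[_ ts]] := chT s' t' s'N s'T t'T Dt'.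
          by rewrite /nod st.
        by rewrite /nod ts orbT.
      (* A tube [K] containing the bundle and different from [W] would cross [W :\ y]; but these two
         form the simplex of the partial tube [K :\ y]. *)
      have facet_old y K : y \in b -> W :\ y \in T -> K \in T -> b \subset K ->
          nod (W :\ y) K.
        move=> yb yT KT bK; have DK := lower_D (lT K KT) (subsetP bK y yb) yb.
        have KW := conn_subW (cT K KT) DK.
        have [->|KneW] := eqVneq K W; first by rewrite /nod subsetDl.
        have y0y : y0 != y by have := pT _ yT (D_facet yb); rewrite !inE => /andP[].
        have E : K :\ y :|: b = K.
          apply/setP => v; rewrite in_setU in_setD1; have [->|_] := eqVneq v y.
            by rewrite yb (subsetP bK).
          by have := subsetP bK v; case: (v \in b) => [->|] //; rewrite ?orbF.
        have /sgT/negP : K :\ y \in partial_tubes.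
          apply: (@partial_tube_intro _ y0) => //.
          + by rewrite in_setD1 y0y (subsetP bK).
          + exact: lower_D1 (lT K KT) yb.
          + by rewrite E; exact: cT.
          + rewrite E; have := fT [set sat K]; rewrite sub1set famT // /cover big_set1 sat_large //.
            by apply => //; apply/set0Pn; exists K; rewrite set11.
          + by apply/negP => /subsetP/(_ y yb); rewrite !inE eqxx.
          + move=> y1 y1b; apply: contraNneq KneW => E1; apply/eqP.
            have yy1 : y = y1.
              have /setP/(_ y) := E1; rewrite !in_setD1 eqxx (subsetP bW y yb) !andbT.
              by move=> /esym/negbFE/eqP.
            by rewrite -(setD1K (subsetP bK y yb)) E1 -yy1 (setD1K (subsetP bW y yb)).
        case; apply/subsetP => K' /partial_faceP[[-> _]|[y1 [y1b y1K ->]]]; first by rewrite E.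
        by move: y1K; rewrite in_setD1 (subsetP bK y1 y1b) andbT negbK => /eqP->.
      case: (kT s sT) => [[ls cs /(_ Ds) bs]|[y yb sE]|sN]; last exact: newL.
        case: (kT t tT) => [[lt ct /(_ Dt) bt]|[y yb tE]|tN]; last by rewrite nodC; exact: newL.
          by rewrite !sat_large in satn.
        by rewrite nodC tE; apply: facet_old => //; rewrite -tE.
      case: (kT t tT) => [[lt ct /(_ Dt) bt]|[y' y'b tE]|tN]; last by rewrite nodC; exact: newL.
        by rewrite sE; apply: facet_old => //; rewrite -sE.
      have [yy'|yy'] := eqVneq y y'; first by rewrite sE tE yy' nod_refl.
      (* Two facets cross, but they form the simplex of [W] without both points. That is a partial
         tube because [y0] is still in it. *)
      exfalso; pose K := W :\: [set y; y'].
      have y0K : y0 \in K.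
        have := pT s sT Ds; have := pT t tT Dt; rewrite sE tE !in_setD1 in_setD in_set2.
        by move=> /andP[/negbTE-> ->] /andP[/negbTE-> _].
      have E : K :|: b = W.
        apply/setP => v; rewrite in_setU in_setD in_set2.
        have [->|_] := eqVneq v y; first by rewrite yb (subsetP bW y yb).
        have [->|_] := eqVneq v y'; first by rewrite y'b (subsetP bW y' y'b).
        by have := subsetP bW v; case: (v \in b) => [->|] //; rewrite ?orbF.
      have /sgT/negP : K \in partial_tubes.
        apply: (@partial_tube_intro _ y0) => //.
        + by apply: lower_Db lowerW _; rewrite subUset !sub1set yb y'b.
        + by rewrite E; exact: connW.
        + by rewrite E; exact: fillsW.
        + by apply/negP => /subsetP/(_ y yb); rewrite in_setD in_set2 eqxx.
        + move=> y1 y1b; apply/eqP => E1.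
          have h z : z \in [set y; y'] -> z \in b -> z = y1.
            move=> zyy zb; have /setP/(_ z) := E1.
            rewrite /K in_setD zyy in_setD1 (subsetP bW z zb) !andbT.
            by move=> /esym/negbFE/eqP.
          by case/eqP: yy'; rewrite (h y (set21 _ _) yb) (h y' (set22 _ _) y'b).
      case; apply/subsetP => K' /partial_faceP[[->]|[y1 [y1b y1K ->]]]; first by rewrite E eqxx.
      move: y1K; rewrite in_setD (subsetP bW y1 y1b) andbT negbK in_set2.
      by move=> /orP[/eqP->|/eqP->]; rewrite -?sE -?tE.
    - rewrite /sat Ds (negbTE Dt) in satn; case/or3P: satn => [st|ts|dst].
      + by case/negP: Dt; apply: subset_trans st; rewrite subsetU ?Ds.
      + rewrite /nod (_ : t \subset s) ?orbT //; apply/subsetP => v vt.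
        have := subsetP ts v vt; rewrite in_setU => /orP[//|vb].
        by have := small_notin (lT t tT) Dt vb; rewrite vt.
      + by rewrite /nod (disjointWl (subsetUl _ _) dst) !orbT.
    - rewrite /sat Dt (negbTE Ds) in satn; case/or3P: satn => [st|ts|dst].
      + rewrite /nod (_ : s \subset t) //; apply/subsetP => v vs.
        have := subsetP st v vs; rewrite in_setU => /orP[//|vb].
        by have := small_notin (lT s sT) Ds vb; rewrite vs.
      + by case/negP: Ds; apply: subset_trans ts; rewrite subsetU ?Dt.
      + by rewrite /nod (disjointWr (subsetUl _ _) dst) !orbT.
    - by rewrite /sat (negbTE Ds) (negbTE Dt) in satn.
  apply/tubingP; split => //.
  - move=> S' S'T S'0 y _ yS'.
    have [|||z /bigcupP[_ /imsetP[t tS' ->] zt] zy] := fT [set sat t | t : {set P} in S'] _ _ y.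
    + by apply: subset_trans (subsetUr _ _); exact: imsetS.
    + by have /set0Pn[t tS'] := S'0; apply/set0Pn; exists (sat t); exact: imset_f.
    + apply: subset_trans yS' _; apply/bigcupsP => t tS'.
      by apply: subset_trans (sub_sat t) _; apply: (bigcup_sup (sat t)); exact: imset_f.
    have tT := subsetP S'T t tS'.
    have [zt'|zt'] := boolP (z \in t); first by exists z => //; apply/bigcupP; exists t.
    move: zt; rewrite /sat; case: ifP => Dt; last by rewrite (negbTE zt').
    (* An element contributed by the saturation lies in the bundle, and [y0] is a bundle element
       present in every tube above [D]. *)
    rewrite in_setU (negbTE zt') => zb; exists y0; first by apply/bigcupP; exists t; rewrite // pT.
    by rewrite -zy; move: zb y0b; rewrite !bundleE => /eqP-> /eqP->.
  - move=> T0; rewrite subTset; apply/eqP => cT'.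
    have WT : W \in T by apply: cover_setT_W => //.
    by have := covT WT; rewrite cT' eqxx.
have cov1 (t : {set P}) : cover [set t] = t by rewrite /cover big_set1.
have fills1 t : t \in T -> fills t.
  move=> tT y yt; have := fT [set t]; rewrite sub1set cov1; apply => //.
  by apply/set0Pn; exists t; rewrite set11.
have bundleT t : t \in T -> D \subset t -> exists2 y, y \in t & y \in b.
  by move=> tT Dt; have [z zt /eqP zD] := fills1 t tT x Dt; exists z; rewrite ?bundleE.
have conn_sat t : t \in T -> conn (sat t).
  move=> tT; rewrite /sat; case: ifP => Dt; last exact: cT.
  exact: conn_Ub (lT t tT) Dt (cT t tT).
have kindT t : t \in T -> [\/ old t, exists2 y, y \in b & t = W :\ y | t \in partial_tubes].
  move=> tT; have [Dt|Dt] := boolP (D \subset t); last first.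
    by constructor 1; split; [exact: lT|exact: cT|rewrite (negbTE Dt)].
  have [bt|bt] := boolP (b \subset t); first by constructor 1; split; [exact: lT|exact: cT|].
  have [/exists_inP[y yb /eqP tE]|nfac] := boolP [exists y in b, t == W :\ y].
    by constructor 2; exists y.
  constructor 3; apply/partial_tubesP; split => //; [exact: lT|exact: cT|exact: fills1|].
  by move=> y yb; apply: contra nfac => /eqP->; apply/exists_inP; exists y.
have sat_nod s t : s \in T -> t \in T -> nod (sat s) (sat t).
  move=> sT tT; case/or3P: (nT s t sT tT) => [/sat_mono|/sat_mono|dst].
  - by rewrite /nod => ->.
  - by rewrite /nod => ->; rewrite orbT.
  rewrite /nod (_ : [disjoint sat s & sat t]) ?orbT // /sat.
  case: ifPn => Ds; case: ifPn => Dt //.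
  - by have := meetD Ds Dt; rewrite dst.
  - apply/pred0P => v /=; apply/negP; rewrite in_setU => /andP[/orP[vs|vb] vt].
      by have := disjointI dst vs; rewrite vt.
    by have := small_notin (lT t tT) Dt vb; rewrite vt.
  - apply/pred0P => v /=; apply/negP; rewrite in_setU => /andP[vs /orP[vt|vb]].
      by have := disjointI dst vs; rewrite vt.
    by have := small_notin (lT s sT) Ds vb; rewrite vs.
split.
- exact: kindT.
- move=> s t; rewrite !in_setU1 => /predU1P[->|/imsetP[s' s'T ->]] /predU1P[->|/imsetP[t' t'T ->]].
  + exact: nod_refl.
  + by apply: nodW; exact: conn_sat.
  + by rewrite nodC; apply: nodW; exact: conn_sat.
  + exact: sat_nod.
- move=> F FF; apply: fills_family => F0 y yF.
  pose S' := [set t in T | sat t \in F :\ W].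
  have FS' K : K \in F :\ W -> exists2 t, t \in S' & K = sat t.
    move=> KF; move: (KF); rewrite in_setD1 => /andP[/negbTE KW /(subsetP FF)].
    by rewrite in_setU1 KW => /imsetP[t tT KE]; exists t; rewrite // inE tT -KE.
  have [|||z /bigcupP[t]] := fT S' _ _ y (in_setT y).
  + by apply/subsetP => t; rewrite inE => /andP[].
  + by have /set0Pn[K /FS'[t tS' _]] := F0; apply/set0Pn; exists t.
  + rewrite -boundary_sub_b; apply: subset_trans yF _; apply/bigcupsP => K /FS'[t tS' ->].
    apply: (@subset_trans _ _ (t :|: b)).
      by rewrite /sat; case: ifP => // _; exact: subsetUl.
    by apply: setSU; exact: bigcup_sup.
  rewrite inE => /andP[tT tF] zt zy; exists z => //.
  by apply/bigcupP; exists (sat t) => //; exact: (subsetP (sub_sat t)).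
- have [/exists_inP[t0 t0T Dt0]|noD] := boolP [exists t in T, D \subset t]; last first.
    exists x; first exact: x_in_b.
    by move=> t tT Dt; case/negP: noD; apply/exists_inP; exists t.
  have t0P : (t0 \in T) && (D \subset t0) by rewrite t0T.
  (* A smallest tube above [D] lies in all the others, as two such tubes meet; being filled at [x],
     it contains a bundle element. *)
  have [t /= /andP[tT Dt] tmin] := @arg_minnP _ t0 [pred t | (t \in T) && (D \subset t)]
    (fun t => #|t|) t0P.
  have [y yt yb] := bundleT t tT Dt; exists y => // s sT Ds.
  case/or3P: (nT s t sT tT) => [st|/subsetP->//|].
    by have /eqP-> : s == t by rewrite eqEcard st tmin //= sT.
  by rewrite (negbTE (meetD Ds Dt)).
- move=> s t sN sT tT Dt; have /partial_tubesP sN' := sN.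
  case/or3P: (nT s t sT tT) => [st|ts|]; [by left| |by rewrite (negbTE (meetD (partial_tube_D sN') Dt))].
  case: (kindT t tT) => [[_ _ /(_ Dt) bt]|[y yb tE]|tN]; last by right.
    by have := partial_tube_b sN'; rewrite (subset_trans bt ts).
  left; rewrite tE subsetD1 (partial_tube_sub_W sN') /=; apply/negP => ys.
  case/negP: (partial_tube_b sN'); apply: subset_trans bW _.
  by rewrite -(setD1K (subsetP bW y yb)) subUset sub1set ys -tE.
(* Two members of the simplex of [L] always cross: [L :|: b] and some [W :\ y], or, when [L :|: b]
   is [W], two facets, since [L] is not a facet and so omits two bundle elements. *)
- move=> L LN; have /partial_tubesP LN' := LN; apply/negP => /subsetP sgT.
  have fac z : z \in b -> z \notin L -> W :\ z \in T.
    by move=> zb zL; apply: sgT; apply/partial_faceP; right; exists z.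
  have nod_fac z K : z \in b -> W :\ z \in T -> K \in T -> z \in K -> K \subset W -> D \subset K -> K = W.
    move=> zb zT KT zK KW DK; case/or3P: (nT _ _ zT KT) => [zK'|/subsetP/(_ z zK)|].
    - apply/eqP; rewrite eqEsubset KW -(setD1K (subsetP bW z zb)) subUset sub1set zK zK'.
      by [].
    - by rewrite !inE eqxx.
    - by rewrite (negbTE (meetD (D_facet zb) DK)).
  have [y yb yL] := partial_tube_notin LN'.
  have [LbW|LbW] := eqVneq (L :|: b) W; last first.
    move/eqP: (LbW); apply; apply: (nod_fac y) => //.
    + exact: fac.
    + by apply: sgT; apply/partial_faceP; left.
    + by rewrite in_setU yb orbT.
    + by rewrite subUset partial_tube_sub_W // bW.
    + by apply: subset_trans (partial_tube_D LN') _; exact: subsetUl.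
  have /subsetPn[v vW vL] : ~~ (W :\ y \subset L).
    apply: contra (partial_tube_facet LN' yb) => h.
    by rewrite eqEsubset h subsetD1 partial_tube_sub_W // yL.
  have [vy vW'] : v != y /\ v \in W by move: vW; rewrite in_setD1 => /andP[].
  have vb : v \in b by move: vW'; rewrite -LbW in_setU (negbTE vL).
  have := nod_fac y (W :\ v) yb (fac y yb yL) (fac v vb vL).
  rewrite in_setD1 eq_sym vy (subsetP bW y yb) => /(_ isT (subsetDl _ _) (D_facet vb)).
  by move=> /setP/(_ v); rewrite in_setD1 eqxx vW'.
- move=> WT; have : T != set0 by apply/set0Pn; exists W.
  by move=> /covT; rewrite subTset.
Qed.

(** * The product with the simplex as the initial complex *)

Local Notation A := (~: (b :\ x)).
Local Notation extend := (@extend _ P A).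
Local Notation restrict := (@restrict _ P A).
Local Notation k := (#|b|.-1).
Local Notation code := ({set induced A} + 'I_k.+1)%type.

Lemma in_A y : (y \in A) = (y == x) || (y \notin b).
Proof. by rewrite in_setC in_setD1 negb_and negbK. Qed.

Lemma lowerA : lower_set A.
Proof. by rewrite -setTD; apply: lower_Db lower_setT _; exact: subsetDl. Qed.

Lemma DA : D \subset A.
Proof. by apply/subsetP => y /boundary_disjoint_b yb; rewrite in_A yb orbT. Qed.

Lemma boundary_A y : boundary y \subset A.
Proof. by apply/subsetP => z /boundary_disjoint_b zb; rewrite in_A zb orbT. Qed.

Definition partial_uncode L : option ({set induced A} + 'I_k.+1) :=
  if [pick y in b | L == W :\ y] is Some y then Some (inr (bundle_idx x y)) else
  if lower_set L && ((D \subset L) ==> (b \subset L)) then Some (inl (restrict L)) else None.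

(** The tight sets of the product polytope, see [product_realizes]. *)
Definition joined (t : {set code}) : bool :=
  tubing (inl @^-1: t) && [exists j, inr j \notin t].

Definition is_facet L : bool := [exists y in b, L == W :\ y].

Lemma partial_uncode_facet y : y \in b -> partial_uncode (W :\ y) = Some (inr (bundle_idx x y)).
Proof.
move=> yb; rewrite /partial_uncode; case: pickP => [z /andP[_ /eqP/(facet_eq yb)->]//|/(_ y)].
by rewrite yb eqxx.
Qed.

Lemma partial_uncode_old L : ~~ is_facet L -> partial_uncode L =
  if lower_set L && ((D \subset L) ==> (b \subset L)) then Some (inl (restrict L)) else None.
Proof.
move=> nL; rewrite /partial_uncode; case: pickP => // z /andP[zb LE].
by case/exists_inP: nL; exists z.
Qed.

Lemma is_facetP L : reflect (exists2 y, y \in b & L = W :\ y) (is_facet L).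
Proof. by apply: (iffP exists_inP) => -[y yb /eqP]; exists y => //; apply/eqP. Qed.

Lemma large_not_facet L : b \subset L -> ~~ is_facet L.
Proof.
move=> bL; apply/is_facetP => -[y yb LE].
by have := subsetP bL y yb; rewrite LE !inE eqxx.
Qed.

Lemma small_not_facet L : ~~ (D \subset L) -> ~~ is_facet L.
Proof. by apply: contra => /is_facetP[y yb ->]; exact: D_facet. Qed.

Lemma extend_restrictI L : extend (restrict L) = L :&: A.
Proof. exact: imset_restrict. Qed.

Lemma setIA_small L : lower_set L -> ~~ (D \subset L) -> L :&: A = L.
Proof.
move=> lL DL; apply/setIidPl/subsetP => y yL; rewrite in_A; apply/orP; right.
by apply: contraL yL; exact: small_notin.
Qed.

Lemma setIA_large L : b \subset L -> L :&: A :|: b = L.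
Proof.
move=> bL; apply/setP => v; rewrite in_setU in_setI in_A.
have := subsetP bL v; case: (v \in b) => [->|] //; first by rewrite orbT.
by rewrite orbT andbT orbF.
Qed.

Lemma lower_setIA L : lower_set L -> lower_set (L :&: A).
Proof.
move=> lL; apply/lower_setP => u v; rewrite !in_setI => /andP[uL uA] vu.
by rewrite (lower_setP _ lL _ _ uL vu) (lower_setP _ lowerA _ _ uA vu).
Qed.

Lemma x_in_A : x \in A.
Proof. by rewrite in_A eqxx. Qed.

Lemma conn_setIA L : lower_set L -> (D \subset L -> b \subset L) ->
  conn (L :&: A) <-> conn L.
Proof.
move=> lL DbL; have [/[dup] DL /DbL bL|DL] := boolP (D \subset L); last first.
  by rewrite setIA_small.
have xL : x \in L := subsetP bL x x_in_b.
have lLA := lower_setIA lL; have xLA : x \in L :&: A by rewrite in_setI xL x_in_A.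
split=> cL.
  rewrite -(setIA_large bL); apply: conn_Ub => //.
  exact: lower_boundary.
by apply: (@conn_of_Ub _ x) => //; rewrite ?x_in_b // setIA_large.
Qed.

Lemma mem_relabel_facet (t : {set code}) y : y \in b ->
  (W :\ y \in relabel_set partial_uncode t) = (inr (bundle_idx x y) \in t).
Proof. by move=> yb; rewrite inE partial_uncode_facet. Qed.

Lemma mem_relabel_old (t : {set code}) L : ~~ is_facet L -> (L \in relabel_set partial_uncode t) =
  [&& lower_set L, (D \subset L) ==> (b \subset L) & restrict L \in inl @^-1: t].
Proof.
by move=> nL; rewrite inE partial_uncode_old // andbA; case: ifP => //= _; rewrite inE.
Qed.

Lemma partial_stage_first_to T : partial_stage set0 T ->
  exists2 t : {set code}, joined t & T = relabel_set partial_uncode t.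
Proof.
move=> ST; have [kT nT fT [y0 y0b pT] _ _ covT] := ST.
have oldT t : t \in T -> ~~ is_facet t -> old t.
  move=> tT nt; case: (kT t tT) => [//|tf|]; last by rewrite inE.
  by case/is_facetP: nt.
pose T0 := [set t in T | ~~ is_facet t].
have T0P t : t \in T0 -> t \in T /\ old t.
  by rewrite inE => /andP[tT nt]; split => //; exact: oldT.
have famT0 t : t \in T0 -> t \in family T.
  move=> /T0P[tT [lt ct bt]]; rewrite in_setU1; apply/orP; right; apply/imsetP.
  exists t => //; rewrite /sat; case: ifP => // Dt.
  by rewrite (setUidPl (bt Dt)).
have nodT0 s t : s \in T0 -> t \in T0 -> nod s t.
  by move=> /famT0 sF /famT0; exact: nT.
pose t0 : {set code} :=
  [set i | match i with inl L => L \in restrict @: T0 | inr j => W :\ bundle_pt j \in T end].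
have t0E : inl @^-1: t0 = restrict @: T0 by apply/setP => L; rewrite !in_set.
exists t0.
  apply/andP; split; last first.
    apply/existsP; exists (bundle_idx x y0); rewrite in_set bundle_idxK //.
    by apply/negP => /pT/(_ (D_facet y0b)); rewrite !inE eqxx.
  rewrite t0E; apply/(tubing_induced lowerA).
  have sP t : t \in extend @: (restrict @: T0) -> exists2 L, L \in T0 & t = L :&: A.
    by move=> /imsetP[_ /imsetP[L LT ->] ->]; exists L; rewrite ?extend_restrictI.
  split.
  - by move=> _ /sP[L /T0P[_ [lL cL bL]] ->]; apply/conn_setIA.
  - by move=> _ /sP[L /T0P[_ [lL _ _]] ->]; exact: lower_setIA.
  - move=> _ _ /sP[K KT ->] /sP[L LT ->]; rewrite /nod.
    case/or3P: (nodT0 K L KT LT) => [KL|LK|dKL].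
    + by rewrite setSI.
    + by rewrite (setSI _ LK) orbT.
    + by rewrite (disjointWl (subsetIl _ _)) ?orbT // (disjointWr (subsetIl _ _)).
  - move=> S' S'T S'0 y yA yS'.
    pose S2 := [set L in T0 | L :&: A \in S'].
    have S2F : S2 \subset family T by apply/subsetP => L; rewrite inE => /andP[/famT0].
    have S20 : S2 != set0.
      have /set0Pn[t tS'] := S'0; have [L LT tE] := sP t (subsetP S'T t tS').
      by apply/set0Pn; exists L; rewrite inE LT -tE.
    have [|z /bigcupP[L LS2 zL] zy] := fT S2 S2F S20 y.
      apply: subset_trans yS' _; apply/bigcupsP => t tS'.
      have [L LT tE] := sP t (subsetP S'T t tS'); rewrite tE.
      by apply: subset_trans (subsetIl _ _) _; apply: bigcup_sup; rewrite inE LT -tE.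
    move: LS2; rewrite inE => /andP[/T0P[LT [lL cL bL]] LS'].
    have [zA|] := boolP (z \in A).
      by exists z => //; apply/bigcupP; exists (L :&: A); rewrite // in_setI zL.
    rewrite in_A negb_or negbK => /andP[_ zb].
    have xL : x \in L := subsetP (bL (lower_D lL zL zb)) x x_in_b.
    exists x; last by move: zb; rewrite bundleE zy => /eqP.
    by apply/bigcupP; exists (L :&: A); rewrite // in_setI xL x_in_A.
  (* A cover of [A] gives a cover of [P] by old tubes, so [W] is among them, against
     [partial_stage_cover]. *)
  - move=> _; apply/negP => /subsetP AT.
    have AT0 v : v \in A -> v \in cover T0.
      move=> /AT/bigcupP[t /sP[L LT ->]]; rewrite in_setI => /andP[vL _].
      by apply/bigcupP; exists L.
    have covT0 : cover T0 = setT.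
      apply/setP => v; rewrite in_setT; have [vA|] := boolP (v \in A); first exact: AT0.
      rewrite in_A negb_or negbK => /andP[_ vb].
      have /bigcupP[L LT xL] := AT0 x x_in_A; have [_ [lL cL bL]] := T0P L LT.
      apply/bigcupP; exists L => //; apply: subsetP vb; apply: bL.
      exact: lower_boundary.
    have WT : W \in T.
      suff /T0P[] : W \in T0 by [].
      by apply: cover_setT_W covT0 => // t /T0P[_ []].
    case/eqP: (covT WT); apply/eqP; rewrite -subTset -covT0.
    by apply/bigcupsP => L /T0P[LT _]; exact: bigcup_sup.
apply/setP => L; have [/is_facetP[y yb ->]|nL] := boolP (is_facet L).
  by rewrite mem_relabel_facet // in_set bundle_idxK.
rewrite mem_relabel_old // t0E; apply/idP/and3P => [LT|[lL /implyP bL]].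
  have [lL _ bL] := oldT L LT nL; split=> //; first exact/implyP.
  by apply: imset_f; rewrite inE LT.
move=> /imsetP[K KT0 LK]; suff -> : L = K by have [] := T0P K KT0.
have [KT [lK _ bK]] := T0P K KT0.
(* An old set is determined by its trace on [A]: it contains the whole bundle or none of it,
   according to [D]. *)
have E : L :&: A = K :&: A by rewrite -!extend_restrictI LK.
have DE : (D \subset L) = (D \subset K).
  have subI K' : (D \subset K') = (D \subset K' :&: A) by rewrite subsetI DA andbT.
  by rewrite subI E -subI.
have [DK|DK] := boolP (D \subset K).
  by rewrite -(setIA_large (bK DK)) -E setIA_large // bL // DE.
by rewrite -(setIA_small lK DK) -E setIA_small // DE.
Qed.

Lemma partial_stage_first_of (t : {set code}) : joined t -> partial_stage set0 (relabel_set partial_uncode t).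
Proof.
move=> /andP[/(tubing_induced lowerA)[cT lT nT fT covT] /existsP[j0 j0t]].
set T := relabel_set _ _.
have oldP L : L \in T -> ~~ is_facet L ->
    [/\ lower_set L, conn L, D \subset L -> b \subset L & L :&: A \in extend @: (inl @^-1: t)].
  move=> LT nL; move: LT; rewrite mem_relabel_old // => /and3P[lL /implyP bL Lt].
  have LA : L :&: A \in extend @: (inl @^-1: t).
    by rewrite -extend_restrictI; apply: imset_f.
  by split=> //; apply/(conn_setIA lL bL)/cT.
have satP L : L \in T -> ~~ is_facet L -> sat L = L.
  move=> LT nL; have [_ _ bL _] := oldP L LT nL.
  by rewrite /sat; case: ifP => // /bL/setUidPl.
have famP K : K \in family T -> K = W \/ K \in T /\ ~~ is_facet K.
  rewrite in_setU1 => /predU1P[|/imsetP[L LT ->]]; first by left.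
  have [/is_facetP[y yb ->]|nL] := boolP (is_facet L); first by left; exact: sat_facet.
  by right; rewrite satP.
have nod_old K L : K \in T -> ~~ is_facet K -> L \in T -> ~~ is_facet L -> nod K L.
  move=> KT nK LT nL; have [lK cK bK KA] := oldP K KT nK; have [lL cL bL LA] := oldP L LT nL.
  have mono K' L' : lower_set K' -> lower_set L' -> (D \subset K' -> b \subset K') ->
      (D \subset L' -> b \subset L') -> K' :&: A \subset L' :&: A -> K' \subset L'.
    move=> lK' lL' bK' bL' sub; have sub' := subset_trans sub (subsetIl _ _).
    have [DK|DK] := boolP (D \subset K'); last by rewrite -(setIA_small lK' DK).
    rewrite -(setIA_large (bK' DK)) subUset sub' bL' //.
    by apply: subset_trans sub'; rewrite subsetI DK DA.
  case/or3P: (nT _ _ KA LA) => [h|h|h].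
  - by rewrite /nod mono.
  - by rewrite /nod (mono L K) ?orbT.
  - rewrite /nod (_ : [disjoint K & L]) ?orbT //; apply/pred0P => v /=.
    apply/negP => /andP[vK vL]; have [vA|] := boolP (v \in A).
      by have := disjointI h (_ : v \in K :&: A); rewrite !in_setI vK vL vA => /(_ isT).
    rewrite in_A negb_or negbK => /andP[_ vb].
    have := meetD (_ : D \subset K :&: A) (_ : D \subset L :&: A).
    by rewrite h !subsetI DA !(lower_D _ _ vb) // => /(_ isT isT).
split.
- move=> L LT; have [/is_facetP[y yb ->]|nL] := boolP (is_facet L).
    by constructor 2; exists y.
  by constructor 1; have [? ? ? _] := oldP L LT nL.
- move=> K L /famP[->|[KT nK]] /famP[->|[LT nL]].
  + exact: nod_refl.
  + by apply: nodW; have [] := oldP L LT nL.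
  + by rewrite nodC; apply: nodW; have [] := oldP K KT nK.
  + exact: nod_old.
- move=> F FF; apply: fills_family => F0 y.
  have FP K : K \in F :\ W -> K \in T /\ ~~ is_facet K.
    by rewrite in_setD1 => /andP[KW /(subsetP FF)/famP[KE|//]]; rewrite KE eqxx in KW.
  (* An element outside [A] has the same boundary as [x], which is in [A]. *)
  wlog yA : y / y \in A.
    move=> H; have [yA|] := boolP (y \in A); first exact: H yA.
    rewrite in_A negb_or negbK bundleE => /andP[_ /eqP->].
    exact: H x_in_A.
  move=> yF; pose S2 := [set L :&: A | L : {set P} in F :\ W].
  have [|||z /bigcupP[_ /imsetP[L LF ->] zL] zy] := fT S2 _ _ y yA.
  + by apply/subsetP => _ /imsetP[L /FP[LT nL] ->]; have [] := oldP L LT nL.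
  + by have /set0Pn[K KF] := F0; apply/set0Pn; exists (K :&: A); exact: imset_f.
  + apply/subsetP => v vy; have /bigcupP[L LF vL] := subsetP yF v vy.
    apply/bigcupP; exists (L :&: A); first exact: imset_f.
    by rewrite in_setI vL (subsetP (boundary_A y)).
  exists z => //; apply/bigcupP; exists L => //.
  by move: zL; rewrite in_setI => /andP[].
- exists (bundle_pt j0); first exact: bundle_ptP.
  move=> L LT DL; have [/is_facetP[y yb LE]|nL] := boolP (is_facet L); last first.
    by have [_ _ bL _] := oldP L LT nL; exact: subsetP (bL DL) _ (bundle_ptP j0).
  move: LT; rewrite LE mem_relabel_facet // => yt.
  rewrite in_setD1 (subsetP bW _ (bundle_ptP j0)) andbT.
  by apply: contraNneq j0t => yj; rewrite -(bundle_ptK j0) yj.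
- by move=> s L; rewrite inE.
- by move=> L; rewrite inE.
- move=> WT; have nW := large_not_facet bW; have [_ _ _ WA] := oldP W WT nW.
  have /covT : extend @: (inl @^-1: t) != set0 by apply/set0Pn; exists (W :&: A).
  apply: contra => /eqP cT'; apply/subsetP => v vA.
  have /bigcupP[L LT vL] : v \in cover T by rewrite cT' in_setT.
  have [/is_facetP[y yb LE]|nL] := boolP (is_facet L); last first.
    have [_ _ _ LA] := oldP L LT nL.
    by apply/bigcupP; exists (L :&: A); rewrite // in_setI vL.
  apply/bigcupP; exists (W :&: A); rewrite // in_setI vA andbT.
  by move: vL; rewrite LE in_setD1 => /andP[].
Qed.

Lemma partial_uncode_onto (t : {set code}) i : joined t -> i \in t -> exists L, partial_uncode L = Some i.
Proof.
move=> /andP[/(tubing_induced lowerA)[cT lT nT fT covT] _].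
case: i => [L|j] it; last first.
  by exists (W :\ bundle_pt j); rewrite partial_uncode_facet ?bundle_ptP // bundle_ptK.
have LT : extend L \in extend @: (inl @^-1: t) by apply: imset_f; rewrite inE.
have lL := lT _ LT; have LA := imset_val_sub L.
have [DL|DL] := boolP (D \subset extend L); last first.
  exists (extend L); rewrite partial_uncode_old ?small_not_facet // lL (negbTE DL) /=.
  by rewrite restrict_imset.
exists (extend L :|: b); rewrite partial_uncode_old; last by apply: large_not_facet; exact: subsetUr.
rewrite lower_Ub // subsetUr implybT /=; congr (Some (inl _)).
(* [x] is the only bundle element in [A], so a tube of [A] above [D] must contain it in order to be
   filled. *)
have xL : x \in extend L.
  have [|||z] := fT [set extend L] _ _ x x_in_A; rewrite ?sub1set //.
  - by apply/set0Pn; exists (extend L); rewrite set11.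
  - by rewrite /cover big_set1.
  rewrite /cover big_set1 => zL /eqP; rewrite -bundleE => zb.
  have := subsetP LA z zL; rewrite in_A zb orbF => /eqP zx.
  by rewrite zx in zL.
apply/setP => y; rewrite in_set in_setU mem_imset_val; have := valP y; rewrite in_A.
have [yx _|_ /= yb] := eqVneq (val y) x.
  by rewrite yx x_in_b orbT -(mem_imset_val L) yx xL.
by rewrite (negbTE yb) orbF.
Qed.

End NontrivialBundle.

(** * The case of an antichain *)

Section Antichain.
Context {d : Order.disp_t} {P : finPOrderType d} (x : P).
Local Notation b := (bundle x).
Hypothesis bmax : forall y z : P, y \in b -> ~~ (y < z)%O.
Hypothesis D0 : boundary x = set0.

(** A minimal element below [y] has empty boundary, so it is in the bundle, hence maximal and equal
    to [y]. *)
Lemma boundary_antichain (y : P) : boundary y = set0.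
Proof.
have [m] := @arg_minnP _ y [pred m | (m <= y)%O] (fun m => #|boundary m|) (lexx y).
rewrite inE => my mmin; have m0 : boundary m = set0.
  apply/eqP/set0Pn => -[w]; rewrite inE => wm.
  have := mmin w; rewrite inE (ltW (lt_le_trans wm my)) => /(_ isT).
  apply/negP; rewrite -ltnNge; apply: proper_card; apply/properP; split.
    by apply/subsetP => z; rewrite !inE => /lt_trans; apply.
  by exists w; rewrite inE ?ltxx.
have mb : m \in b by rewrite inE m0 D0.
by move: my; rewrite le_eqVlt (negbTE (bmax y mb)) orbF => /eqP <-.
Qed.

Lemma bundle_antichain (y : P) : y \in b.
Proof. by rewrite inE !boundary_antichain. Qed.

Lemma lower_antichain (L : {set P}) : lower_set L.
Proof.
apply/lower_setP => y z yL; rewrite le_eqVlt => /predU1P[->//|zy].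
by have := in_set0 z; rewrite -(boundary_antichain y) inE zy.
Qed.

Lemma tubing_antichain (T : {set {set P}}) : tubing T <->
  (forall t, t \in T -> exists y, t = [set y]) /\ exists y, [set y] \notin T.
Proof.
split=> [/tubingP[cT _ _ fT covT]|[T1 [y0 y0T]]].
  split=> [t tT|].
    have [|||u] := fT [set t] _ _ x (in_setT x); rewrite ?sub1set ?D0 ?sub0set //.
      by apply/set0Pn; exists t; rewrite set11.
    rewrite /cover big_set1 => ut _; exists u; apply/eqP.
    rewrite eqEsubset sub1set ut andbT.
    have := cT t tT _ _ (lower_antichain [set u]) (lower_antichain (t :\ u)).
    rewrite -setI_eq0 setIDA setIC -setIDA setDv setI0 eqxx setD1K // subxx.
    by move=> /(_ isT isT)/orP[//|/subsetP/(_ u ut)]; rewrite !inE eqxx.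
  have [->|/covT] := eqVneq T set0; first by exists x; rewrite in_set0.
  rewrite subTset => /eqP cT'; apply: contrapT => /forallNP h; apply: cT'.
  apply/setP => y; rewrite in_setT; apply/bigcupP; exists [set y]; last exact: set11.
  by apply/negPn/negP; exact: h.
apply/tubingP; split.
- move=> t /T1[y ->] U V _ _ _; rewrite !sub1set in_setU; exact.
- by move=> t _; exact: lower_antichain.
- move=> s t /T1[y ->] /T1[z ->]; rewrite /nod !sub1set !in_set1 disjoints1 in_set1 eq_sym.
  by case: (z == y).
- move=> S ST /set0Pn[s sS] y _ _; have [z sE] := T1 s (subsetP ST s sS).
  exists z; last by rewrite !boundary_antichain.
  by apply/bigcupP; exists s; rewrite // sE set11.
- move=> _; apply/negP => /subsetP/(_ y0 (in_setT _))/bigcupP[t tT y0t].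
  have [y tE] := T1 t tT; move: y0t; rewrite tE in_set1 => /eqP yy.
  by rewrite yy -tE tT in y0T.
Qed.

(** The bundle is all of [P], so the smaller poset is the single point [x] and its associahedron is
    a point. *)
Lemma tubing_induced_antichain (s : {set {set induced (~: (b :\ x))}}) :
  tubing s <-> s = set0.
Proof.
split=> [/(tubing_induced (lower_antichain _))[_ _ _ fs covs]|->]; last exact: tubing0.
apply/eqP/set0Pn => -[t ts].
have xA : x \in ~: (b :\ x) by rewrite !inE eqxx.
have tE : extend t \in extend (A := ~: (b :\ x)) @: s by exact: imset_f.
have [|||z] := fs [set extend t] _ _ x xA; rewrite ?sub1set ?D0 ?sub0set //.
  by apply/set0Pn; exists (extend t); rewrite set11.
rewrite /cover big_set1 => zt _.
have zx : z = x.
  have := subsetP (imset_val_sub t) z zt.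
  by rewrite in_setC in_setD1 bundle_antichain andbT negbK => /eqP.
have /covs/negP : extend (A := ~: (b :\ x)) @: s != set0 by apply/set0Pn; exists (extend t).
apply; apply/subsetP => v; rewrite in_setC in_setD1 bundle_antichain andbT negbK.
by move=> /eqP->; apply/bigcupP; exists (extend t) => //; rewrite zx in zt.
Qed.

Definition antichain_uncode (L : {set P}) : option ({set induced (~: (b :\ x))} + 'I_(#|b|.-1).+1) :=
  if [pick y | L == [set y]] is Some y then Some (inr (bundle_idx x y)) else None.

Lemma antichain_uncode_set1 y : antichain_uncode [set y] = Some (inr (bundle_idx x y)).
Proof.
rewrite /antichain_uncode; case: pickP => [z /eqP/set1_inj->//|/(_ y)].
by rewrite eqxx.
Qed.

(** The tubings of an antichain are the proper subsets of its singletons, just as the tight sets of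
    a simplex are the proper subsets of its facets. The product is thus already a realization,
    without any cut. *)
Lemma antichain_realizes {R : realType} m (K : set 'rV[R]_m) :
  realizes K (@tubing _ (induced (~: (b :\ x)))) ->
  realizes (prod_set K (simplex (#|b|.-1))) (@tubing _ P).
Proof.
have yb := bundle_antichain.
move=> KR; apply: (relabel_realizes (g := antichain_uncode) (product_realizes KR)).
- exists set0; rewrite /= (_ : inl @^-1: _ = set0) ?tubing0 /=.
    by apply/existsP; exists ord0; rewrite inE.
  by apply/setP => i; rewrite !inE.
- move=> t i /andP[/tubing_induced_antichain t0 _] it; case: i it => [L|j] it.
    have : L \in inl @^-1: t by rewrite in_set.
    by rewrite t0 in_set0.
  by exists [set bundle_pt j]; rewrite antichain_uncode_set1 bundle_ptK.
- move=> T; rewrite tubing_antichain; split=> [[T1 [y0 y0T]]|[t /andP[/tubing_induced_antichain t0]]].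
    exists [set i | if i is inr j then [set bundle_pt j] \in T else false].
      apply/andP; split; last first.
        by apply/existsP; exists (bundle_idx x y0); rewrite inE bundle_idxK.
      by apply/tubing_induced_antichain/setP => L; rewrite !inE.
    apply/setP => L; rewrite inE /antichain_uncode; case: pickP => [y /eqP->|L1].
      by rewrite inE bundle_idxK.
    by apply/negP => /T1[y LE]; have := L1 y; rewrite LE eqxx.
  move=> /existsP[j jt] ->; split=> [L|].
    rewrite inE /antichain_uncode; case: pickP => [y /eqP->|//].
    by exists y.
  by exists (bundle_pt j); rewrite inE antichain_uncode_set1 bundle_ptK.
Qed.

End Antichain.

Lemma truncations_nontrivial_bundle {R : realType} {d} {P : finPOrderType d} (x : P) m
    (K : set 'rV[R]_m) :
  (forall y z : P, y \in bundle x -> ~~ (y < z)%O) -> bundle x != [set x] ->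
  realizes K (@tubing _ (induced (~: (bundle x :\ x)))) ->
  exists Q', iterated_truncation (prod_set K (simplex (#|bundle x|.-1))) Q' /\
    realizes Q' (@tubing _ P).
Proof.
move=> bmax bN1 KR; have [D0|D0] := eqVneq (boundary x) set0.
  exists (prod_set K (simplex (#|bundle x|.-1))); split; first exact: Relation_Operators.rt_refl.
  exact: antichain_realizes.
have [|||Q' [it Q'R]] := @iterated_truncation_realizes R _ _ (partial_tubes x)
  (fun L => #|L|) (partial_face x) (fun S T => `[< partial_stage x S T >]) _ _ (prod_set K (simplex (#|bundle x|.-1))).
- move=> S s t /asboolP sS ts; apply/asboolP; exact: partial_stage_sub sS ts.
- move=> S L SN LN below above.
  have LN' : partial_tube x L by apply/partial_tubesP; move: LN; rewrite inE => /andP[].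
  split.
  + apply/asboolP.
    have := partial_stage_step_to bmax D0 SN LN above (set11 L) (partial_stage_single bmax D0 SN LN).
    by rewrite setDv set0U.
  + exact: partial_face_neq0.
  + move=> T /asboolP ST; exact: (partial_stage_fresh LN ST).
  + move=> T; rewrite /stellar; case: ifPn => LT; last first.
      apply/asboolP/andP => [/(partial_stage_step_out x S LT)[? ?]|[? /asboolP ?]].
        by split=> //; exact/asboolP.
      exact/(partial_stage_step_out x S LT).
    apply/asboolP/andP => [TS|[sgT /asboolP TS]].
      split; first by apply: partial_stage_sg TS _ _; rewrite setU11.
      apply/asboolP; exact: partial_stage_step_to.
    exact: (partial_stage_step_of bmax D0 SN LN below).
- apply: (relabel_realizes (g := @partial_uncode _ P x) (product_realizes KR)).
  + exists set0; rewrite /= (_ : inl @^-1: _ = set0) ?tubing0 /=.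
      by apply/existsP; exists ord0; rewrite inE.
    by apply/setP => i; rewrite !inE.
  + exact: partial_uncode_onto.
  + move=> T; split=> [/asboolP/(partial_stage_first_to bmax D0)//|[t jt ->]].
    apply/asboolP; exact: partial_stage_first_of.
exists Q'; split => //; apply: eq_realizes Q'R => T.
by apply/asboolP/idP => /(partial_stage_last bmax bN1 D0).
Qed.

(** * Longest chains *)

Section LongestChain.
Context {d : Order.disp_t} {P : finPOrderType d}.

(** The part of the chain below [x] lies in [boundary x = boundary y]; with [y] and [z] put on top
    of it, the chain would become longer. *)
Lemma top_bundle_max (x y z : P) : top_of_longest_chain x -> y \in bundle x -> ~~ (y < z)%O.
Proof.
move=> [C [chC maxC xC topC]]; rewrite inE => /eqP yx; apply/negP => yz.
have Cy c : c \in C :\ x -> (c < y)%O.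
  rewrite !inE => /andP[cx /topC]; rewrite le_eqVlt (negbTE cx) /= => cx'.
  have : c \in boundary x by rewrite inE.
  by rewrite -yx inE.
have below c : c \in C :\ x -> (c <= y)%O && (c <= z)%O.
  by move=> /Cy cy; rewrite (ltW cy) (ltW (lt_trans cy yz)).
have yC : y \notin C :\ x by apply/negP => /Cy; rewrite ltxx.
have zC : z \notin y |: C :\ x.
  rewrite in_setU1 negb_or (gt_eqF yz) /=; apply/negP => /Cy zy.
  by have := lt_trans yz zy; rewrite ltxx.
have chain' : chain (z |: (y |: C :\ x)).
  apply/forall_inP => u uE; apply/forall_inP => v vE.
  move: uE vE; rewrite !in_setU1 => /or3P[/eqP->|/eqP->|uC] /or3P[/eqP->|/eqP->|vC];
    rewrite /Order.comparable ?lexx ?(ltW yz) ?orbT //.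
  - by have /andP[_ ->] := below v vC; rewrite orbT.
  - by have /andP[-> _] := below v vC; rewrite orbT.
  - by have /andP[_ ->] := below u uC.
  - by have /andP[-> _] := below u uC.
  - move: uC vC; rewrite !inE => /andP[_ uC] /andP[_ vC].
    exact: (forall_inP (forall_inP chC u uC) v vC).
have := maxC _ chain'; rewrite !cardsU1 zC yC (cardsD1 x C) xC.
by rewrite ltnn.
Qed.

(** Lets the induction choose its own [x] in each smaller poset. *)
Lemma ex_top_of_longest_chain (p : P) : exists x : P, top_of_longest_chain x.
Proof.
have ch1 : chain [set p].
  by apply/forall_inP => u /set1P->; apply/forall_inP => v /set1P->; rewrite /Order.comparable lexx.
have [C chC maxC] := @arg_maxnP _ [set p] (@chain _ P) (fun C : {set P} => #|C|) ch1.
have [c cC] : exists c, c \in C.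
  by apply/card_gt0P; apply: leq_trans (maxC _ ch1); rewrite cards1.
have [x /= xC xmax] := @arg_maxnP _ c [in C] (fun y => #|boundary y|) cC.
exists x, C; split => // y yC.
have := forall_inP (forall_inP chC y yC) x xC; rewrite /Order.comparable => /orP[//|].
rewrite le_eqVlt => /predU1P[->//|xy].
have := xmax y yC; rewrite /= leqNgt => /negP; case; apply: proper_card; apply/properP.
split; last by exists x; rewrite inE ?ltxx.
by apply/subsetP => z; rewrite !inE => /lt_trans; apply.
Qed.

End LongestChain.

(** * Existence of realizations and conclusion *)

Lemma realizes_associahedron {R : realType} {d} {P : finPOrderType d} n (Q : set 'rV[R]_n) :
  realizes Q (@tubing _ P) -> poset_associahedron P Q.
Proof.
by move=> QR; split; [exact: realizes_polytope QR|exact: realizes_faces QR].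
Qed.

Lemma card_induced {d} {P : finPOrderType d} (A : {set P}) : #|{: induced A}| = #|A|.
Proof. by rewrite card_sub; apply: eq_card => y; rewrite inE. Qed.

Lemma card_removed_lt {d} {P : finPOrderType d} (B : {set P}) :
  B != set0 -> #|{: induced (~: B)}| < #|P|.
Proof.
move=> B0; rewrite card_induced cardsCs setCK ltn_subrL card_gt0 B0 /=.
by have /set0Pn[y _] := B0; apply/card_gt0P; exists y.
Qed.

Lemma bundle_rest {d} {P : finPOrderType d} (x : P) :
  bundle x != [set x] -> bundle x :\ x != set0.
Proof.
apply: contra => /eqP b0; apply/eqP.
have xb : x \in bundle x by rewrite inE.
by rewrite -(setD1K xb) b0 setU0.
Qed.

(** Both kinds of truncation lead from a poset with fewer elements to [P], so they also produce a
    starting polytope by induction. *)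
Lemma ex_realization {R : realType} {d} (P : finPOrderType d) :
  exists n (Q : set 'rV[R]_n), realizes Q (@tubing _ P).
Proof.
have [N] := ubnP #|P|; elim: N P => // N IH P; rewrite ltnS => PN.
have [P0|] := posnP #|P|.
  (* The empty poset gives the point of dimension 0, described by inequalities [0 <= 1] that are
     never tight. *)
  exists 0%N, [set: 'rV[R]_0]%classic; exists (fun=> True), (fun=> 0%R), (fun=> 1%R); split.
    split=> //; first by exists 0%R => y; case.
    by move=> y; split=> // _; split=> // L; rewrite dotp0l Num.Theory.ler01.
  have tE y : tight (fun=> 0%R : 'rV[R]_0) (fun=> 1%R) y = (set0 : {set {set P}}).
    by apply/setP => L; rewrite !inE dotp0l eq_sym oner_eq0.
  move=> T; split=> [/tubingP TT|[y _ <-]]; last by rewrite tE tubing0.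
  exists 0%R => //; rewrite tE; apply/esym/eqP/negPn/negP => /(tubing_cover TT).
  by case/negP; apply/subsetP => y; have := card0_eq P0 y.
move=> /card_gt0P[p _]; have [x xtop] := ex_top_of_longest_chain p.
have bmax y z : y \in bundle x -> ~~ (y < z)%O by exact: top_bundle_max.
have [xb|xb] := eqVneq (bundle x) [set x].
  have [|n [Q QR]] := IH (induced [set~ x]).
    apply: leq_trans PN; apply: card_removed_lt; apply/set0Pn; exists x; exact: set11.
  have [|Q' [_ Q'R]] := truncations_trivial_bundle _ xb QR; last by exists n, Q'.
  by move=> y; apply: bmax; rewrite inE.
have [|m [K KR]] := IH (induced (~: (bundle x :\ x))).
  by apply: leq_trans PN; apply: card_removed_lt; exact: bundle_rest.
have [Q' [_ Q'R]] := truncations_nontrivial_bundle bmax xb KR.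
by eexists; exists Q'.
Qed.

From mathcomp Require Import classical_sets functions reals.

Local Open Scope ring_scope.

Theorem theorem3p2 (R : realType) (d : Order.disp_t) (P : finPOrderType d)
    (x : P) (hx : top_of_longest_chain x) :
  (bundle x = [set x]%SET ->
     exists (n : nat) (Q Q' : set 'rV[R]_n),
       [/\ poset_associahedron (induced [set~ x]%SET) Q,
           poset_associahedron P Q'
         & iterated_truncation Q Q'])
  /\
  (bundle x <> [set x]%SET ->
     exists (m : nat) (K : set 'rV[R]_m) (n : nat) (Q Q' : set 'rV[R]_n),
       [/\ poset_associahedron (induced (~: (bundle x :\ x))%SET) K,
           polytope Q
             /\ combinatorially_equivalent Q
                  (prod_set K (simplex (#|bundle x|.-1))),
           poset_associahedron P Q'
         & iterated_truncation Q Q']).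
Proof.
have bmax y z : y \in bundle x -> ~~ (y < z)%O by exact: top_bundle_max.
split=> [xb|/eqP xb].
  have [n [Q QR]] := @ex_realization R _ (induced [set~ x]%SET).
  have [|Q' [it Q'R]] := truncations_trivial_bundle _ xb QR.
    by move=> y; apply: bmax; rewrite inE.
  by exists n, Q, Q'; split => //; exact: realizes_associahedron.
have [m [K KR]] := @ex_realization R _ (induced (~: (bundle x :\ x))%SET).
have [Q' [it Q'R]] := truncations_nontrivial_bundle bmax xb KR.
exists m, K, _, (prod_set K (simplex #|bundle x|.-1)), Q'.
split=> //; try exact: realizes_associahedron.
split; first exact: realizes_polytope (product_realizes KR).
by exists id; split => //; split => // F QF; exists F.
Qed.
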